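(* For $\mu\in(0,1]$ let $q^\mu=(q_1^\mu,q_2^\mu)\colon[0,T]\to\mathbb R^2$ be a $\mu$-frozen planet orbit constructed by the mountain pass procedure described in the context, i.e. a solution of $$\ddot q_1=f'(|q_1|)+\mu g'(|q_2-q_1|),\qquad \ddot q_2=f'(|q_2|)-\mu g'(|q_2-q_1|)$$ with $\dot q_1(0)=0=\dot q_2(0)$ and $q_1(T)=0=\dot q_2(T)$. Then, as $\mu\to0$, $q^\mu$ converges uniformly on compact subsets of $(0,T)$ to a function $q=(q_1,q_2)$. Each of the components $q_1,q_2$ is (up to translation and reversal of time) a segment of the brake orbit of period $2T$ of the $f$-Kepler problem $\ddot x=f'(x)$. Moreover, $q_1(T)=0$ and $\dot q_2(0)=-\dot q_1(0)>0$. So the limit trajectory has a collision-reflection at $t=0$.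
   Context: Standing assumptions: $T>0$ and $f,g\colon(0,+\infty)\to(0,+\infty)$ are $C^2$ functions, both singular at the origin ($f(s),g(s)\to+\infty$ as $s\to0^+$), such that: $f(s),f'(s),g(s),g'(s)\to0$ as $s\to+\infty$; $f',g'\le0$ and $f'',g''\ge0$ on $(0,+\infty)$; there is $\alpha\in(0,2)$ with $sf'(s)+\alpha f(s)\ge0$ and $sg'(s)+\alpha g(s)\le0$ for all $s>0$; there is $\bar s>0$ with $0<g(\bar s)<f(\bar s)$. Brake orbit: the brake orbit of period $2T$ of the $f$-Kepler problem is the positive solution $\hat q$ of $\ddot x=f'(x)$ on $(0,2T]$, continuous on $[0,2T]$, with $\hat q(0)=0$ and $\dot{\hat q}(2T)=0$. Construction of $q^\mu$. Fix $\mu\in(0,1]$ and put $G=\mu g$. For $\varepsilon_1>0$ let $f_{\varepsilon_1}\colon\mathbb R\to\mathbb R$ be $f_{\varepsilon_1}(s)=f(s)$ for $s\ge\varepsilon_1$; $f_{\varepsilon_1}(s)=f(\varepsilon_1)+f'(\varepsilon_1)(s-\varepsilon_1)$ for $s\in[0,\varepsilon_1]$; $f_{\varepsilon_1}(s)=f(\varepsilon_1)-\varepsilon_1f'(\varepsilon_1)+f'(\varepsilon_1)s+\frac{f'(\varepsilon_1)}{2\varepsilon_1}s^2$ for $s\in[-\varepsilon_1,0]$; $f_{\varepsilon_1}(s)=f_{\varepsilon_1}(-\varepsilon_1)$ for $s\le-\varepsilon_1$. For $\varepsilon_2>0$ let $\psi_{\varepsilon_2}\colon\mathbb R\to\mathbb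 R$ be a smooth monotone decreasing function with $\psi_{\varepsilon_2}=1$ on $(-\infty,-\varepsilon_2]$, $\psi_{\varepsilon_2}=0$ on $[\varepsilon_2,+\infty)$, $\psi_{\varepsilon_2}(0)=\frac12$, convex on $[0,\varepsilon_2]$, and put $G_{\varepsilon_2}(s)=G(s)+\psi_{\varepsilon_2}(s)/s^2$ for $s>0$. Let $\mathcal D=\{(q_1,q_2)\in H^1([0,T],\mathbb R^2): q_1(0)=0,\ q_1(t)<q_2(t)\ \forall t\in[0,T]\}$ and on $\mathcal D$ let $$\mathcal A_{\varepsilon_1,\varepsilon_2}(q_1,q_2)=\int_0^T\tfrac12(|\dot q_1|^2+|\dot q_2|^2)+f_{\varepsilon_1}(q_1)+f_{\varepsilon_1}(q_2)-G_{\varepsilon_2}(q_2-q_1)\,dt.$$ Let $q_{\varepsilon_1}$ be the minimiser of $\mathcal F_{\varepsilon_1}(q)=\int_0^T\frac12|\dot q|^2+f_{\varepsilon_1}(q)\,dt$ on $\{q\in H^1([0,T],\mathbb R):q(0)=0\}$ and $a_{\varepsilon_1}=\mathcal F_{\varepsilon_1}(q_{\varepsilon_1})$. For constants $C>c>q_{\varepsilon_1}(T)$ let $\Gamma_c^C(\varepsilon_1)$ be the set of continuous paths $\gamma\colon[0,1]\to\mathcal D$ with $\gamma(0)=(q_{\varepsilon_1},c)$ and $\gamma(1)=(q_{\varepsilon_1},C)$ ($c$, $C$ being regarded as constant functions). For $\varepsilon_1,\varepsilon_2$ small enough there exist $\delta_1>\delta_2>0$ and $c,C$ such that, for every $\gamma\in\Gamma_c^C(\varepsilon_1)$,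 $\max\{\mathcal A_{\varepsilon_1,\varepsilon_2}(\gamma(0)),\mathcal A_{\varepsilon_1,\varepsilon_2}(\gamma(1))\}\le a_{\varepsilon_1}+\delta_2$ and $\max_{s\in[0,1]}\mathcal A_{\varepsilon_1,\varepsilon_2}(\gamma(s))>a_{\varepsilon_1}+\delta_1$; the constants $c,C$ are chosen in this way. Put $c_{\varepsilon_1,\varepsilon_2}=\inf_{\gamma\in\Gamma_c^C(\varepsilon_1)}\max_{s\in[0,1]}\mathcal A_{\varepsilon_1,\varepsilon_2}(\gamma(s))$. Let $q^\varepsilon\in\mathcal D$ be critical points of $\mathcal A_{\varepsilon_1,\varepsilon_2}$ (with respect to variations in $\{v\in H^1([0,T],\mathbb R^2):v_1(0)=0\}$) at level $c_{\varepsilon_1,\varepsilon_2}$. As $\varepsilon_1,\varepsilon_2\to0$ a subsequence of $q^\varepsilon$ converges, uniformly on $[0,T]$ and in $C^2([\delta,T])$ for every $\delta\in(0,T)$, to a function $\tilde q^\mu=(\tilde q_1^\mu,\tilde q_2^\mu)$, with $\tilde q_1^\mu(0)=0$, $\dot{\tilde q}_1^\mu(T)=0$, $\dot{\tilde q}_2^\mu(0)=\dot{\tilde q}_2^\mu(T)=0$, solving the system with parameter $\mu$. The $\mu$-frozen planet orbit $q^\mu$ is its time reversal, $q^\mu(t)=\tilde q^\mu(T-t)$.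
   Formalization: The barrier height δ1 in the mountain pass construction is assumed bounded below by a positive constant independent of μ, ε1, ε2; if δ1, c, C may depend freely on μ, one can choose orbits for some f, g whose second component escapes to infinity as μ→0. *)

(* Defs.v *)
From HB Require Import structures.
From mathcomp Require Import all_boot all_order all_algebra.
From mathcomp Require Import all_classical all_reals all_analysis.

Set Implicit Arguments.
Unset Strict Implicit.
Unset Printing Implicit Defensive.

Import Order.TTheory GRing.Theory Num.Theory.
Import numFieldNormedType.Exports.

Local Open Scope classical_set_scope.
Local Open Scope ring_scope.

(* Functions on an interval are represented by functions R -> R; the values
   outside the interval are never used. *)

Definition singular_potential (R : realType) (f : R -> R) : Prop :=
  [/\ forall s, 0 < s ->
        [/\ 0 < f s, derivable f s 1, derivable (derive1 f) s 1
          & {for s, continuous (derive1n 2 f)}],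
      f s @[s --> 0^'+] --> +oo,
      f s @[s --> +oo] --> (0 : R),
      derive1 f s @[s --> +oo] --> (0 : R)
    & forall s, 0 < s -> derive1 f s <= 0 /\ 0 <= derive1n 2 f s].

(* One-sided at the end points of D when D is an interval. *)
Definition derivative_within (R : realType) (D : set R) (x : R -> R) (t d : R)
    : Prop :=
  (x s - x t) / (s - t) @[s --> within D t^'] --> d.

Definition C2_within (R : realType) (D : set R) (x x' x'' : R -> R) : Prop :=
  [/\ forall t, D t -> derivative_within D x t (x' t),
      forall t, D t -> derivative_within D x' t (x'' t)
    & {within D, continuous x''}].

Definition cvg_C2 (R : realType) (D : set R) (x : nat -> R -> R) (y : R -> R)
    : Prop :=
  exists (x' x'' : nat -> R -> R) (y' y'' : R -> R),
    [/\ forall n, C2_within D (x n) (x' n) (x'' n),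
        C2_within D y y' y'',
        {uniform D, x @ \oo --> y},
        {uniform D, x' @ \oo --> y'}
      & {uniform D, x'' @ \oo --> y''}].

(* The period is 2 * T. *)
Definition brake_orbit (R : realType) (f : R -> R) (T : R) (x : R -> R)
    : Prop :=
  [/\ {within `[0, 2 * T], continuous x},
      x 0 = 0,
      forall t, t \in `]0, 2 * T] -> 0 < x t
    & exists v : R -> R,
        v (2 * T) = 0 /\
        forall t, t \in `]0, 2 * T] ->
          derivative_within `]0, 2 * T] x t (v t) /\
          derivative_within `]0, 2 * T] v t (derive1 f (x t))].

Definition brake_segment (R : realType) (T : R) (xhat x : R -> R) : Prop :=
  exists a sigma : R, (sigma = 1 \/ sigma = -1) /\
    forall t, t \in `[0, T] ->
      a + sigma * t \in `[0, 2 * T] /\ x t = xhat (a + sigma * t).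

(* q_1 reaches the singularity of f at time T, so the equations are imposed on
   [0, T[; there a solution has to stay where f and g are defined. *)
Definition frozen_planet_orbit (R : realType) (f g : R -> R) (T mu : R)
    (q : (R -> R) * (R -> R)) : Prop :=
  let: (q1, q2) := q in
  {within `[0, T], continuous q1} /\ {within `[0, T], continuous q2} /\
  exists v1 v2 : R -> R,
    [/\ forall t, t \in `[0, T[ ->
          [/\ q1 t != 0, q2 t != 0 & q2 t != q1 t],
        forall t, t \in `[0, T[ ->
          derivative_within `[0, T] q1 t (v1 t) /\
          derivative_within `[0, T[ v1 t
            (derive1 f `|q1 t| + mu * derive1 g `|q2 t - q1 t|),
        forall t, t \in `[0, T[ ->
          derivative_within `[0, T] q2 t (v2 t) /\
          derivative_within `[0, T[ v2 t
            (derive1 f `|q2 t| - mu * derive1 g `|q2 t - q1 t|),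
        v1 0 = 0 /\ v2 0 = 0
      & q1 T = 0 /\ derivative_within `[0, T] q2 T 0].

Local Notation leb := (@lebesgue_measure _).

(* v is (a representative of) the weak derivative in L^2([0, T]) of x, where x
   is the continuous representative of its class in H^1([0, T]). *)
Definition weak_derivative (R : realType) (T : R) (x v : R -> R) : Prop :=
  [/\ measurable_fun `[0, T] v,
      leb.-integrable `[0, T] (EFin \o (fun t => v t ^+ 2))
    & forall t, t \in `[0, T] -> x t = x 0 + \int[leb]_(s in `[0, t]) v s].

Definition in_H1 (R : realType) (T : R) (x : R -> R) : Prop :=
  exists v, weak_derivative T x v.

(* Unique up to equality almost everywhere on [0, T]. *)
Definition wderiv (R : realType) (T : R) (x : R -> R) : R -> R :=
  xget (fun=> 0) [set v | weak_derivative T x v].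

Definition H1_norm2 (R : realType) (T : R) (x : R -> R) : R :=
  \int[leb]_(t in `[0, T]) (x t ^+ 2 + wderiv T x t ^+ 2).

Definition H1_dist (R : realType) (T : R) (p q : (R -> R) * (R -> R)) : R :=
  Num.sqrt (H1_norm2 T (fun t => p.1 t - q.1 t) +
            H1_norm2 T (fun t => p.2 t - q.2 t)).

Definition f_reg (R : realType) (f : R -> R) (e1 s0 : R) : R :=
  let s := Num.max s0 (- e1) in
  if e1 <= s then f s
  else if 0 <= s then f e1 + derive1 f e1 * (s - e1)
  else f e1 - e1 * derive1 f e1 + derive1 f e1 * s
       + derive1 f e1 / (2 * e1) * s ^+ 2.

Definition cutoff (R : realType) (e2 : R) (psi : R -> R) : Prop :=
  [/\ forall k s, derivable (derive1n k psi) s 1,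
      {homo psi : s t / s <= t >-> t <= s},
      (forall s, s <= - e2 -> psi s = 1) /\ (forall s, e2 <= s -> psi s = 0),
      psi 0 = 2^-1
    & forall s t l, s \in `[0, e2] -> t \in `[0, e2] -> l \in `[0, 1] ->
        psi (l * s + (1 - l) * t) <= l * psi s + (1 - l) * psi t].

Definition G_reg (R : realType) (g psi : R -> R) (mu s : R) : R :=
  mu * g s + psi s / s ^+ 2.

Definition calD (R : realType) (T : R) (q : (R -> R) * (R -> R)) : Prop :=
  [/\ in_H1 T q.1, in_H1 T q.2, q.1 0 = 0
    & forall t, t \in `[0, T] -> q.1 t < q.2 t].

Definition calA (R : realType) (f g psi : R -> R) (T mu e1 : R)
    (q : (R -> R) * (R -> R)) : R :=
  \int[leb]_(t in `[0, T])
    (2^-1 * (wderiv T q.1 t ^+ 2 + wderiv T q.2 t ^+ 2)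
     + f_reg f e1 (q.1 t) + f_reg f e1 (q.2 t)
     - G_reg g psi mu (q.2 t - q.1 t)).

Definition calF (R : realType) (f : R -> R) (T e1 : R) (x : R -> R) : R :=
  \int[leb]_(t in `[0, T]) (2^-1 * wderiv T x t ^+ 2 + f_reg f e1 (x t)).

Definition minimiser (R : realType) (f : R -> R) (T e1 : R) (x : R -> R)
    : Prop :=
  [/\ in_H1 T x, x 0 = 0
    & forall y, in_H1 T y -> y 0 = 0 -> calF f T e1 x <= calF f T e1 y].

(* The paths in calD, continuous for the H^1 distance, from (x, c) to (x, C). *)
Definition Gamma (R : realType) (T : R) (x : R -> R) (c C : R)
    : set (R -> (R -> R) * (R -> R)) :=
  [set gam | [/\ forall s : R, s \in `[0, 1] -> calD T (gam s),
      forall s : R, s \in `[0, 1] ->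
        H1_dist T (gam r) (gam s) @[r --> within `[0, 1] (nbhs s)] --> (0 : R),
      forall t : R, t \in `[0, T] -> (gam 0).1 t = x t /\ (gam 0).2 t = c
    & forall t, t \in `[0, T] -> (gam 1).1 t = x t /\ (gam 1).2 t = C]].

(* A maximum: the action is continuous along a path of Gamma. *)
Definition max_action (R : realType) (f g psi : R -> R) (T mu e1 : R)
    (gam : R -> (R -> R) * (R -> R)) : R :=
  sup [set calA f g psi T mu e1 (gam s) | s in `[0, 1]].

Definition mountain_pass_level (R : realType) (f g psi : R -> R)
    (T mu e1 : R) (x : R -> R) (c C : R) : R :=
  inf [set max_action f g psi T mu e1 gam | gam in Gamma T x c C].

Definition mountain_pass_geometry (R : realType) (f g psi : R -> R)
    (T mu e1 : R) (x : R -> R) (d1 d2 c C : R) : Prop :=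
  forall gam, Gamma T x c C gam ->
    Num.max (calA f g psi T mu e1 (gam 0)) (calA f g psi T mu e1 (gam 1))
      <= calF f T e1 x + d2 /\
    calF f T e1 x + d1 < max_action f g psi T mu e1 gam.

Definition critical_point (R : realType) (f g psi : R -> R) (T mu e1 : R)
    (q : (R -> R) * (R -> R)) : Prop :=
  calD T q /\
  forall v1 v2, in_H1 T v1 -> in_H1 T v2 -> v1 0 = 0 ->
    is_derive (0 : R) (1 : R)
      (fun s => calA f g psi T mu e1
                  (fun t => q.1 t + s * v1 t, fun t => q.2 t + s * v2 t)) 0.

(* The choice of d1, d2, c, C may depend on mu, e1, e2, psi; only the barrier
   height d1 has a lower bound, d0, that does not.  If d1 could tend to 0 with
   mu, then for some f and g one could choose c and C on either side of a small
   barrier whose position tends to infinity, and q_2 would not converge. *)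
Definition mountain_pass_point (R : realType) (f g : R -> R) (T d0 mu e1 e2 : R)
    (q : (R -> R) * (R -> R)) : Prop :=
  exists (psi x : R -> R) (d1 d2 c C : R),
    [/\ cutoff e2 psi, minimiser f T e1 x,
        [/\ 0 < d2, d2 < d1, d0 <= d1, x T < c & c < C],
        mountain_pass_geometry f g psi T mu e1 x d1 d2 c C
      & critical_point f g psi T mu e1 q /\
        calA f g psi T mu e1 q = mountain_pass_level f g psi T mu e1 x c C].

Definition mountain_pass_limit (R : realType) (f g : R -> R) (T d0 mu : R)
    (qt : (R -> R) * (R -> R)) : Prop :=
  exists (e1 e2 : nat -> R) (q : nat -> (R -> R) * (R -> R)),
    [/\ forall n, 0 < e1 n /\ 0 < e2 n,
        e1 @ \oo --> (0 : R) /\ e2 @ \oo --> (0 : R),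
        forall n, mountain_pass_point f g T d0 mu (e1 n) (e2 n) (q n),
        {uniform `[0, T], (fun n => (q n).1) @ \oo --> qt.1} /\
        {uniform `[0, T], (fun n => (q n).2) @ \oo --> qt.2}
      & forall d, d \in `]0, T[ ->
          cvg_C2 `[d, T] (fun n => (q n).1) qt.1 /\
          cvg_C2 `[d, T] (fun n => (q n).2) qt.2].

Definition mountain_pass_orbit (R : realType) (f g : R -> R) (T d0 mu : R)
    (q : (R -> R) * (R -> R)) : Prop :=
  frozen_planet_orbit f g T mu q /\
  exists qt, mountain_pass_limit f g T d0 mu qt /\
    forall t, t \in `[0, T] -> q.1 t = qt.1 (T - t) /\ q.2 t = qt.2 (T - t).

(* Main.v *)
Require Import Defs.
From HB Require Import structures.
From mathcomp Require Import all_boot all_order all_algebra.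
From mathcomp Require Import all_classical all_reals all_analysis.
From mathcomp Require Import measurable_realfun ring lra.

(** As mu tends to 0 the coupling mu g'(q2 - q1) disappears wherever the gap
    z = q2 - q1 is not small, so the limit should solve the Kepler problem
    x'' = f'(x) in each component, except at a collision of the two.  One has to
    exclude that the orbits escape to infinity, fall onto the singularity or
    accumulate at more than one limit, and to see what happens at the collision.

    Bounds that survive all limits come from the mountain pass level of the
    regularised problem, which runs in reversed time and starts on the singularity
    (mountain_pass_point_bounds, orbit_bounds).  The level is at most the action
    along the straight path from (x, c) to (x, C), where x is the minimiser, and this
    is bounded by a quantity that depends on f only; the virial identity then bounds
    the kinetic energy, hence the modulus of continuity.  If q2 were far away, the
    two components would hardly interact, q1 would be almost minimal by convexity
    and q2 would contribute almost nothing; but the level lies at least d0 above the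
    minimal action.  If q2(T) were close to 0 without a strong repulsion, the action
    of q2 alone would exceed what the level allows above the minimum.

    For a single orbit, z is convex.  The initial gap z(0) tends to 0 with mu, since
    otherwise q2 would be strictly concave with vanishing velocity at both ends
    (gap_small).  The initial energy 2 mu g(z(0)) of the relative motion stays away
    from 0, since otherwise Gronwall's inequality would keep z small almost up to T,
    and so would be q2(T), which the level excludes (coupling_ge).  Therefore the
    Lagrange-Jacobi inequality gives z(t)^2 >= sigma t^2 uniformly in mu, and the
    coupling tends to 0 uniformly on every [d, T[ with d > 0 (uniform_bounds,
    force_small).

    Two orbits q and r with small parameters are close to each other
    (orbit_comparison, orbits_cauchy).  Since f' is nondecreasing, the products
    (q1 - r1)(q1 - r1)' and (q2 - r2)(q2 - r2)' are nondecreasing on [d, T[ up to the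
    coupling.  The second one vanishes at T, which bounds it above; at d the sum of
    the two is small, because q1 - r1 and q2 - r2 nearly agree there and because the
    total velocity is of the order of d, the coupling being internal.  So the first
    one is bounded below by a small negative number, and since q1 - r1 vanishes at T,
    it is small; then q2 - r2 is small at d, and from there on.  Hence the family is
    Cauchy as mu tends to 0, and no subsequence has to be chosen.

    In the limit, x2 solves x'' = f'(x) on [0, T] with x2'(T) = 0 (limit_second).
    In the sum x1 + x2 the coupling cancels, so that (x1 + x2)'' = f'(x1) + f'(x2) on
    [0, T[ with (x1 + x2)'(0) = 0 (limit_sum).  Hence x1'(0) = - x2'(0), and the curve
    that follows x1 backwards from its zero to the collision, and then x2, is a
    solution of x'' = f'(x): it is the brake orbit (glued_orbit_brake).  Finally
    x2'(0) > 0, because x2'' < 0 and x2'(T) = 0 (glued_slope). *)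

Set Implicit Arguments.
Unset Strict Implicit.
Unset Printing Implicit Defensive.

Import Order.TTheory GRing.Theory Num.Theory.
Import numFieldNormedType.Exports.

Local Open Scope classical_set_scope.
Local Open Scope ring_scope.

(** * Monotonicity and singular potentials *)

Section monotone.
Variable R : realType.
Implicit Types (f df : R -> R) (a b x y d k : R).

Lemma is_derive_continuous f (x d : R) : is_derive x 1 f d -> {for x, continuous f}.
Proof. by move=> fd; apply/differentiable_continuous/derivable1_diffP. Qed.

Lemma is_derive_continuous_within f df a b :
  (forall x, a <= x <= b -> is_derive x 1 f (df x)) ->
  {within `[a, b], continuous f}.
Proof.
move=> fd; apply: derivable_within_continuous => x; rewrite in_itv/= => xab.
by have [] := fd x xab.
Qed.

Lemma mean_value f df a b : a < b ->
  (forall x, a <= x <= b -> is_derive x 1 f (df x)) ->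
  exists2 c, a < c < b & f b - f a = df c * (b - a).
Proof.
move=> ab fd.
have fd' x : x \in `]a, b[ -> is_derive x 1 f (df x).
  by rewrite in_itv/= => /andP[ax xb]; apply: fd; rewrite !ltW.
have [c] := MVT ab fd' (is_derive_continuous_within fd).
by rewrite in_itv/=; exists c.
Qed.

Lemma mean_value_within f df a b : a < b ->
  {within `[a, b], continuous f} ->
  (forall x, a < x < b -> is_derive x 1 f (df x)) ->
  exists2 c, a < c < b & f b - f a = df c * (b - a).
Proof.
move=> ab fc fd.
have fd' x : x \in `]a, b[ -> is_derive x 1 f (df x).
  by rewrite in_itv/= => xab; apply: fd.
have [c] := MVT ab fd' fc.
by rewrite in_itv/=; exists c.
Qed.

Lemma deriv_ge0_le f df a b : a <= b ->
  (forall x, a <= x <= b -> is_derive x 1 f (df x)) ->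
  (forall x, a < x < b -> 0 <= df x) -> f a <= f b.
Proof.
rewrite le_eqVlt => /predU1P[->//|ab] fd df0.
have [c cab e] := mean_value ab fd.
by rewrite -subr_ge0 e mulr_ge0 ?df0// subr_ge0 ltW.
Qed.

Lemma deriv_le0_ge f df a b : a <= b ->
  (forall x, a <= x <= b -> is_derive x 1 f (df x)) ->
  (forall x, a < x < b -> df x <= 0) -> f b <= f a.
Proof.
rewrite le_eqVlt => /predU1P[->//|ab] fd df0.
have [c cab e] := mean_value ab fd.
by rewrite -subr_le0 e mulr_le0_ge0 ?df0// subr_ge0 ltW.
Qed.

Lemma deriv_ge_lin f df a b k : a <= b ->
  (forall x, a <= x <= b -> is_derive x 1 f (df x)) ->
  (forall x, a < x < b -> k <= df x) -> f a + k * (b - a) <= f b.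
Proof.
move=> ab fd dfk.
have := @deriv_ge0_le (fun x => f x - k * x) (fun x => df x - k) a b ab.
rewrite [leLHS]/= => h; have : f a - k * a <= f b - k * b.
  apply: h => x xab; last by rewrite subr_ge0 dfk.
  have fdx := fd x xab; apply: is_derive_eq; rewrite scaler1; ring.
lra.
Qed.

Lemma deriv_le_lin f df a b k : a <= b ->
  (forall x, a <= x <= b -> is_derive x 1 f (df x)) ->
  (forall x, a < x < b -> df x <= k) -> f b <= f a + k * (b - a).
Proof.
move=> ab fd dfk.
have := @deriv_ge_lin (fun x => - f x) (fun x => - df x) a b (- k) ab.
move=> h; have : - f a + (- k) * (b - a) <= - f b; last lra.
apply: h => x xab; last by rewrite lerN2 dfk.
by have fdx := fd x xab; apply: is_derive_eq.
Qed.

Lemma deriv_gt0_slope f a d : is_derive a 1 f d -> 0 < d ->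
  exists2 e, 0 < e & forall h, h != 0 -> `|h| < e -> 0 < h^-1 * (f (h + a) - f a).
Proof.
move=> [df ed] d0.
have cv : h^-1 *: (f (h *: 1 + a) - f a) @[h --> 0^'] --> d by rewrite -[X in _ --> X]ed.
have [e /= e0 he] := cvgr_gt _ cv _ d0.
exists e => // h h0 hh; have := he h; rewrite /ball/= sub0r normrN => /(_ hh h0).
by rewrite /GRing.scale/= mulr1.
Qed.

Lemma deriv_at_min f a d : is_derive a 1 f d -> (forall x, f a <= f x) -> d = 0.
Proof.
move=> fd fmin; apply/eqP; rewrite eq_le; apply/andP; split; rewrite leNgt; apply/negP => d0.
- have [e e0 he] := deriv_gt0_slope fd d0.
  have := he (- (e / 2)); rewrite oppr_eq0 gt_eqF ?divr_gt0// normrN gtr0_norm ?divr_gt0//.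
  move=> /(_ isT); have -> : e / 2 < e by lra.
  move=> /(_ isT); rewrite ltNge => /negP; apply.
  rewrite invrN mulNr oppr_le0 mulr_ge0 ?invr_ge0//; first lra.
  by rewrite subr_ge0.
- have fdN : is_derive a 1 (fun x => - f x) (- d) by apply: is_derive_eq.
  have d0' : 0 < - d by lra.
  have [e e0 he] := deriv_gt0_slope fdN d0'.
  have := he (e / 2); rewrite gt_eqF ?divr_gt0// gtr0_norm ?divr_gt0//.
  move=> /(_ isT); have -> : e / 2 < e by lra.
  move=> /(_ isT); rewrite ltNge => /negP; apply.
  apply: mulr_ge0_le0; first by rewrite invr_ge0; lra.
  by have := fmin (e / 2 + a); lra.
Qed.

End monotone.

Section potential.
Variables (R : realType) (f : R -> R).
Hypothesis fP : singular_potential f.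
Implicit Types (s t x y e m M B : R).
Local Notation f' := (derive1 f).
Local Notation f'' := (derive1 (derive1 f)).

Lemma pot_gt0 s : 0 < s -> 0 < f s.
Proof. by case: fP => h _ _ _ _ /h[]. Qed.

Lemma pot_derive s : 0 < s -> is_derive s 1 f (f' s).
Proof. by case: fP => h _ _ _ _ /h[_ d _ _]; rewrite derive1E; apply: derivableP. Qed.

Lemma pot_derive2 s : 0 < s -> is_derive s 1 f' (f'' s).
Proof. by case: fP => h _ _ _ _ /h[_ _ d _]; rewrite (derive1E f'); apply: derivableP. Qed.

Lemma pot_d_le0 s : 0 < s -> f' s <= 0.
Proof. by case: fP => _ _ _ _ h /h[]. Qed.

Lemma pot_dd_ge0 s : 0 < s -> 0 <= f'' s.
Proof. by case: fP => _ _ _ _ h /h[_]. Qed.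


Lemma pot_d_nd s t : 0 < s -> s <= t -> f' s <= f' t.
Proof.
move=> s0 st; apply: (deriv_ge0_le st (df := f'')) => x /andP[sx _].
  by apply: pot_derive2; exact: lt_le_trans sx.
by apply: pot_dd_ge0; exact: lt_trans sx.
Qed.

Lemma pot_tangent s y : 0 < s -> 0 < y -> f s + f' s * (y - s) <= f y.
Proof.
move=> s0 y0; have [sy|ys] := leP s y.
  apply: (deriv_ge_lin sy (df := f')) => x /andP[sx _].
    by apply: pot_derive; exact: lt_le_trans sx.
  by apply: pot_d_nd => //; exact: ltW.
have := deriv_le_lin (ltW ys) (f := f) (df := f') (k := f' s).
move=> h; suff : f s <= f y + f' s * (s - y) by lra.
apply: h => x /andP[yx xs].
  by apply: pot_derive; exact: lt_le_trans yx.
by apply: pot_d_nd; [exact: lt_trans yx|exact: ltW].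
Qed.

Lemma pot_small e : 0 < e -> exists2 M, 0 < M &
  forall s, M <= s -> f s <= e.
Proof.
move=> e0; case: fP => _ _ h _ _.
have /cvgrPdist_le/(_ _ e0)[M [_ hM]] := h.
exists (Num.max 1 (M + 1)); first by rewrite lt_max ltr01.
move=> s; rewrite ge_max => /andP[_ Ms].
have /hM : M < s by rewrite (lt_le_trans _ Ms)// ltrDl.
by rewrite sub0r normrN; exact/le_trans/ler_norm.
Qed.

Lemma pot_d_small e : 0 < e -> exists2 M, 0 < M &
  forall s, M <= s -> - e <= f' s.
Proof.
move=> e0; case: fP => _ _ _ h _.
have /cvgrPdist_le/(_ _ e0)[M [_ hM]] := h.
exists (Num.max 1 (M + 1)); first by rewrite lt_max ltr01.
move=> s; rewrite ge_max => /andP[_ Ms].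
have /hM : M < s by rewrite (lt_le_trans _ Ms)// ltrDl.
by rewrite sub0r normrN ler_norml => /andP[].
Qed.

(** A point with zero slope would keep the convex function f above a positive
    value, against its decay at infinity. *)
Lemma pot_d_lt0 s : 0 < s -> f' s < 0.
Proof.
move=> s0; rewrite lt_neqAle pot_d_le0// andbT; apply/eqP => fs0.
have fle y : s <= y -> f s <= f y.
  move=> sy; have := pot_tangent s0 (lt_le_trans s0 sy).
  by rewrite fs0 mul0r addr0.
have fs : 0 < f s / 2 by rewrite divr_gt0// pot_gt0.
have [M M0 hM] := pot_small fs.
have := hM (Num.max M s); rewrite le_max lexx => /(_ isT).
have := fle (Num.max M s); rewrite le_max lexx orbT => /(_ isT).
lra.
Qed.

(** The tangent at s0 passes below (1, f 1), and f is unbounded near 0. *)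
Lemma pot_d_unbounded B : exists2 s0, 0 < s0 & f' s0 <= - B.
Proof.
case: fP => _ /cvgryPge h _ _ _.
have [d /= d0 hd] := h (f 1 + `|B|).
pose s := Num.min (d / 2) 2^-1.
have s0 : 0 < s by rewrite lt_min divr_gt0//= invr_gt0.
exists s => //.
have := hd s; rewrite /ball/= sub0r normrN gtr0_norm// => hs.
have {}hs : f 1 + `|B| <= f s.
  by apply: hs => //; rewrite gt_min ltr_pdivrMr// ltr_pMr// ltr1n.
have := pot_tangent s0 (@ltr01 R).
have s1 : s <= 2^-1 by rewrite ge_min lexx orbT.
have := ler_norm B; have := normr_ge0 B.
nra.
Qed.

Lemma pot_d_lipschitz m M : 0 < m -> m <= M -> exists2 L, 0 <= L &
  forall x y, m <= x -> x <= y -> y <= M -> f' y - f' x <= L * (y - x).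
Proof.
move=> m0 mM.
have fc : {within `[m, M], continuous f''}.
  apply: continuous_in_subspaceT => x; rewrite inE/= in_itv/= => /andP[mx _].
  by case: fP => h _ _ _ _; case: (h x (lt_le_trans m0 mx)).
have [c] := EVT_max mM fc; rewrite in_itv/= => /andP[mc cM] hc.
exists (f'' c); first by apply: pot_dd_ge0; exact: lt_le_trans mc.
move=> x y mx xy yM.
have := deriv_le_lin xy (f := f') (df := f'') (k := f'' c).
move=> h; rewrite lerBlDl; apply: h => t /andP[xt ty].
  by apply: pot_derive2; rewrite (lt_le_trans m0)// (le_trans mx).
by apply: hc; rewrite in_itv/= (le_trans mx (ltW xt)) (le_trans (ltW ty)).
Qed.

Lemma pot_d_continuous s : 0 < s -> {for s, continuous f'}.
Proof. by move=> /pot_derive2; exact: is_derive_continuous. Qed.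

Lemma pot_continuous s : 0 < s -> {for s, continuous f}.
Proof. by move=> /pot_derive; exact: is_derive_continuous. Qed.

End potential.

(** * Integrals and weak derivatives on a segment *)

Section integral.
Variable R : realType.
Local Notation leb := (@lebesgue_measure R).
Implicit Types (T c t s k : R) (f g v w x y : R -> R).

Definition intg T f := leb.-integrable `[0, T] (EFin \o f).
Definition itg T f := \int[leb]_(t in `[0, T]) f t.

Let mD T : @measurable _ (measurableTypeR R) `[0, T].
Proof. exact: measurable_itv. Qed.

Lemma eq_itg T f g : (forall t, 0 <= t <= T -> f t = g t) -> itg T f = itg T g.
Proof. by move=> fg; apply: eq_Rintegral => t; rewrite inE/= in_itv/=; exact: fg. Qed.

Lemma intg_eq T f g : (forall t, 0 <= t <= T -> f t = g t) -> intg T f -> intg T g.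
Proof.
move=> fg; apply: eq_integrable => // t; rewrite inE/= in_itv/= => tT.
by rewrite /= fg.
Qed.

Lemma intgD T f g : intg T f -> intg T g -> intg T (fun t => f t + g t).
Proof. by move=> fi gi; have := integrableD (mD T) fi gi. Qed.

Lemma intgZ T k f : intg T f -> intg T (fun t => k * f t).
Proof. by move=> fi; have := integrableZl (mD T) k fi. Qed.

Lemma intgN T f : intg T f -> intg T (fun t => - f t).
Proof. by move=> /(intgZ (-1)); apply: intg_eq => t _; rewrite mulN1r. Qed.

Lemma intgB T f g : intg T f -> intg T g -> intg T (fun t => f t - g t).
Proof. by move=> fi /intgN gi; exact: intgD. Qed.

Lemma itgD T f g : intg T f -> intg T g ->
  itg T (fun t => f t + g t) = itg T f + itg T g.
Proof. by move=> fi gi; rewrite /itg RintegralD. Qed.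

Lemma itgB T f g : intg T f -> intg T g ->
  itg T (fun t => f t - g t) = itg T f - itg T g.
Proof. by move=> fi gi; rewrite /itg RintegralB. Qed.

Lemma itgZ T k f : intg T f -> itg T (fun t => k * f t) = k * itg T f.
Proof. by move=> fi; rewrite /itg RintegralZl. Qed.

Lemma itgN T f : intg T f -> itg T (fun t => - f t) = - itg T f.
Proof.
move=> fi; rewrite -[RHS]mulN1r -itgZ//.
by apply: eq_itg => t _; rewrite mulN1r.
Qed.

Lemma itg_le T f g : intg T f -> intg T g ->
  (forall t, 0 <= t <= T -> f t <= g t) -> itg T f <= itg T g.
Proof.
move=> fi gi fg; apply: le_Rintegral => // t /=; rewrite in_itv/=; exact: fg.
Qed.

Lemma itg_ge0 T f : (forall t, 0 <= t <= T -> 0 <= f t) -> 0 <= itg T f.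
Proof. by move=> fg; apply: Rintegral_ge0 => t /=; rewrite in_itv/=; exact: fg. Qed.

Lemma intg_continuous T f : {within `[0, T], continuous f} -> intg T f.
Proof. by move=> fc; apply: continuous_compact_integrable => //; exact: segment_compact. Qed.

Lemma intg_cst T c : intg T (fun=> c).
Proof. by apply: intg_continuous => t; exact: cvg_cst. Qed.

Lemma itg_cst T c : 0 <= T -> itg T (fun=> c) = c * T.
Proof.
move=> T0; rewrite /itg Rintegral_cst//; congr (_ * _).
suff : leb `[0, T] = T%:E by move=> /(congr1 fine).
rewrite lebesgue_measure_itv/= lte_fin; case: ifPn => [_|].
  by rewrite -EFinD subr0.
by rewrite -leNgt => T0'; rewrite (@le_anti _ _ T 0) ?T0 ?T0'.
Qed.

Lemma intgS t T f : t <= T -> intg T f -> intg t f.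
Proof.
move=> tT; apply: integrableS => //.
by move=> s /=; rewrite !in_itv/= => /andP[-> /le_trans]; exact.
Qed.

Lemma intg_measurable T f : intg T f -> measurable_fun `[0, T] f.
Proof. by case/integrableP => /measurable_EFinP. Qed.

Lemma intg_dom T f g : measurable_fun `[0, T] f -> intg T g ->
  (forall t, 0 <= t <= T -> `|f t| <= g t) -> intg T f.
Proof.
move=> mf gi fg; apply: (le_integrable (mD T) _ _ gi).
  exact/measurable_EFinP.
move=> t /=; rewrite in_itv/= => /fg fgt; rewrite lee_fin.
exact: le_trans (ler_norm _).
Qed.

Definition ae0 T f g := {ae leb, forall t, t \in `[0, T] -> f t = g t}.

Lemma itg_ae T f g : measurable_fun `[0, T] f -> measurable_fun `[0, T] g ->
  ae0 T f g -> itg T f = itg T g.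
Proof.
move=> mf mg fg; rewrite /itg /Rintegral; congr fine.
apply: ae_eq_integral => //; [exact/measurable_EFinP|exact/measurable_EFinP|].
apply: (@filterS _ _ (ae_filter_ringOfSetsType leb)) fg => t h tT; congr EFin; exact: h.
Qed.

Definition sqint T v := measurable_fun `[0, T] v /\ intg T (fun t => v t ^+ 2).

Lemma sqint_mul T v w : sqint T v -> sqint T w -> intg T (fun t => v t * w t).
Proof.
move=> [mv iv] [mw iw]; apply: (@intg_dom _ _ (fun t => v t ^+ 2 + w t ^+ 2)).
- exact: measurable_funM.
- exact: intgD.
- by move=> t _; rewrite ler_norml; apply/andP; split; nra.
Qed.

Lemma sqintD T v w : sqint T v -> sqint T w -> sqint T (fun t => v t + w t).
Proof.
move=> vi wi; have [mv iv] := vi; have [mw iw] := wi.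
split; first exact: measurable_funD.
have := intgD (intgD iv iw) (intgZ 2 (sqint_mul vi wi)).
by apply: intg_eq => t _; ring.
Qed.

Lemma sqintZ T k v : sqint T v -> sqint T (fun t => k * v t).
Proof.
move=> [mv iv]; split; first by apply: measurable_funM.
by apply: intg_eq (intgZ (k ^+ 2) iv) => t _; ring.
Qed.

Lemma sqint_continuous T v : {within `[0, T], continuous v} -> sqint T v.
Proof.
move=> vc; split.
  by apply: intg_measurable; exact: intg_continuous.
by apply: intg_continuous => t; apply: continuousM; exact: vc.
Qed.

Lemma sqint_cst T c : sqint T (fun=> c).
Proof. by apply: sqint_continuous => t; exact: cvg_cst. Qed.

Lemma sqint_intg T v : sqint T v -> intg T v.
Proof.
move=> vi; have := sqint_mul vi (sqint_cst T 1).
by apply: intg_eq => t _; rewrite mulr1.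
Qed.

Lemma itg_split t T f : 0 <= t -> t <= T -> intg T f ->
  itg T f - itg t f = \int[leb]_(s in `]t, T]) f s.
Proof. by move=> t0 tT fi; rewrite /itg Rintegral_itvB// ?bnd_simp. Qed.

Lemma itg_mono t T f : 0 <= t -> t <= T -> intg T f ->
  (forall s, 0 <= s <= T -> 0 <= f s) -> itg t f <= itg T f.
Proof.
move=> t0 tT fi f0; rewrite -subr_ge0 itg_split//; apply: Rintegral_ge0 => s /=.
by rewrite in_itv/= => /andP[ts sT]; apply: f0; rewrite sT (le_trans t0 (ltW ts)).
Qed.

Lemma itg_FTC T f : 0 <= T -> {within `[0, T], continuous f} ->
  forall F, (forall t, 0 <= t <= T -> is_derive t 1 F (f t)) ->
  itg T f = F T - F 0.
Proof.
rewrite le_eqVlt => /predU1P[<-|T0] fc F Fd.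
  by rewrite /itg set_itv1 Rintegral_set1 subrr.
rewrite /itg /Rintegral (@continuous_FTC2 _ f F)//.
- have Fc := is_derive_continuous_within Fd.
  have [] := (continuous_within_itvP _ T0).1 Fc.
  split => // t; rewrite in_itv/= => /andP[t0 tT].
  by case: (Fd t); rewrite ?ltW.
- move=> t; rewrite in_itv/= => /andP[t0 tT]; rewrite derive1E.
  by apply: derive_val; apply: Fd; rewrite !ltW.
Qed.

Lemma itg_id T : 0 <= T -> itg T id = T ^+ 2 / 2.
Proof.
move=> T0.
have idc : {within `[0, T], continuous (id : R -> R)}.
  by apply: continuous_subspaceT => x; exact: cvg_id.
transitivity (T ^+ 2 / 2 - 0 ^+ 2 / 2); last by rewrite expr0n mul0r subr0.
apply: (itg_FTC T0 idc (F := fun t => t ^+ 2 / 2)) => t _; apply: is_derive_eq.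
by rewrite /GRing.scale/=; field.
Qed.

Lemma weakP T x v : weak_derivative T x v <->
  sqint T v /\ forall t, 0 <= t <= T -> x t = x 0 + itg t v.
Proof.
by split=> [[mv iv h]|[[mv iv] h]]; split.
Qed.

Lemma weak_lin T x y v w k : weak_derivative T x v -> weak_derivative T y w ->
  weak_derivative T (fun t => x t + k * y t) (fun t => v t + k * w t).
Proof.
move=> /weakP[vi hx] /weakP[wi hy]; apply/weakP; split.
  by apply: sqintD => //; exact: sqintZ.
move=> t /[dup] tT /andP[t0 tT']; rewrite hx// (hy t)// itgD ?itgZ; first ring.
- exact: intgS tT' (sqint_intg wi).
- exact: intgS tT' (sqint_intg vi).
- exact/intgZ/(intgS tT' (sqint_intg wi)).
Qed.

Lemma weak_cst T c : weak_derivative T (fun=> c) (fun=> 0).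
Proof.
apply/weakP; split; first exact: sqint_cst.
by move=> t /andP[t0 _]; rewrite itg_cst// mul0r addr0.
Qed.

(** The difference of two weak derivatives has integral 0 on every [0, t], and
    the derivative of this integral is the difference, almost everywhere. *)
Lemma weak_unique T x v w : weak_derivative T x v -> weak_derivative T x w ->
  ae0 T v w.
Proof.
move=> /weakP[vi hv] /weakP[wi hw].
pose u0 t := v t - w t.
have u0i : intg T u0 by apply: intgB; exact: sqint_intg.
pose u := u0 \_ `[0, T].
have u0I t : 0 <= t <= T -> itg t u0 = 0.
  move=> /[dup] tT /andP[_ tT']; rewrite itgB.
  - by have := hv t tT; rewrite (hw t tT) => /addrI ->; rewrite subrr.
  - exact: intgS tT' (sqint_intg vi).
  - exact: intgS tT' (sqint_intg wi).
have uloc : locally_integrable [set: R] u by exact: integrable_locally.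
have ui t : leb.-integrable [set` Interval (BLeft 0) (BRight t)] (EFin \o u).
  have : leb.-integrable setT (EFin \o u).
    rewrite -restrict_EFin; apply/integrable_restrict => //.
    by rewrite setTI.
  by apply: integrableS.
have key t : 0 < t -> t < T ->
    derive1 (fun r : R => \int[leb]_(t in [set` Interval (BLeft 0) (BRight r)]) u t) t = u t ->
    v t = w t.
  move=> t0 tT; rewrite derive1E.
  rewrite (@near_eq_derive _ _ _ _ (cst 0)) ?oner_neq0//; last first.
    near=> s.
    have s0 : 0 < s by near: s; exact: lt_nbhsr.
    have sT : s < T by near: s; exact: lt_nbhsl.
    rewrite /cst -[RHS](u0I s); last by rewrite !ltW.
    apply: eq_Rintegral => r; rewrite inE/= in_itv/= => /andP[r0 rs].
    by rewrite /u patchE mem_set//= in_itv/= r0 (le_trans rs)// ltW.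
  rewrite derive_cst /u patchE mem_set//=; last by rewrite in_itv/= !ltW.
  by move/esym/eqP; rewrite subr_eq0 => /eqP.
have := FTC1 ui uloc.
have : {ae leb, forall t : R, t != 0 /\ t != T}.
  exists [set 0; T]; split.
  - by apply: measurableU.
  - by apply: countable_lebesgue_measure0; apply: finite_set_countable.
  - move=> t /= /not_andP[/negP|/negP]; rewrite negbK => /eqP ->; [by left|by right].
apply: (@filterS2 _ _ (ae_filter_ringOfSetsType leb)) => t [tn0 tnT] h.
rewrite in_itv/= => /andP[t0 tT].
have t0' : 0 < t by rewrite lt_neqAle eq_sym tn0.
apply: key => //; first by rewrite lt_neqAle tnT.
by have [] := h t0'.
Unshelve. all: by end_near. Qed.

Lemma in_H1_wderiv T x : in_H1 T x -> weak_derivative T x (wderiv T x).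
Proof. by move=> xi; exact: (xgetPex (fun=> 0)). Qed.

(** The Cauchy-Schwarz inequality as a family of linear ones: integrate
    +- v <= (c v^2 + 1 / c) / 2 between s and t.  In this form it is stable
    under uniform limits and combines linearly with the other estimates. *)
Lemma weak_modulus T x v c s t : 0 <= s -> s <= t -> t <= T -> 0 < c ->
  weak_derivative T x v ->
  `|x t - x s| <= (c * itg T (fun r => v r ^+ 2) + (t - s) / c) / 2.
Proof.
move=> s0 st tT c0 /weakP[vi h].
have t0 : 0 <= t by exact: le_trans st.
have sT : s <= T by exact: le_trans tT.
have key w : sqint T w -> (forall r, w r ^+ 2 = v r ^+ 2) ->
    itg t w - itg s w <= (c * itg T (fun r => v r ^+ 2) + (t - s) / c) / 2.
  move=> wi wv.
  have wii : intg T (fun r => c / 2 * w r ^+ 2 + (2 * c)^-1).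
    by apply: intgD; [apply: intgZ; case: wi|exact: intg_cst].
  have wi' := sqint_intg wi.
  set q := (fun r => c / 2 * w r ^+ 2 + (2 * c)^-1) in wii.
  have : itg t w - itg s w <= itg t q - itg s q.
    rewrite !itg_split//; try exact: intgS tT _.
    apply: le_Rintegral => //.
    - apply: integrableS wi' => //.
      by move=> r /=; rewrite !in_itv/= => /andP[sr rt]; rewrite (le_trans rt)// (le_trans _ (ltW sr)).
    - apply: integrableS wii => //.
      by move=> r /=; rewrite !in_itv/= => /andP[sr rt]; rewrite (le_trans rt)// (le_trans _ (ltW sr)).
    - move=> r _; rewrite /q -subr_ge0.
      rewrite (_ : _ - _ = c^-1 / 2 * (c * w r - 1) ^+ 2); last by field; rewrite gt_eqF.
      by rewrite mulr_ge0 ?sqr_ge0// divr_ge0// invr_ge0 ltW.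
  move/le_trans; apply.
  have qE r : 0 <= r -> r <= T -> itg r q = c / 2 * itg r (fun r => v r ^+ 2) + (2 * c)^-1 * r.
    move=> r0 rT; rewrite /q itgD ?itgZ ?itg_cst//.
    - by congr (_ * _ + _); apply: eq_itg => ? _; rewrite wv.
    - by apply: intgS rT _; case: wi.
    - by apply: intgZ; apply: intgS rT _; case: wi.
    - exact: intg_cst.
  rewrite !qE//.
  have vi2 : intg T (fun r => v r ^+ 2) by case: vi.
  have h1 : itg t (fun r => v r ^+ 2) <= itg T (fun r => v r ^+ 2).
    by apply: itg_mono => // r _; exact: sqr_ge0.
  have h2 : 0 <= itg s (fun r => v r ^+ 2) by apply: itg_ge0 => r _; exact: sqr_ge0.
  have -> : (2 * c)^-1 = c^-1 / 2 by rewrite invfM mulrC.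
  set A := itg t _ in h1 *; set B := itg s _ in h2 *; set C := itg T _ in h1 *.
  have : c * A <= c * C by rewrite ler_pM2l.
  have : 0 <= c * B by rewrite mulr_ge0// ltW.
  rewrite -(addrC (- s)) /=; lra.
have h1 := key v vi (fun=> erefl).
have := key (fun r => (-1) * v r) (sqintZ _ vi) (fun r => _).
rewrite !itgZ; [|exact: intgS sT (sqint_intg vi)|exact: intgS tT (sqint_intg vi)].
move=> /(_ (fun r => ltac:(ring))) h2.
rewrite (h t) ?t0// (h s) ?s0// ler_norml; apply/andP; split; lra.
Qed.

Lemma weak_continuous T x v : weak_derivative T x v -> {within `[0, T], continuous x}.
Proof.
move=> /[dup] xv /weakP[vi h].
have [T0|T0] := leP 0 T; last first.
  by rewrite set_itv_ge ?bnd_simp -?ltNge//; exact: continuous_subspace0.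
have := parameterized_integral_continuous T0 (sqint_intg vi).
move=> hc.
have : {within `[0, T], continuous (fun t => x 0 + parameterized_integral lebesgue_measure 0 t v)}.
  by move=> t; apply: cvgD; [exact: cvg_cst|exact: hc].
apply: subspace_eq_continuous => t; rewrite inE/= in_itv/= => tT.
by rewrite [RHS]h.
Qed.

(** Tested against these functions, a weak Euler-Lagrange equation becomes a
    formula for the value of its solution at r. *)
Lemma weak_min T r : 0 <= r -> r <= T ->
  weak_derivative T (fun t => Num.min t r) (\1_(`[0, r])).
Proof.
move=> r0 rT; apply/weakP; split.
  split; first exact: measurable_indic.
  apply: (@intg_dom _ _ (fun=> 1)).
  - by apply: measurable_funM; exact: measurable_indic.
  - exact: intg_cst.
  - by move=> t _; rewrite indicE; case: (_ \in _); rewrite ?expr1n ?expr0n ?normr1 ?normr0.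
move=> t /andP[t0 tT].
rewrite (min_idPl r0) add0r /itg.
have -> : \int[leb]_(s in `[0, t]) \1_`[0, r] s = \int[leb]_(s in `[0, t] `&` `[0, r]) 1.
  rewrite Rintegral_mkcondr; apply: eq_Rintegral => s _.
  by rewrite patchE indicE; case: ifP.
have -> : `[0, t] `&` `[0, r] = (`[0, Num.min t r])%classic :> set R.
  apply/seteqP; split => s /=; rewrite !in_itv/= le_min.
    by move=> [/andP[-> ->] /andP[_ ->]].
  by move=> /and3P[-> -> ->].
have := itg_cst 1; rewrite /itg => ->; first by rewrite mul1r.
by rewrite le_min t0.
Qed.

End integral.

(** * The regularised potentials *)

Section glue.
Variable R : realType.
Implicit Types (a x d : R) (G H : R -> R).

Definition glue a G H x := if x < a then G x else H x.

Lemma glueL a G H x : x < a -> glue a G H x = G x.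
Proof. by rewrite /glue => ->. Qed.

Lemma glueR a G H x : a <= x -> glue a G H x = H x.
Proof. by rewrite /glue ltNge => ->. Qed.

Lemma glue_is_derive a G H x d : G a = H a ->
  (x <= a -> is_derive x 1 G d) -> (a <= x -> is_derive x 1 H d) ->
  is_derive x 1 (glue a G H) d.
Proof.
move=> GH Gd Hd; have [xa|ax|/esym xa] := ltgtP x a.
- have h := Gd (ltW xa); apply: (near_eq_is_derive _ h).
  near=> y; rewrite /glue ifT//; near: y; exact: lt_nbhsl.
- have h := Hd (ltW ax); apply: (near_eq_is_derive _ h).
  near=> y; rewrite /glue ifN// -leNgt ltW//; near: y; exact: lt_nbhsr.
- subst x; have /Gd [dG eG] := lexx a; have /Hd [dH eH] := lexx a.
  have cG : h^-1 *: (G (h *: 1 + a) - G a) @[h --> 0^'] --> d by rewrite -eG.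
  have cH : h^-1 *: (H (h *: 1 + a) - H a) @[h --> 0^'] --> d by rewrite -eH.
  have : h^-1 *: (glue a G H (h *: 1 + a) - glue a G H a) @[h --> 0^'] --> d.
    apply/cvgrPdist_le => e e0.
    move/cvgrPdist_le : cG => /(_ _ e0); move/cvgrPdist_le : cH => /(_ _ e0).
    apply: filterS2 => h hH hG.
    rewrite {2}/glue ltxx /glue; case: ifP => _ //.
    by rewrite -GH.
  move=> hc; split; first by apply/cvg_ex; exists d.
  exact: cvg_lim hc.
Unshelve. all: by end_near. Qed.

Lemma glue_continuous a G H x : G a = H a ->
  (x <= a -> {for x, continuous G}) -> (a <= x -> {for x, continuous H}) ->
  {for x, continuous (glue a G H)}.
Proof.
move=> GH Gd Hd.
have [xa|ax|/esym xa] := ltgtP x a; rewrite /prop_for /continuous_at.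
- have -> : glue a G H x = G x by rewrite /glue xa.
  apply: (cvg_trans _ (Gd (ltW xa))).
  by apply: near_eq_cvg; near=> y; rewrite /glue ifT//; near: y; exact: lt_nbhsl.
- have -> : glue a G H x = H x by rewrite /glue ltNge (ltW ax).
  apply: (cvg_trans _ (Hd (ltW ax))).
  apply: near_eq_cvg; near=> y; rewrite /glue ifN// -leNgt ltW//.
  by near: y; exact: lt_nbhsr.
- subst x; apply/cvgrPdist_le => e e0.
  have /cvgrPdist_le/(_ _ e0) := Gd (lexx a); have /cvgrPdist_le/(_ _ e0) := Hd (lexx a).
  apply: filterS2 => h hH hG.
  rewrite {1}/glue ltxx /glue; case: ifP => _ //.
  by rewrite -GH.
Unshelve. all: by end_near. Qed.

End glue.

(** The properties of f that its regularisation keeps.  The derivative is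
    monotone and the tangents lie below the graph on the half line s >= 0 only:
    for s < 0 the regularisation bends to a constant. *)
Record attractive (R : realType) (alpha : R) (phi dphi : R -> R) : Prop := {
  att_derive : forall s : R, is_derive s (1 : R) phi (dphi s);
  att_continuous : continuous dphi;
  att_gt0 : forall s, 0 < phi s;
  att_le0 : forall s, dphi s <= 0;
  att_nd : forall s t, 0 <= s -> s <= t -> dphi s <= dphi t;
  att_tangent : forall s t, 0 <= s -> 0 <= t -> phi s + dphi s * (t - s) <= phi t;
  att_alpha : forall s, 0 <= s * dphi s + alpha * phi s }.

Record repulsive (R : realType) (alpha : R) (gam dgam : R -> R) : Prop := {
  rep_derive : forall s : R, 0 < s -> is_derive s (1 : R) gam (dgam s);
  rep_continuous : forall s, 0 < s -> {for s, continuous dgam};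
  rep_ge0 : forall s, 0 < s -> 0 <= gam s;
  rep_le0 : forall s, 0 < s -> dgam s <= 0;
  rep_ni : forall s t, 0 < s -> s <= t -> gam t <= gam s;
  rep_alpha : forall s, 0 < s -> s * dgam s + alpha * gam s <= 0 }.

Section regularised_attraction.
Variables (R : realType) (f : R -> R) (alpha e : R).
Hypothesis fP : singular_potential f.
Hypothesis alpha0 : 0 < alpha.
Hypothesis f_alpha : forall s, 0 < s -> 0 <= s * derive1 f s + alpha * f s.
Hypothesis e0 : 0 < e.
Local Notation f' := (derive1 f).
Implicit Types (s t x y : R).

Let lin s := f e + f' e * (s - e).
Let quad s := f e - e * f' e + f' e * s + f' e / (2 * e) * s ^+ 2.

Definition df_reg : R -> R :=
  glue (- e) (cst 0) (glue 0 (fun s => f' e + f' e / e * s)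
    (glue e (cst (f' e)) f')).

(** In this form the formulas are differentiated one junction at a time. *)
Lemma f_regE : f_reg f e =
  glue (- e) (cst (quad (- e))) (glue 0 quad (glue e lin f)).
Proof.
have e0' := e0.
apply/funext => s; rewrite /f_reg /glue.
have [se|es] := ltP s (- e).
  rewrite ifN; last by apply/negP => h; lra.
  by rewrite ifN//; apply/negP => h; lra.
by case: (leP 0 s) => s0; case: (leP e s) => h //; exfalso; lra.
Qed.

Lemma f_reg_derive s : is_derive s 1 (f_reg f e) (df_reg s).
Proof.
have e0' := e0.
rewrite f_regE.
have Ne0 : - e < 0 by lra.
have quad_glue : quad (- e) = glue 0 quad (glue e lin f) (- e) by rewrite glueL.
have lin_f : lin e = f e by rewrite /lin subrr mulr0 addr0.
have quad_lin : quad 0 = glue e lin f 0 by rewrite glueL// /quad /lin; ring.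
have quad_d t : is_derive t 1 quad (f' e + f' e / e * t).
  by apply: is_derive_eq; rewrite /GRing.scale/=; field; rewrite gt_eqF.
have lin_d t : is_derive t 1 lin (f' e).
  by apply: is_derive_eq; rewrite /GRing.scale/=; ring.
have [h1|h1] := ltP s (- e).
  apply: glue_is_derive => //; last by rewrite leNgt h1.
  by move=> _; rewrite /df_reg glueL//; exact: is_derive_cst.
apply: glue_is_derive => //.
  move=> h2; have -> : s = - e by apply/le_anti; rewrite h1 h2.
  have -> : df_reg (- e) = 0.
    by rewrite /df_reg glueR// glueL//; field; rewrite gt_eqF.
  exact: is_derive_cst.
move=> _; rewrite /df_reg glueR//.
apply: glue_is_derive => //.
- rewrite le_eqVlt => /predU1P[->|s0]; last by rewrite glueL.
  by rewrite glueR// glueL// /cst; have := quad_d 0; rewrite mulr0 addr0.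
- move=> s0; rewrite glueR//; apply: glue_is_derive => //.
    rewrite le_eqVlt => /predU1P[->|se]; last by rewrite glueL//; exact: lin_d.
    by rewrite glueR//; exact: lin_d.
  by move=> es; rewrite glueR//; apply: pot_derive => //; exact: lt_le_trans es.
Qed.

Lemma df_reg_continuous : continuous df_reg.
Proof.
have e0' := e0; have Ne0 : - e < 0 by lra.
move=> s; apply: glue_continuous.
- by rewrite glueL// /cst; field; rewrite gt_eqF.
- by move=> _; exact: cst_continuous.
move=> _; apply: glue_continuous.
- by rewrite glueL// mulr0 addr0.
- by move=> _; apply: cvgD; [exact: cvg_cst|apply: cvgMr; exact: cvg_id].
move=> s0; apply: glue_continuous => //.
- by move=> _; exact: cst_continuous.
- by move=> es; apply: (pot_d_continuous fP); exact: lt_le_trans es.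
Qed.

Lemma f_regr s : e <= s -> f_reg f e s = f s.
Proof. have e0' := e0; by move=> es; rewrite f_regE /glue; do 3 (case: ifP; first lra; move=> _). Qed.

Lemma df_regr s : e <= s -> df_reg s = f' s.
Proof. have e0' := e0; by move=> es; rewrite /df_reg /glue; do 3 (case: ifP; first lra; move=> _). Qed.

Lemma df_reg_le0 s : df_reg s <= 0.
Proof.
have e0' := e0.
have fe := pot_d_le0 fP e0; rewrite /df_reg /glue.
case: ltP => // h1; case: ltP => h2; last first.
  by case: ltP => // h3; apply: pot_d_le0 => //; exact: lt_le_trans h3.
rewrite (_ : _ + _ = f' e * ((e + s) / e)); last by field; rewrite gt_eqF.
by rewrite mulr_le0_ge0//; apply: divr_ge0; lra.
Qed.

Lemma f_reg_ni s t : s <= t -> f_reg f e t <= f_reg f e s.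
Proof.
move=> st; apply: (deriv_le0_ge st (df := df_reg)) => x _; first exact: f_reg_derive.
exact: df_reg_le0.
Qed.

Lemma f_reg_gt0 s : 0 < f_reg f e s.
Proof.
have e0' := e0.
have [se|es] := leP s e; last by rewrite f_regr ?ltW//; apply: pot_gt0 => //; lra.
by rewrite (lt_le_trans _ (f_reg_ni se))// f_regr//; exact: pot_gt0.
Qed.

Lemma df_reg_ge0E s : 0 <= s -> df_reg s = glue e (cst (f' e)) f' s.
Proof.
have e0' := e0; move=> s0; rewrite /df_reg glueR; last lra.
by rewrite glueR.
Qed.

Lemma f_reg_ge0E s : 0 <= s -> f_reg f e s = glue e lin f s.
Proof.
have e0' := e0; move=> s0; rewrite f_regE glueR; last lra.
by rewrite glueR.
Qed.

Lemma df_reg_nd s t : 0 <= s -> s <= t -> df_reg s <= df_reg t.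
Proof.
move=> s0 st; rewrite !df_reg_ge0E//; last exact: le_trans st.
have [es|se] := leP e s; first by rewrite !glueR ?(le_trans es)//; apply: pot_d_nd => //; exact: lt_le_trans es.
rewrite glueL//; have [et|te] := leP e t; last by rewrite glueL.
by rewrite glueR//; exact: pot_d_nd.
Qed.

Lemma f_reg_tangent s y : 0 <= s -> 0 <= y ->
  f_reg f e s + df_reg s * (y - s) <= f_reg f e y.
Proof.
have e0' := e0.
move=> s0 y0; have [sy|ys] := leP s y.
  apply: (deriv_ge_lin sy (df := df_reg)) => x xs; first exact: f_reg_derive.
  by apply: df_reg_nd => //; lra.
have := deriv_le_lin (ltW ys) (f := f_reg f e) (df := df_reg) (k := df_reg s).
move=> h; suff : f_reg f e s <= f_reg f e y + df_reg s * (s - y) by lra.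
apply: h => x xs; first exact: f_reg_derive.
by apply: df_reg_nd => //; lra.
Qed.

(** On [0, e] the right-hand side is affine in s with slope
    (1 + alpha) f' e <= 0, and it is nonnegative at e; for s < 0 both terms are
    nonnegative. *)
Lemma f_reg_alpha s : 0 <= s * df_reg s + alpha * f_reg f e s.
Proof.
have e0' := e0; have a0 := alpha0.
have [s0|s0] := ltP s 0.
  by have := df_reg_le0 s; have := f_reg_gt0 s; nra.
have [es|se] := leP e s.
  by rewrite df_regr// f_regr//; apply: f_alpha; exact: lt_le_trans es.
have fe := pot_d_le0 fP e0; have := f_alpha e0.
rewrite f_reg_ge0E// df_reg_ge0E// !glueL// /lin /cst => h.
have h1 : 0 <= (1 + alpha) * (f' e * (s - e)).
  by apply: mulr_ge0; [lra|apply: mulr_le0; lra].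
apply: le_trans (addr_ge0 h h1) _; rewrite le_eqVlt; apply/orP; left.
by apply/eqP; ring.
Qed.

Lemma f_reg_continuous : continuous (f_reg f e).
Proof. by move=> s; apply: is_derive_continuous (f_reg_derive s). Qed.

Lemma f_reg_attractive : attractive alpha (f_reg f e) df_reg.
Proof.
split; [exact: f_reg_derive|exact: df_reg_continuous|exact: f_reg_gt0|
  exact: df_reg_le0|exact: df_reg_nd|exact: f_reg_tangent|exact: f_reg_alpha].
Qed.

End regularised_attraction.

Section regularised_repulsion.
Variables (R : realType) (g psi : R -> R) (alpha mu e : R).
Hypothesis gP : singular_potential g.
Hypothesis alpha2 : alpha < 2.
Hypothesis g_alpha : forall s, 0 < s -> s * derive1 g s + alpha * g s <= 0.
Hypothesis psiP : cutoff e psi.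
Hypothesis mu0 : 0 < mu.
Hypothesis e0 : 0 < e.
Local Notation g' := (derive1 g).
Implicit Types (s t x y : R).

Definition dG_reg s := mu * g' s + (derive1 psi s / s ^+ 2 - 2 * psi s / s ^+ 3).

Let psi_d s : is_derive s 1 psi (derive1 psi s).
Proof. by case: psiP => h _ _ _ _; rewrite derive1E; apply: derivableP; exact: (h 0%N). Qed.

Let dpsi_c s : {for s, continuous (derive1 psi)}.
Proof.
case: psiP => h _ _ _ _; apply/differentiable_continuous/derivable1_diffP.
exact: (h 1%N).
Qed.

Let psi_ge0 s : 0 <= psi s.
Proof.
case: psiP => _ h [_ h0] _ _.
by rewrite -(h0 (Num.max s e)) ?le_max ?lexx ?orbT//; apply: h; rewrite le_max lexx.
Qed.

Let dpsi_le0 s : derive1 psi s <= 0.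
Proof.
have e0' := e0.
case: psiP => _ h _ _ _.
rewrite leNgt; apply/negP => d0.
have [d d0' hd] := deriv_gt0_slope (psi_d s) d0.
have := hd (d / 2); rewrite gt_eqF ?divr_gt0// gtr0_norm ?divr_gt0//.
have -> : d / 2 < d by lra.
move=> /(_ isT isT); rewrite ltNge => /negP; apply.
apply: mulr_ge0_le0; first by rewrite invr_ge0; lra.
by rewrite subr_le0; apply: h; lra.
Qed.

Let psi0 s : e < s -> psi s = 0.
Proof. by case: psiP => _ _ [_ h] _ _ /ltW/h. Qed.

Let dpsi0 s : e < s -> derive1 psi s = 0.
Proof.
move=> es; rewrite derive1E (@near_eq_derive _ _ _ _ (cst 0)) ?derive_cst//.
by near=> t; rewrite psi0//; near: t; exact: lt_nbhsr.
Unshelve. all: by end_near. Qed.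

Lemma G_reg_derive s : 0 < s -> is_derive s 1 (G_reg g psi mu) (dG_reg s).
Proof.
move=> s0; have hg := pot_derive gP s0; have hpsi := psi_d s.
have s2 : s ^+ 2 != 0 by rewrite expf_neq0// gt_eqF.
have hq : is_derive s 1 (fun s : R => s ^+ 2) (2 * s).
  by apply: is_derive_eq; rewrite /GRing.scale/=; ring.
have hi : is_derive s 1 (fun s : R => (s ^+ 2)^-1) (- (s ^+ 2) ^- 2 *: (2 * s)).
  exact: is_deriveV.
rewrite /G_reg; apply: is_derive_eq; rewrite /dG_reg /GRing.scale/=.
by field; rewrite gt_eqF.
Qed.

Lemma dG_reg_continuous s : 0 < s -> {for s, continuous dG_reg}.
Proof.
move=> s0; apply: cvgD; first by apply: cvgMr; exact: (pot_d_continuous gP).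
apply: cvgB.
  apply: cvgM; first exact: dpsi_c.
  apply: cvgV; first by rewrite expf_neq0// gt_eqF.
  exact: exprn_continuous.
apply: cvgM.
  by apply: cvgMr; exact: is_derive_continuous (psi_d s).
apply: cvgV; first by rewrite expf_neq0// gt_eqF.
exact: exprn_continuous.
Qed.

Lemma G_reg_ge0 s : 0 < s -> 0 <= G_reg g psi mu s.
Proof.
move=> s0; apply: addr_ge0.
  by apply: mulr_ge0; [exact: ltW|exact/ltW/(pot_gt0 gP)].
by apply: divr_ge0 => //; exact/exprn_ge0/ltW.
Qed.

Lemma dG_reg_le0 s : 0 < s -> dG_reg s <= 0.
Proof.
have e0' := e0.
move=> s0; rewrite /dG_reg.
have h1 : mu * g' s <= 0 by apply: mulr_ge0_le0; [exact: ltW|exact: (pot_d_le0 gP)].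
have h2 : derive1 psi s / s ^+ 2 <= 0.
  by apply: mulr_le0_ge0; [exact: dpsi_le0|rewrite invr_ge0; exact/exprn_ge0/ltW].
have h3 : 0 <= 2 * psi s / s ^+ 3.
  by apply: divr_ge0; [exact: mulr_ge0|exact/exprn_ge0/ltW].
lra.
Qed.

Lemma G_reg_ni s t : 0 < s -> s <= t -> G_reg g psi mu t <= G_reg g psi mu s.
Proof.
move=> s0 st; apply: (deriv_le0_ge st (df := dG_reg)) => x /andP[sx _].
  by apply: G_reg_derive; exact: lt_le_trans sx.
by apply: dG_reg_le0; exact: lt_trans sx.
Qed.

(** Up to the decreasing factor psi the additional term psi / s^2 is homogeneous
    of degree - 2, and alpha < 2. *)
Lemma G_reg_alpha s : 0 < s -> s * dG_reg s + alpha * G_reg g psi mu s <= 0.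
Proof.
have e0' := e0; have a2 := alpha2.
move=> s0.
have -> : s * dG_reg s + alpha * G_reg g psi mu s =
    mu * (s * g' s + alpha * g s) + (derive1 psi s / s + (alpha - 2) * (psi s / s ^+ 2)).
  by rewrite /dG_reg /G_reg; field; rewrite gt_eqF.
have h1 : mu * (s * g' s + alpha * g s) <= 0 by apply: mulr_ge0_le0; [exact: ltW|exact: g_alpha].
have h2 : derive1 psi s / s <= 0 by apply: mulr_le0_ge0; [exact: dpsi_le0|rewrite invr_ge0 ltW].
have h3 : (alpha - 2) * (psi s / s ^+ 2) <= 0.
  by apply: mulr_le0_ge0; [lra|apply: divr_ge0 => //; exact/exprn_ge0/ltW].
lra.
Qed.

Lemma G_regr s : e < s -> G_reg g psi mu s = mu * g s.
Proof. by move=> es; rewrite /G_reg psi0// mul0r addr0. Qed.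

Lemma dG_regr s : e < s -> dG_reg s = mu * g' s.
Proof. by move=> es; rewrite /dG_reg dpsi0// psi0//; ring. Qed.

Lemma G_reg_repulsive : repulsive alpha (G_reg g psi mu) dG_reg.
Proof.
split; [exact: G_reg_derive|exact: dG_reg_continuous|exact: G_reg_ge0|
  exact: dG_reg_le0|exact: G_reg_ni|exact: G_reg_alpha].
Qed.

End regularised_repulsion.

(** * First variation of the action *)

Section within.
Variable R : realType.
Implicit Types (T t s e k : R) (u w h : R -> R).

Lemma withinP T u : {within `[0, T], continuous u} <->
  forall t, 0 <= t <= T -> u s @[s --> within `[0, T] (nbhs t)] --> u t.
Proof.
split; first by move/subspace_continuousP => uc t tT; apply: uc; rewrite /= in_itv.
by move=> uc; apply/subspace_continuousP => t /=; rewrite in_itv/=; exact: uc.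
Qed.

Lemma within_eq T u w : (forall t, 0 <= t <= T -> u t = w t) ->
  {within `[0, T], continuous u} -> {within `[0, T], continuous w}.
Proof.
move=> uw; apply: subspace_eq_continuous => t; rewrite inE/= in_itv/= => /uw.
by [].
Qed.

Lemma within_comp T u h : {within `[0, T], continuous u} ->
  (forall t, 0 <= t <= T -> {for u t, continuous h}) ->
  {within `[0, T], continuous (fun t => h (u t))}.
Proof.
move=> /withinP uc hc; apply/withinP => t tT.
by apply: (cvg_comp _ _ (uc t tT)); exact: hc.
Qed.

Lemma withinD T u w : {within `[0, T], continuous u} ->
  {within `[0, T], continuous w} ->
  {within `[0, T], continuous (fun t => u t + w t)}.
Proof. by move=> uc wc t; apply: cvgD; [exact: uc|exact: wc]. Qed.

Lemma withinB T u w : {within `[0, T], continuous u} ->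
  {within `[0, T], continuous w} ->
  {within `[0, T], continuous (fun t => u t - w t)}.
Proof. by move=> uc wc t; apply: cvgB; [exact: uc|exact: wc]. Qed.

Lemma withinM T u w : {within `[0, T], continuous u} ->
  {within `[0, T], continuous w} ->
  {within `[0, T], continuous (fun t => u t * w t)}.
Proof. by move=> uc wc t; apply: cvgM; [exact: uc|exact: wc]. Qed.

Lemma withinZ T k u : {within `[0, T], continuous u} ->
  {within `[0, T], continuous (fun t => k * u t)}.
Proof. by move=> uc t; apply: cvgMr; exact: uc. Qed.

Lemma within_bounded T u : {within `[0, T], continuous u} ->
  exists2 K, 0 < K & forall t, 0 <= t <= T -> `|u t| <= K.
Proof.
move=> uc; have [T0|T0] := leP 0 T; last first.
  by exists 1 => // t /andP[t0 tT]; move: (le_trans t0 tT); rewrite leNgt T0.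
have uc' : {within `[0, T], continuous (fun t => `|u t|)}.
  by apply: within_comp uc _ => t _; exact: norm_continuous.
have [c _ hc] := EVT_max T0 uc'.
exists (`|u c| + 1); first by rewrite ltr_wpDl.
move=> t tT; apply: le_trans (hc t _) _; first by rewrite in_itv.
by rewrite lerDl.
Qed.

Lemma within_pos_lbound T u : 0 <= T -> {within `[0, T], continuous u} ->
  (forall t, 0 <= t <= T -> 0 < u t) ->
  exists2 m, 0 < m & forall t, 0 <= t <= T -> m <= u t.
Proof.
move=> T0 uc u0; have [c cT hc] := EVT_min T0 uc.
exists (u c); first by apply: u0; move: cT; rewrite in_itv.
by move=> t tT; apply: hc; rewrite in_itv.
Qed.

Lemma segment_bounded (a b : R) h : (forall s, a <= s <= b -> {for s, continuous h}) ->
  exists2 K, 0 < K & forall s, a <= s <= b -> `|h s| <= K.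
Proof.
move=> hc; have [ab|ba] := leP a b; last first.
  by exists 1 => // t /andP[t0 tT]; move: (le_trans t0 tT); rewrite leNgt ba.
have uc' : {within `[a, b], continuous (fun t => `|h t|)}.
  apply: continuous_in_subspaceT => t; rewrite inE/= in_itv/= => /hc ht.
  by apply: continuous_comp ht _; exact: norm_continuous.
have [c _ hc'] := EVT_max ab uc'.
exists (`|h c| + 1); first by rewrite ltr_wpDl.
move=> t tT; apply: le_trans (hc' t _) _; first by rewrite in_itv.
by rewrite lerDl.
Qed.

End within.

Section variation.
Variables (R : realType) (T : R).
Hypothesis T0 : 0 < T.
Implicit Types (t s e B : R).

(** The bound B, uniform in t and in small s, is the domination that allows
    differentiation under the integral. *)
Lemma parametric_derive (N dN : R -> R -> R) e B : 0 < e -> 0 <= B ->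
  (forall s, `|s| < e -> intg T (N s)) ->
  (forall s t, `|s| < e -> 0 <= t <= T -> is_derive s (1 : R) (N^~ t) (dN s t)) ->
  (forall s t, `|s| < e -> 0 <= t <= T -> `|dN s t| <= B) ->
  is_derive (0 : R) (1 : R) (fun s => itg T (N s)) (itg T (dN 0)).
Proof.
move=> e0 B0 Ni Nd NB.
have I0 : (`]- e, e[%classic : set R) 0 by rewrite /= in_itv/= oppr_lt0 e0.
have Ie s : (`]- e, e[%classic : set R) s -> `|s| < e.
  by rewrite /= in_itv/= ltr_norml.
have der s t : (`]- e, e[%classic : set R) s -> (`[0, T]%classic : set R) t ->
    is_derive s (1 : R) (N^~ t) (dN s t).
  by move=> /Ie se tT; apply: Nd => //; rewrite /= in_itv in tT.
have pE s t : (`]- e, e[%classic : set R) s -> (`[0, T]%classic : set R) t ->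
    partial1of2 N s t = dN s t.
  move=> se tT; rewrite partial1of2E.
  by have [_ ->] := der s t se tT.
have /(_ _ _ _ _ _ _ _ _) H := @cvg_differentiation_under_integral R _
  (measurableTypeR R) lebesgue_measure N `[0, T] (measurable_itv _) 0 (- e) e I0.
have cv : h^-1 *: (itg T (N (h *: 1 + 0)) - itg T (N 0)) @[h --> 0^'] --> itg T (dN 0).
  have -> : itg T (dN 0) = \int[lebesgue_measure]_(t in `[0, T]) (partial1of2 N 0 t).
    by apply: eq_itg => t tT; rewrite pE//= in_itv.
  have := H _ _ (cst B) _ _ _.
  rewrite (_ : (fun h : R => _ *: (itg T (N (h *: 1 + 0)) - itg T (N 0))) =
    (fun h : R => h^-1 *: (itg T (N (h + 0)) - itg T (N 0)))); last first.
    by apply/funext => h; rewrite /GRing.scale/= mulr1.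
  apply => //.
  - by move=> s /Ie; exact: Ni.
  - by move=> s t se tT; have [] := der s t se tT.
  - exact: intg_cst.
  - move=> s t se tT; rewrite pE//; apply: NB; first exact: Ie.
    by rewrite /= in_itv in tT.
split; first by apply/cvg_ex; exists (itg T (dN 0)).
exact: cvg_lim cv.
Qed.

(** The kinetic term is a quadratic polynomial in s; only N has to be
    differentiated under the integral.  J is kept apart from the integral because
    the weak derivative of a perturbed curve is p + s r almost everywhere only. *)
Lemma action_derive (p1 r1 p2 r2 : R -> R) (N dN : R -> R -> R) (J : R -> R) e B :
  sqint T p1 -> sqint T r1 -> sqint T p2 -> sqint T r2 ->
  0 < e -> 0 <= B ->
  (forall s, `|s| < e -> intg T (N s)) ->
  (forall s t, `|s| < e -> 0 <= t <= T -> is_derive s (1 : R) (N^~ t) (dN s t)) ->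
  (forall s t, `|s| < e -> 0 <= t <= T -> `|dN s t| <= B) ->
  (forall s, `|s| < e -> J s = itg T (fun t =>
     2^-1 * ((p1 t + s * r1 t) ^+ 2 + (p2 t + s * r2 t) ^+ 2) + N s t)) ->
  is_derive (0 : R) (1 : R) J
    (itg T (fun t => p1 t * r1 t + p2 t * r2 t) + itg T (dN 0)).
Proof.
move=> p1i r1i p2i r2i e0 B0 Ni Nd NB JE.
have Pd := parametric_derive e0 B0 Ni Nd NB.
pose c0 := itg T (fun t => 2^-1 * (p1 t ^+ 2 + p2 t ^+ 2)).
pose c1 := itg T (fun t => p1 t * r1 t + p2 t * r2 t).
pose c2 := itg T (fun t => 2^-1 * (r1 t ^+ 2 + r2 t ^+ 2)).
have i0 : intg T (fun t => 2^-1 * (p1 t ^+ 2 + p2 t ^+ 2)).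
  by apply: intgZ; apply: intgD; [case: p1i|case: p2i].
have i1 : intg T (fun t => p1 t * r1 t + p2 t * r2 t).
  by apply: intgD; apply: sqint_mul.
have i2 : intg T (fun t => 2^-1 * (r1 t ^+ 2 + r2 t ^+ 2)).
  by apply: intgZ; apply: intgD; [case: r1i|case: r2i].
have JE' s : `|s| < e -> c0 + s * c1 + s ^+ 2 * c2 + itg T (N s) = J s.
  move=> se; rewrite JE// /c0 /c1 /c2 -(itgZ _ i1) -(itgZ _ i2) -!itgD//.
  - by apply: eq_itg => t _; field.
  - by apply: intgD; [apply: intgD|]; rewrite ?i0//; exact: intgZ.
  - exact: Ni.
  - by apply: intgD => //; exact: intgZ.
  - exact: intgZ.
  - exact: intgZ.
have Qd : is_derive (0 : R) (1 : R)
    (fun s => c0 + s * c1 + s ^+ 2 * c2 + itg T (N s)) (c1 + itg T (dN 0)).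
  by apply: is_derive_eq; rewrite /GRing.scale/=; ring.
apply: near_eq_is_derive Qd.
exists e => //= s; rewrite /ball/= sub0r normrN; exact: JE'.
Qed.

End variation.

Section euler_lagrange.
Variables (R : realType) (T : R).
Hypothesis T0 : 0 < T.
Implicit Types (t s e B : R) (x y u w v : R -> R).
Variables phi dphi : R -> R.
Hypothesis phi_d : forall s, is_derive s (1 : R) phi (dphi s).
Hypothesis dphi_c : continuous dphi.

Let phi_c : continuous phi.
Proof. by move=> s; exact: is_derive_continuous (phi_d s). Qed.

Lemma ae_wderiv_shift x y w s : in_H1 T x -> weak_derivative T y w ->
  ae0 T (wderiv T (fun t => x t + s * y t)) (fun t => wderiv T x t + s * w t).
Proof.
move=> /in_H1_wderiv xi yi; have xyi := weak_lin s xi yi.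
apply: (weak_unique _ xyi); apply: in_H1_wderiv.
by exists (fun t => wderiv T x t + s * w t).
Qed.

Lemma ae_wderiv x w : weak_derivative T x w -> ae0 T (wderiv T x) w.
Proof. by move=> xi; apply: (weak_unique _ xi); apply: in_H1_wderiv; exists w. Qed.

Lemma sqint_wderiv x : in_H1 T x -> sqint T (wderiv T x).
Proof. by move=> /in_H1_wderiv /weakP[]. Qed.

Definition action1 x := itg T (fun t => 2^-1 * wderiv T x t ^+ 2 + phi (x t)).

Let path_bound x y : {within `[0, T], continuous x} -> {within `[0, T], continuous y} ->
  exists2 B, 0 <= B & forall s t, `|s| < 1 -> 0 <= t <= T ->
    `|dphi (x t + s * y t) * y t| <= B.
Proof.
move=> xc yc; have [Kx Kx0 hx] := within_bounded xc.
have [Ky Ky0 hy] := within_bounded yc.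
have [K K0 hK] := @segment_bounded _ (- (Kx + Ky)) (Kx + Ky) dphi (fun s _ => @dphi_c s).
exists (K * Ky); first by rewrite mulr_ge0// ltW.
move=> s t s1 tT; rewrite normrM ler_pM//; last exact: hy.
apply: hK; rewrite -ler_norml (le_trans (ler_normD _ _))// lerD ?hx// normrM.
by rewrite -[leRHS]mul1r ler_pM// ?hy// ltW.
Qed.

Let phi_path x y t s : is_derive s (1 : R) (fun s => phi (x t + s * y t)) (dphi (x t + s * y t) * y t) .
Proof.
have h1 : is_derive s (1 : R) (fun s => x t + s * y t) (y t).
  by apply: is_derive_eq; rewrite /GRing.scale/=; ring.
have := @is_derive1_comp _ phi (fun s => x t + s * y t) s (dphi (x t + s * y t)) (y t) (phi_d _) h1.
by [].
Qed.

Lemma within_line x y s : {within `[0, T], continuous x} -> {within `[0, T], continuous y} ->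
  {within `[0, T], continuous (fun t => x t + s * y t)}.
Proof. by move=> xc yc; apply: withinD => //; exact: withinZ. Qed.

Lemma measurable_within u : {within `[0, T], continuous u} -> measurable_fun `[0, T] u.
Proof. by move=> uc; apply: intg_measurable; exact: intg_continuous. Qed.

Lemma action1_derive x y w : in_H1 T x -> weak_derivative T y w ->
  is_derive (0 : R) (1 : R) (fun s => action1 (fun t => x t + s * y t))
    (itg T (fun t => wderiv T x t * w t + dphi (x t) * y t)).
Proof.
move=> xi yw; have xc := weak_continuous (in_H1_wderiv xi).
have yc := weak_continuous yw; have wi : sqint T w by case/weakP : yw.
have [B B0 hB] := path_bound xc yc.
have pi := sqint_wderiv xi.
have := @action_derive _ T (wderiv T x) w (fun=> 0) (fun=> 0)
  (fun s t => phi (x t + s * y t)) (fun s t => dphi (x t + s * y t) * y t)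
  (fun s => action1 (fun t => x t + s * y t)) 1 B pi wi
  (sqint_cst _ _) (sqint_cst _ _) ltr01 B0.
have -> : itg T (fun t => wderiv T x t * w t + dphi (x t) * y t) =
  itg T (fun t => wderiv T x t * w t + 0 * 0) + itg T (fun t => dphi (x t + 0 * y t) * y t).
  rewrite -itgD.
  - by apply: eq_itg => t _; rewrite !mul0r !addr0.
  - apply: intgD; last exact: intg_cst.
    exact: sqint_mul.
  - apply: intg_continuous; apply: withinM => //.
    by apply: (within_comp (h := dphi) (within_line (s := 0) xc yc)) => t _; exact: dphi_c.
apply.
- move=> s _; apply: intg_continuous.
  by apply: (within_comp (h := phi) (within_line (s := s) xc yc)) => t _; exact: phi_c.
- by move=> s t _ _; exact: phi_path.
- exact: hB.
- move=> s _; apply: itg_ae; last first.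
  + apply: (@filterS _ _ (ae_filter_ringOfSetsType lebesgue_measure)) (ae_wderiv_shift s xi yw) => t h tT.
    by rewrite h// mulr0 addr0 expr0n addr0.
  + have [mw _] := wi; have [mp _] := pi.
    apply: measurable_funD; last first.
      apply: measurable_within; apply: (within_comp (h := phi) (within_line (s := s) xc yc)) => t _; exact: phi_c.
    apply: measurable_funM => //; apply: measurable_funD => //.
    by do 2 (apply: measurable_funX; apply: measurable_funD => //; apply: measurable_funM => //).
  + apply: measurable_funD; last first.
      apply: measurable_within; apply: (within_comp (h := phi) (within_line (s := s) xc yc)) => t _; exact: phi_c.
    apply: measurable_funM => //; apply: measurable_funX.
    have [] // := @sqint_wderiv (fun t => x t + s * y t).
    by exists (fun t => wderiv T x t + s * w t); apply: weak_lin => //; exact: in_H1_wderiv.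
Qed.

Variables gam dgam : R -> R.
Hypothesis gam_d : forall s, 0 < s -> is_derive s (1 : R) gam (dgam s).
Hypothesis dgam_c : forall s, 0 < s -> {for s, continuous dgam}.

Let gam_c s : 0 < s -> {for s, continuous gam}.
Proof. by move/gam_d; exact: is_derive_continuous. Qed.

Definition action2 (q : (R -> R) * (R -> R)) := itg T (fun t =>
  2^-1 * (wderiv T q.1 t ^+ 2 + wderiv T q.2 t ^+ 2) + phi (q.1 t) + phi (q.2 t)
  - gam (q.2 t - q.1 t)).

(** The gap q2 - q1 has a positive minimum, so for small s the perturbed pair does
    not meet the singularity of gam. *)
Lemma action2_derive q1 q2 y1 y2 w1 w2 : calD T (q1, q2) ->
  weak_derivative T y1 w1 -> weak_derivative T y2 w2 ->
  is_derive (0 : R) (1 : R)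
    (fun s => action2 (fun t => q1 t + s * y1 t, fun t => q2 t + s * y2 t))
    (itg T (fun t => wderiv T q1 t * w1 t + wderiv T q2 t * w2 t) +
     itg T (fun t => dphi (q1 t) * y1 t + dphi (q2 t) * y2 t
                     - dgam (q2 t - q1 t) * (y2 t - y1 t))).
Proof.
move=> [/= q1i q2i q10 q12] yw1 yw2.
have q1c := weak_continuous (in_H1_wderiv q1i).
have q2c := weak_continuous (in_H1_wderiv q2i).
have y1c := weak_continuous yw1; have w1i : sqint T w1 by case/weakP : yw1.
have y2c := weak_continuous yw2; have w2i : sqint T w2 by case/weakP : yw2.
have p1i := sqint_wderiv q1i; have p2i := sqint_wderiv q2i.
have zc := withinB q2c q1c; have yc := withinB y2c y1c.
pose z t := q2 t - q1 t; pose y t := y2 t - y1 t.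
have z0 t : 0 <= t <= T -> 0 < z t.
  by move=> tT; rewrite subr_gt0; apply: q12; rewrite in_itv.
have [m m0 hm] := within_pos_lbound (ltW T0) zc z0.
have [Kz Kz0 hz] := within_bounded zc.
have [Ky Ky0 hy] := within_bounded yc.
pose e := Num.min 1 (m / (2 * Ky)).
have e0 : 0 < e by rewrite lt_min ltr01 divr_gt0// mulr_gt0.
have zs s t : `|s| < e -> 0 <= t <= T -> m / 2 <= z t + s * y t <= Kz + Ky.
  move=> se tT.
  have h1 : `|s * y t| <= e * Ky.
    by rewrite normrM ler_pM// ?hy// ltW.
  have h2 : e * Ky <= m / 2.
    rewrite -ler_pdivlMr// (le_trans (y := m / (2 * Ky)))//; first by rewrite ge_min lexx orbT.
    by rewrite invfM mulrA.
  have h3 : e * Ky <= Ky.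
    by rewrite -[leRHS]mul1r ler_pM2r// ge_min lexx.
  have := hm t tT; have := hz t tT; rewrite -/(z t).
  have := ler_norm (z t); have := ler_norm (s * y t).
  have := ler_norm (- (s * y t)); rewrite normrN; lra.
have m2 : 0 < m / 2 by rewrite divr_gt0.
have [K K0 hK] := @segment_bounded _ (m / 2) (Kz + Ky) dgam
  (fun s h => dgam_c (lt_le_trans m2 (andP h).1)).
have [B1 B10 hB1] := path_bound q1c y1c.
have [B2 B20 hB2] := path_bound q2c y2c.
have zpos s t : `|s| < e -> 0 <= t <= T -> 0 < z t + s * y t.
  by move=> se /(zs _ _ se)/andP[h _]; exact: lt_le_trans h.
have e1 s : `|s| < e -> `|s| < 1.
  by move=> /lt_le_trans; apply; rewrite ge_min lexx.
have Nc s : `|s| < e -> {within `[0, T], continuous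
   (fun t => phi (q1 t + s * y1 t) + phi (q2 t + s * y2 t) - gam (z t + s * y t))}.
  move=> se; apply: withinB; [apply: withinD|].
  - by apply: (within_comp (h := phi) (within_line (s := s) q1c y1c)) => t _; exact: phi_c.
  - by apply: (within_comp (h := phi) (within_line (s := s) q2c y2c)) => t _; exact: phi_c.
  - by apply: (within_comp (h := gam) (within_line (s := s) zc yc)) => t tT; apply: gam_c; exact: zpos.
have gam_path s t : `|s| < e -> 0 <= t <= T ->
    is_derive s (1 : R) (fun s => gam (z t + s * y t)) (dgam (z t + s * y t) * y t).
  move=> se tT.
  have h1 : is_derive s (1 : R) (fun s => z t + s * y t) (y t).
    by apply: is_derive_eq; rewrite /GRing.scale/=; ring.
  exact: (@is_derive1_comp _ gam (fun s => z t + s * y t) s _ (y t) (gam_d (zpos _ _ se tT)) h1).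
have := @action_derive _ T (wderiv T q1) w1 (wderiv T q2) w2
  (fun s t => phi (q1 t + s * y1 t) + phi (q2 t + s * y2 t) - gam (z t + s * y t))
  (fun s t => dphi (q1 t + s * y1 t) * y1 t + dphi (q2 t + s * y2 t) * y2 t
    - dgam (z t + s * y t) * y t)
  (fun s => action2 (fun t => q1 t + s * y1 t, fun t => q2 t + s * y2 t)) e
  (B1 + B2 + K * Ky) p1i w1i p2i w2i e0 _.
have -> : itg T (fun t => dphi (q1 t) * y1 t + dphi (q2 t) * y2 t
                     - dgam (q2 t - q1 t) * (y2 t - y1 t)) =
  itg T (fun t => dphi (q1 t + 0 * y1 t) * y1 t + dphi (q2 t + 0 * y2 t) * y2 t
    - dgam (z t + 0 * y t) * y t).
  by apply: eq_itg => t _; rewrite !mul0r !addr0.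
apply.
- by rewrite !addr_ge0// mulr_ge0// ltW.
- by move=> s se; apply: intg_continuous; exact: Nc.
- move=> s t se tT.
  have h1 := phi_path q1 y1 t s; have h2 := phi_path q2 y2 t s; have h3 := gam_path _ _ se tT.
  by apply: is_derive_eq.
- move=> s t se tT; rewrite (le_trans (ler_normB _ _))// lerD//; last first.
    by rewrite normrM ler_pM// ?hy//; apply: hK; exact: zs.
  by rewrite (le_trans (ler_normD _ _))// lerD// ?hB1// ?hB2// e1.
- move=> s se; rewrite /action2/=.
  have aeE := (ae_wderiv_shift s q1i yw1, ae_wderiv_shift s q2i yw2).
  rewrite (@eq_itg _ _ _ (fun t => 2^-1 * (wderiv T (fun t => q1 t + s * y1 t) t ^+ 2 +
      wderiv T (fun t => q2 t + s * y2 t) t ^+ 2) +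
      (phi (q1 t + s * y1 t) + phi (q2 t + s * y2 t) - gam (z t + s * y t)))); last first.
    move=> t _; rewrite (_ : q2 t + s * y2 t - _ = z t + s * y t); last by rewrite /z /y; ring.
    by rewrite !addrA.
  apply: itg_ae; last first.
  + apply: (@filterS2 _ _ (ae_filter_ringOfSetsType lebesgue_measure)) aeE.1 aeE.2 => t h1 h2 tT.
    by rewrite h1// h2.
  + have [mw1 _] := w1i; have [mp1 _] := p1i; have [mw2 _] := w2i; have [mp2 _] := p2i.
    apply: measurable_funD; last by apply: measurable_within; exact: Nc.
    apply: measurable_funM => //; apply: measurable_funD => //.
      by apply: measurable_funX; apply: measurable_funD => //; apply: measurable_funM.
    by apply: measurable_funX; apply: measurable_funD => //; apply: measurable_funM.
  + apply: measurable_funD; last by apply: measurable_within; exact: Nc.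
    apply: measurable_funM => //; apply: measurable_funD; apply: measurable_funX.
      have [] // := @sqint_wderiv (fun t => q1 t + s * y1 t).
      by exists (fun t => wderiv T q1 t + s * w1 t); apply: weak_lin => //; exact: in_H1_wderiv.
    have [] // := @sqint_wderiv (fun t => q2 t + s * y2 t).
    by exists (fun t => wderiv T q2 t + s * w2 t); apply: weak_lin => //; exact: in_H1_wderiv.
Qed.

End euler_lagrange.

(** * The minimiser of the regularised Kepler action *)

Section ftc.
Variable R : realType.
Implicit Types (T t s k : R) (f F beta : R -> R).

Lemma itg_FTC_oo T f F : 0 <= T -> {within `[0, T], continuous f} ->
  {within `[0, T], continuous F} ->
  (forall t, 0 < t < T -> is_derive t (1 : R) F (f t)) ->
  itg T f = F T - F 0.
Proof.
rewrite le_eqVlt => /predU1P[<-|T0] fc Fc Fd.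
  by rewrite /itg set_itv1 Rintegral_set1 subrr.
rewrite /itg /Rintegral (@continuous_FTC2 _ f F)//.
- have [] := (continuous_within_itvP _ T0).1 Fc.
  split => // t; rewrite in_itv/= => tT.
  by case: (Fd t).
- move=> t; rewrite in_itv/= => tT; rewrite derive1E.
  by apply: derive_val; apply: Fd.
Qed.

Lemma within_itg T f : 0 <= T -> intg T f ->
  {within `[0, T], continuous (fun t => itg t f)}.
Proof. by move=> T0 fi; have := parameterized_integral_continuous T0 fi. Qed.

Lemma itg_derive T f t : {within `[0, T], continuous f} -> 0 < t < T ->
  is_derive t (1 : R) (fun t => itg t f) (f t).
Proof.
move=> fc /andP[t0 tT].
have ft : {for t, continuous f}.
  have [h _ _] := (continuous_within_itvP f (lt_trans t0 tT)).1 fc.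
  by apply: h; rewrite in_itv/= t0.
have [] := @continuous_FTC1_closed R f 0 t T tT (intg_continuous fc) t0 ft.
by move=> h1 h2; split; [exact: h1|rewrite -derive1E; exact: h2].
Qed.

Lemma withinS t T f : t <= T -> {within `[0, T], continuous f} ->
  {within `[0, t], continuous f}.
Proof.
move=> tT; apply: continuous_subspaceW => s /=.
by rewrite !in_itv/= => /andP[-> /le_trans]; exact.
Qed.

Lemma within_min T t : {within `[0, T], continuous (fun r : R => Num.min r t)}.
Proof.
apply: continuous_subspaceT => r.
by apply: continuous_min; [exact: cvg_id|exact: cvg_cst].
Qed.

(** The kernel min(r, t) is the Green function of - x'' = beta, x(0) = 0 = x'(T).
    Splitting it at r = t exhibits the solution as a differentiable function of t. *)
Lemma green_split T t beta : 0 <= t -> t <= T -> {within `[0, T], continuous beta} ->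
  itg T (fun r => beta r * Num.min r t) =
  itg t (fun r => r * beta r) + t * (itg T beta - itg t beta).
Proof.
move=> t0 tT bc.
have ci : {within `[0, T], continuous (fun r => beta r * Num.min r t)}.
  by apply: withinM => //; exact: within_min.
have := itg_split t0 tT (intg_continuous ci).
have -> : itg t (fun r => beta r * Num.min r t) = itg t (fun r => r * beta r).
  by apply: eq_itg => r /andP[r0 rt]; rewrite (min_idPl rt) mulrC.
have := itg_split t0 tT (intgZ t (intg_continuous bc)).
rewrite !itgZ; [|exact: intg_continuous (withinS tT bc)|exact: intg_continuous].
have -> : \int[lebesgue_measure]_(s in `]t, T]) (beta s * Num.min s t) =
  \int[lebesgue_measure]_(s in `]t, T]) (t * beta s).
  apply: eq_Rintegral => r; rewrite inE/= in_itv/= => /andP[tr _].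
  by rewrite (min_idPr (ltW tr)) mulrC.
lra.
Qed.

End ftc.

Section minimiser.
Variables (R : realType) (T alpha : R) (phi dphi x : R -> R).
Implicit Types (t s r : R) (y w f : R -> R).
Hypotheses (T0 : 0 < T) (alpha0 : 0 < alpha) (alpha2 : alpha < 2).
Hypothesis phiP : attractive alpha phi dphi.
Hypothesis xH : in_H1 T x.
Hypothesis x0 : x 0 = 0.
Hypothesis xmin : forall y, in_H1 T y -> y 0 = 0 ->
  action1 T phi x <= action1 T phi y.

Let phi_d := att_derive phiP.
Let dphi_c := att_continuous phiP.
Let phi_gt0 := att_gt0 phiP.
Let dphi_le0 := att_le0 phiP.
Let dphi_nd := att_nd phiP.
Let phi_tangent := att_tangent phiP.
Let phi_alpha := att_alpha phiP.

Let phi_c : continuous phi.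
Proof. by move=> s; exact: is_derive_continuous (phi_d s). Qed.

Let xc : {within `[0, T], continuous x}.
Proof. exact: weak_continuous (in_H1_wderiv xH). Qed.

Let dphix_c : {within `[0, T], continuous (fun t => dphi (x t))}.
Proof. by apply: (within_comp xc) => t _; exact: dphi_c. Qed.

Let phix_c : {within `[0, T], continuous (fun t => phi (x t))}.
Proof. by apply: (within_comp xc) => t _; exact: phi_c. Qed.

Let dx := wderiv T x.
Let dxi : sqint T dx. Proof. exact: sqint_wderiv. Qed.

Lemma min_euler_lagrange y w : weak_derivative T y w -> y 0 = 0 ->
  itg T (fun t => dx t * w t + dphi (x t) * y t) = 0.
Proof.
move=> yw y0; have Jd := action1_derive phi_d dphi_c xH yw.
apply: (deriv_at_min Jd) => s.
rewrite (_ : (fun t => x t + 0 * y t) = x); last first.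
  by apply/funext => t; rewrite mul0r addr0.
apply: xmin; last by rewrite x0 y0 mulr0 addr0.
by exists (fun t => wderiv T x t + s * w t); apply: weak_lin => //; exact: in_H1_wderiv.
Qed.

Lemma itg_indic r f : 0 <= r -> r <= T -> intg T f ->
  itg T (fun t => f t * \1_(`[0, r]) t) = itg r f.
Proof.
move=> r0 rT fi; rewrite /itg.
have -> : \int[lebesgue_measure]_(t in `[0, T]) (f t * \1_`[0, r] t) =
    \int[lebesgue_measure]_(t in `[0, T] `&` `[0, r]) f t.
  rewrite Rintegral_mkcondr; apply: eq_Rintegral => s _.
  by rewrite patchE indicE; case: ifP; rewrite ?mulr1 ?mulr0.
congr (Rintegral _ _ _).
apply/seteqP; split => s /=; rewrite !in_itv/=; first by case.
by move=> /andP[-> sr]; rewrite sr (le_trans sr).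
Qed.

Let sqint_indic r : 0 <= r -> r <= T -> sqint T (\1_(`[0, r])).
Proof. by move=> r0 rT; have /weakP[] := weak_min r0 rT. Qed.

(** The weak equation tested against min(., t): x is a superposition, with
    nonnegative weights, of the kernels min(r, .), and inherits their sign and
    their monotonicity. *)
Lemma min_green t : 0 <= t -> t <= T ->
  x t = itg T (fun r => - dphi (x r) * Num.min r t).
Proof.
move=> t0 tT.
have := min_euler_lagrange (weak_min t0 tT); rewrite (min_idPl t0) => /(_ erefl).
have /weakP[_ h] := in_H1_wderiv xH.
have mc : {within `[0, T], continuous (fun r : R => Num.min r t)} by exact: within_min.
rewrite itgD.
- rewrite itg_indic//; last exact: sqint_intg.
  rewrite h ?t0// x0 add0r -/dx => e.
  have -> : itg T (fun r => - dphi (x r) * Num.min r t) =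
      - itg T (fun r => dphi (x r) * Num.min r t).
    rewrite -itgN; first by apply: eq_itg => r _; rewrite mulNr.
    by apply: intg_continuous; apply: withinM.
  lra.
- by apply: sqint_mul => //; exact: sqint_indic.
- by apply: intg_continuous; apply: withinM.
Qed.

Let beta_c : {within `[0, T], continuous (fun t => - dphi (x t))}.
Proof.
by apply: within_eq (withinZ (k := -1) dphix_c) => t _; rewrite mulN1r.
Qed.

Lemma min_nondecreasing s t : 0 <= s -> s <= t -> t <= T -> x s <= x t.
Proof.
move=> s0 st tT; rewrite !min_green ?(le_trans s0 st) ?(le_trans st tT)//.
apply: itg_le.
- by apply: intg_continuous; apply: withinM => //; exact: within_min.
- by apply: intg_continuous; apply: withinM => //; exact: within_min.
- move=> r _; apply: ler_wpM2l; first by rewrite oppr_ge0.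
  by rewrite le_min !ge_min lexx st orbT.
Qed.

Lemma min_ge0 t : 0 <= t -> t <= T -> 0 <= x t.
Proof. by move=> t0 tT; rewrite -[leLHS]x0; exact: min_nondecreasing. Qed.

Lemma min_le_end t : 0 <= t -> t <= T -> x t <= x T.
Proof. by move=> t0 tT; exact: min_nondecreasing. Qed.

(** In the formula for x T each weight - dphi (x r) is at least the weight at the
    largest value, x T. *)
Lemma min_end_ge : - dphi (x T) * T ^+ 2 <= 2 * x T.
Proof.
have T0' := T0; have Tle := ltW T0.
suff : - dphi (x T) * (T ^+ 2 / 2) <= x T by lra.
rewrite -itg_id// -itgZ; last first.
  by apply: intg_continuous; apply: continuous_subspaceT => r; exact: cvg_id.
rewrite [leRHS]min_green//; apply: itg_le.
- by apply: intg_continuous; apply: withinZ; apply: continuous_subspaceT => r; exact: cvg_id.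
- by apply: intg_continuous; apply: withinM => //; exact: within_min.
- move=> r /andP[r0 rT]; rewrite (min_idPl rT); apply: ler_wpM2r => //.
  by rewrite lerN2; apply: dphi_nd; [exact: min_ge0|exact: min_le_end].
Qed.

(** The weak equation tested against x itself, and the homogeneity inequality
    for phi. *)
Lemma min_virial : itg T (fun t => dx t ^+ 2) <= alpha * itg T (fun t => phi (x t)).
Proof.
have /(_ x0) := min_euler_lagrange (in_H1_wderiv xH).
have i1 : intg T (fun t => dx t ^+ 2) by case: dxi.
have i2 : intg T (fun t => dphi (x t) * x t).
  by apply: intg_continuous; apply: withinM.
have i3 : intg T (fun t => phi (x t)) by exact: intg_continuous.
rewrite itgD// -itgZ//.
have -> : itg T (fun t => wderiv T x t * wderiv T x t) = itg T (fun t => dx t ^+ 2).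
  by apply: eq_itg => t _; rewrite expr2.
move=> e; have : 0 <= itg T (fun t => dphi (x t) * x t + alpha * phi (x t)).
  by apply: itg_ge0 => t _; rewrite mulrC phi_alpha.
rewrite itgD//; last exact: intgZ.
move: e; set A := itg _ _; set B := itg _ _; set C := itg _ _; lra.
Qed.

(** The energy x'^2 / 2 - phi x is constant and x' vanishes at T; this is the
    integral of that identity. *)
Lemma min_energy : itg T (fun t => dx t ^+ 2) =
  2 * (itg T (fun t => phi (x t)) - T * phi (x T)).
Proof.
have Tle := ltW T0; have T0' := T0.
pose beta t := - dphi (x t).
pose B t := itg T beta - itg t beta.
have bi : intg T beta by exact: intg_continuous.
have Bc : {within `[0, T], continuous B}.
  apply: withinB; last exact: within_itg.
  by move=> t; exact: cvg_cst.
have rbc : {within `[0, T], continuous (fun r => r * beta r)}.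
  apply: withinM => //; apply: continuous_subspaceT => r; exact: cvg_id.
pose H t := itg t (fun r => r * beta r) + t * B t.
have xE t : 0 <= t <= T -> x t = H t.
  by move=> /andP[t0 tT]; rewrite min_green// green_split.
have Bd t : 0 < t < T -> is_derive t (1 : R) B (- beta t).
  move=> tT; have h := itg_derive beta_c tT.
  rewrite -[- beta t]sub0r; apply: (@is_deriveB _ _ _ (cst (itg T beta)) _ _ _ _ _ _ h).
have Hd t : 0 < t < T -> is_derive t (1 : R) H (B t).
  move=> tT; have h := itg_derive rbc tT; have h' := Bd t tT.
  have h2 : is_derive t (1 : R) (fun t => t * B t) (B t - t * beta t).
    by apply: is_derive_eq; rewrite /GRing.scale/=; ring.
  rewrite (_ : B t = t * beta t + (B t - t * beta t)); last by ring.
  exact: is_deriveD.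
have xd t : 0 < t < T -> is_derive t (1 : R) x (B t).
  move=> /[dup] tT /andP[t0 tT']; apply: near_eq_is_derive (Hd t tT).
  near=> s; apply/esym/xE.
  have -> : 0 <= s by apply: ltW; near: s; exact: lt_nbhsr.
  by apply: ltW; near: s; exact: lt_nbhsl.
have dxB : ae0 T dx B.
  apply: ae_wderiv; apply/weakP; split; first exact: sqint_continuous.
  move=> t /andP[t0 tT]; suff -> : itg t B = x t - x 0 by ring.
  apply: itg_FTC_oo => //; [exact: withinS tT _|exact: withinS tT _|].
  by move=> s /andP[s0 st]; apply: xd; rewrite s0 (lt_le_trans st).
have dxB2 : itg T (fun t => dx t ^+ 2) = itg T (fun t => B t ^+ 2).
  apply: itg_ae.
  - by apply: intg_measurable; case: dxi.
  - by apply: intg_measurable; case: (sqint_continuous Bc).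
  - by apply: (@filterS _ _ (ae_filter_ringOfSetsType lebesgue_measure)) dxB => t h tT; rewrite h.
pose E t := B t ^+ 2 / 2 - phi (x t).
have Ed t : 0 < t < T -> is_derive t (1 : R) E 0.
  move=> tT; have h := Bd t tT.
  have h' := @is_derive1_comp _ phi x t _ _ (phi_d _) (xd t tT).
  have h2 : is_derive t (1 : R) (fun t => B t ^+ 2 / 2) (- (beta t * B t)).
    by apply: is_derive_eq; rewrite /GRing.scale/=; field.
  apply: (is_derive_eq (f := fun t => (fun t => B t ^+ 2 / 2) t - (phi \o x) t)).
  by rewrite /beta; ring.
have Ec : {within `[0, T], continuous E}.
  apply: withinB => //; apply: within_eq (withinZ (k := 2^-1) (withinM Bc Bc)) => t _.
  by rewrite mulrC expr2.
have EE t : 0 <= t <= T -> E t = E T.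
  move=> /andP[t0]; rewrite le_eqVlt => /predU1P[->//|tT].
  have Ec' : {within `[t, T], continuous E}.
    apply: continuous_subspaceW Ec => s /=; rewrite !in_itv/= => /andP[ts ->].
    by rewrite (le_trans t0 ts).
  have [|c ctT] := @mean_value_within _ E (fun=> 0) t T tT Ec'.
    by move=> s /andP[ts sT]; apply: Ed; rewrite sT (le_lt_trans t0 ts).
  by rewrite mul0r => /eqP; rewrite subr_eq0 => /eqP.
have BT : B T = 0 by rewrite /B subrr.
have i3 : intg T (fun t => phi (x t)) by exact: intg_continuous.
rewrite dxB2 (@eq_itg _ _ _ (fun t => 2 * (phi (x t) - phi (x T)))).
  have i4 : intg T (fun=> phi (x T)) by exact: intg_cst.
  rewrite itgZ; last exact: intgB.
  by rewrite itgB// itg_cst// (mulrC T).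
move=> t tT; have := EE t tT; rewrite /E BT expr0n mul0r; lra.
Unshelve. all: by end_near. Qed.

(** Eliminate the kinetic term between the virial inequality and the conservation
    of the energy.  The estimate keeps the mountain pass level bounded as the
    regularisation is removed. *)
Lemma min_action_le : (2 - alpha) * action1 T phi x <= (2 + alpha) * (T * phi (x T)).
Proof.
have a0 := alpha0; have a2 := alpha2.
have i1 : intg T (fun t => dx t ^+ 2) by case: dxi.
have i3 : intg T (fun t => phi (x t)) by exact: intg_continuous.
rewrite /action1 itgD//; last exact: intgZ.
rewrite itgZ//; have := min_virial; have := min_energy; rewrite -/dx.
by move=> -> h; nra.
Qed.

Lemma action1_ge0 y : 0 <= action1 T phi y.
Proof.
apply: itg_ge0 => t _; apply: addr_ge0; last exact: ltW.
by rewrite mulr_ge0// sqr_ge0.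
Qed.

End minimiser.

(** * Critical pairs of the regularised action *)

Section critical_pair.
Variables (R : realType) (T alpha : R) (phi dphi gam dgam q1 q2 : R -> R).
Implicit Types (t s r k : R) (y w f : R -> R).
Hypotheses (T0 : 0 < T) (alpha0 : 0 < alpha).
Hypothesis phiP : attractive alpha phi dphi.
Hypothesis gamP : repulsive alpha gam dgam.
Hypothesis qD : calD T (q1, q2).
Hypothesis crit : forall y1 y2, in_H1 T y1 -> in_H1 T y2 -> y1 0 = 0 ->
  is_derive (0 : R) (1 : R)
    (fun s => action2 T phi gam (fun t => q1 t + s * y1 t, fun t => q2 t + s * y2 t)) 0.

Let phi_d := att_derive phiP.
Let dphi_c := att_continuous phiP.
Let phi_gt0 := att_gt0 phiP.
Let dphi_le0 := att_le0 phiP.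
Let phi_tangent := att_tangent phiP.
Let phi_alpha := att_alpha phiP.

Let gam_d := rep_derive gamP.
Let dgam_c := rep_continuous gamP.
Let gam_ge0 := rep_ge0 gamP.
Let dgam_le0 := rep_le0 gamP.
Let gam_ni := rep_ni gamP.
Let gam_alpha := rep_alpha gamP.

Let z t := q2 t - q1 t.
Let q1H : in_H1 T q1. Proof. by case: qD. Qed.
Let q2H : in_H1 T q2. Proof. by case: qD. Qed.
Let q10 : q1 0 = 0. Proof. by case: qD. Qed.
Let z0 t : 0 <= t <= T -> 0 < z t.
Proof. by case: qD => _ _ _ h tT; rewrite subr_gt0; apply: h; rewrite in_itv. Qed.

Let phi_c : continuous phi.
Proof. by move=> s; exact: is_derive_continuous (phi_d s). Qed.

Let q1c : {within `[0, T], continuous q1}.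
Proof. exact: weak_continuous (in_H1_wderiv q1H). Qed.
Let q2c : {within `[0, T], continuous q2}.
Proof. exact: weak_continuous (in_H1_wderiv q2H). Qed.
Let zc : {within `[0, T], continuous z}.
Proof. exact: withinB. Qed.
Let dphi1_c : {within `[0, T], continuous (fun t => dphi (q1 t))}.
Proof. by apply: (within_comp q1c) => t _; exact: dphi_c. Qed.
Let dphi2_c : {within `[0, T], continuous (fun t => dphi (q2 t))}.
Proof. by apply: (within_comp q2c) => t _; exact: dphi_c. Qed.
Let phi1_c : {within `[0, T], continuous (fun t => phi (q1 t))}.
Proof. by apply: (within_comp q1c) => t _; exact: phi_c. Qed.
Let phi2_c : {within `[0, T], continuous (fun t => phi (q2 t))}.
Proof. by apply: (within_comp q2c) => t _; exact: phi_c. Qed.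
Let dgamz_c : {within `[0, T], continuous (fun t => dgam (z t))}.
Proof. by apply: (within_comp zc) => t tT; apply: dgam_c; exact: z0. Qed.
Let gamz_c : {within `[0, T], continuous (fun t => gam (z t))}.
Proof.
by apply: (within_comp zc) => t tT; apply: is_derive_continuous (gam_d (z0 tT)).
Qed.

Let d1 := wderiv T q1.
Let d2 := wderiv T q2.
Let d1i : sqint T d1. Proof. exact: sqint_wderiv. Qed.
Let d2i : sqint T d2. Proof. exact: sqint_wderiv. Qed.
Let d1sq : intg T (fun t => d1 t ^+ 2). Proof. by case: d1i. Qed.
Let d2sq : intg T (fun t => d2 t ^+ 2). Proof. by case: d2i. Qed.

Lemma pair_euler_lagrange y1 y2 w1 w2 :
  weak_derivative T y1 w1 -> weak_derivative T y2 w2 -> y1 0 = 0 ->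
  itg T (fun t => d1 t * w1 t + d2 t * w2 t) +
  itg T (fun t => dphi (q1 t) * y1 t + dphi (q2 t) * y2 t
                  - dgam (z t) * (y2 t - y1 t)) = 0.
Proof.
move=> yw1 yw2 y10.
have [_ <-] := action2_derive T0 phi_d dphi_c gam_d dgam_c qD yw1 yw2.
by have [_ ->] := crit (ex_intro _ _ yw1) (ex_intro _ _ yw2) y10.
Qed.

Lemma pair_euler_lagrange1 y w : weak_derivative T y w -> y 0 = 0 ->
  itg T (fun t => d1 t * w t) + itg T (fun t => (dphi (q1 t) + dgam (z t)) * y t) = 0.
Proof.
move=> yw y0; rewrite -[RHS](pair_euler_lagrange yw (weak_cst T 0) y0).
congr (_ + _); apply: eq_itg => t _; first by rewrite mulr0 addr0.
by rewrite mulr0 sub0r; ring.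
Qed.

Lemma pair_euler_lagrange2 y w : weak_derivative T y w ->
  itg T (fun t => d2 t * w t) + itg T (fun t => (dphi (q2 t) - dgam (z t)) * y t) = 0.
Proof.
move=> yw; rewrite -[RHS](pair_euler_lagrange (weak_cst T 0) yw erefl).
congr (_ + _); apply: eq_itg => t _; first by rewrite mulr0 add0r.
by rewrite mulr0 subr0; ring.
Qed.

(** Both forces on the first component are nonpositive, so that, like the
    minimiser, it is a superposition of the kernels min(r, .) with nonnegative
    weights. *)
Lemma pair_first_ge0 t : 0 <= t <= T -> 0 <= q1 t.
Proof.
move=> /andP[t0 tT].
have := pair_euler_lagrange1 (weak_min t0 tT); rewrite (min_idPl t0) => /(_ erefl).
have /weakP[_ h] := in_H1_wderiv q1H.
rewrite itg_indic//; last exact: sqint_intg.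
have -> : itg t d1 = q1 t by rewrite h ?t0// q10 add0r.
have : 0 <= - itg T (fun r => (dphi (q1 r) + dgam (z r)) * Num.min r t).
  rewrite -itgN; last first.
    by apply: intg_continuous; apply: withinM; [exact: withinD|exact: within_min].
  apply: itg_ge0 => r /[dup] rT /andP[r0 _]; rewrite -mulNr; apply: mulr_ge0.
    have := dphi_le0 (q1 r); have := dgam_le0 (z0 rT); lra.
  by rewrite le_min r0.
by move=> h1 h2; lra.
Qed.

Lemma pair_second_ge0 t : 0 <= t <= T -> 0 <= q2 t.
Proof.
move=> tT; apply: le_trans (pair_first_ge0 tT) _.
by rewrite -subr_ge0; apply: ltW; exact: z0.
Qed.

Lemma action_split : action2 T phi gam (q1, q2) =
  action1 T phi q1 + action1 T phi q2 - itg T (fun t => gam (z t)).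
Proof.
have i1 : intg T (fun t => phi (q1 t)) by exact: intg_continuous.
have i2 : intg T (fun t => phi (q2 t)) by exact: intg_continuous.
have i3 : intg T (fun t => gam (z t)) by exact: intg_continuous.
have j1 : intg T (fun t => 2^-1 * d1 t ^+ 2 + phi (q1 t)) by apply: intgD => //; exact: intgZ.
have j2 : intg T (fun t => 2^-1 * d2 t ^+ 2 + phi (q2 t)) by apply: intgD => //; exact: intgZ.
rewrite /action1 -itgD// -itgB//; last exact: intgD.
by apply: eq_itg => t _; rewrite /= -/d1 -/d2 /z; ring.
Qed.

(** The weak equation tested against the pair itself.  The homogeneity inequalities
    for phi and gam have opposite directions, and so have the signs of phi and gam
    in the action. *)
Lemma pair_virial :
  (1 + alpha / 2) * (itg T (fun t => d1 t ^+ 2) + itg T (fun t => d2 t ^+ 2)) <=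
  alpha * action2 T phi gam (q1, q2).
Proof.
have i1 : intg T (fun t => phi (q1 t)) by exact: intg_continuous.
have i2 : intg T (fun t => phi (q2 t)) by exact: intg_continuous.
have i3 : intg T (fun t => gam (z t)) by exact: intg_continuous.
have := pair_euler_lagrange (in_H1_wderiv q1H) (in_H1_wderiv q2H) q10.
rewrite -/d1 -/d2.
have -> : itg T (fun t => d1 t * d1 t + d2 t * d2 t) =
    itg T (fun t => d1 t ^+ 2) + itg T (fun t => d2 t ^+ 2).
  by rewrite -itgD//; apply: eq_itg => t _; rewrite !expr2.
set b := (fun t => _ - _ : R).
have bi : intg T b.
  apply: intg_continuous; apply: withinB.
    by apply: withinD; apply: withinM.
  by apply: withinM => //; exact: zc.
have ai : intg T (fun t => phi (q1 t) + phi (q2 t) - gam (z t)).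
  by apply: intgB => //; exact: intgD.
have h : 0 <= itg T b + alpha * itg T (fun t => phi (q1 t) + phi (q2 t) - gam (z t)).
  rewrite -itgZ// -itgD//; last exact: intgZ.
  apply: itg_ge0 => t tT; rewrite /b.
  have := phi_alpha (q1 t); have := phi_alpha (q2 t); have := gam_alpha (z0 tT).
  move: (dgam (z t)) (gam (z t)) => dg g; rewrite /z => h1 h2 h3.
  lra.
have e : itg T (fun t => phi (q1 t) + phi (q2 t) - gam (z t)) =
    itg T (fun t => phi (q1 t)) + itg T (fun t => phi (q2 t)) - itg T (fun t => gam (z t)).
  by rewrite itgB// ?itgD//; exact: intgD.
move: h; rewrite e.
set C := itg T b; move: C => C.
rewrite action_split /action1 !itgD//; try exact: intgZ.
rewrite !itgZ// -/d1 -/d2.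
set A := itg T (fun t => d1 t ^+ 2); set B := itg T (fun t => d2 t ^+ 2).
move=> h1 h2; have -> : A + B = - C by lra.
nra.
Qed.

(** Convexity makes q1 almost minimal when the repulsion is weak: the tangent of
    phi at q1 bounds the action of x from below, and by the weak equation the linear
    term is the work of the repulsion along x - q1. *)
Lemma pair_first_action_le x kap H : in_H1 T x -> x 0 = 0 ->
  (forall t, 0 <= t <= T -> 0 <= x t) -> 0 <= kap ->
  (forall t, 0 <= t <= T -> - kap <= dgam (z t)) ->
  (forall t, 0 <= t <= T -> `|x t - q1 t| <= H) ->
  action1 T phi q1 <= action1 T phi x + T * (kap * H).
Proof.
move=> xH x0 xge kap0 hk hH.
have xw := in_H1_wderiv xH; have xc := weak_continuous xw.
set dx := wderiv T x in xw; have dxi : sqint T dx by case/weakP : xw.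
have dxsq : intg T (fun t => dx t ^+ 2) by case: dxi.
pose y t := x t + (-1) * q1 t; pose w t := dx t + (-1) * d1 t.
have yw : weak_derivative T y w by apply: weak_lin => //; exact: in_H1_wderiv.
have wi : sqint T w by case/weakP : yw.
have yc : {within `[0, T], continuous y} by exact: weak_continuous yw.
have y0 : y 0 = 0 by rewrite /y x0 q10 mulr0 addr0.
have EL := pair_euler_lagrange1 yw y0.
have i1 : intg T (fun t => phi (q1 t)) by exact: intg_continuous.
have ix : intg T (fun t => phi (x t)).
  by apply: intg_continuous; apply: (within_comp xc) => t _; exact: phi_c.
have id : intg T (fun t => d1 t * w t) by exact: sqint_mul.
have ib : intg T (fun t => dphi (q1 t) * y t).
  by apply: intg_continuous; exact: withinM.
have ig : intg T (fun t => dgam (z t) * y t).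
  by apply: intg_continuous; exact: withinM.
have e1 : itg T (fun t => (dphi (q1 t) + dgam (z t)) * y t) =
    itg T (fun t => dphi (q1 t) * y t) + itg T (fun t => dgam (z t) * y t).
  by rewrite -itgD//; apply: eq_itg => t _; rewrite mulrDl.
have h1 : itg T (fun t => 2^-1 * d1 t ^+ 2 + phi (q1 t) + (d1 t * w t + dphi (q1 t) * y t))
    <= action1 T phi x.
  apply: itg_le.
  - by apply: intgD; apply: intgD => //; exact: intgZ.
  - by apply: intgD => //; exact: intgZ.
  - move=> t tT; have := phi_tangent (pair_first_ge0 tT) (xge t tT).
    have : 0 <= 2^-1 * (dx t - d1 t) ^+ 2 by rewrite mulr_ge0// sqr_ge0.
    rewrite /w /y -/dx; lra.
rewrite itgD in h1; last first.
- by apply: intgD.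
- by apply: intgD => //; exact: intgZ.
rewrite (itgD id ib) in h1.
have h2 : itg T (fun t => dgam (z t) * y t) <= T * (kap * H).
  have -> : T * (kap * H) = itg T (fun=> kap * H) by rewrite itg_cst ?ltW// mulrC.
  apply: itg_le => //; first exact: intg_cst.
  move=> t tT; have := hk t tT; have := dgam_le0 (z0 tT); have := hH t tT.
  rewrite ler_norml => /andP[a b] c d; rewrite /y mulN1r; nra.
move: h1; rewrite -/(action1 T phi q1); move: EL h2; rewrite e1.
set A := itg _ _; set B := itg _ _; set C := itg _ _; lra.
Qed.

(** Tested against q2 - q2 0, the weak equation bounds the kinetic energy of q2 by
    the work of the forces, which are weak. *)
Lemma pair_second_action_le kap H : 0 <= kap ->
  (forall t, 0 <= t <= T -> - kap <= dgam (z t)) ->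
  (forall t, 0 <= t <= T -> - kap <= dphi (q2 t)) ->
  (forall t, 0 <= t <= T -> phi (q2 t) <= kap) ->
  (forall t, 0 <= t <= T -> `|q2 t - q2 0| <= H) ->
  action1 T phi q2 <= T * (kap * H) + T * kap.
Proof.
move=> kap0 hg hp hk hH; have T0' := T0; have Tle := ltW T0.
pose y t := q2 t + (-1) * (q2 0).
have yw : weak_derivative T y (fun t => d2 t + (-1) * 0).
  by apply: (@weak_lin _ T q2 (fun=> q2 0)); [exact: in_H1_wderiv|exact: weak_cst].
have yc : {within `[0, T], continuous y} by exact: weak_continuous yw.
have := pair_euler_lagrange2 yw.
have -> : itg T (fun t => d2 t * (d2 t + -1 * 0)) = itg T (fun t => d2 t ^+ 2).
  by apply: eq_itg => t _; rewrite mulr0 addr0 expr2.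
have i2 : intg T (fun t => phi (q2 t)) by exact: intg_continuous.
have ib : intg T (fun t => (dphi (q2 t) - dgam (z t)) * y t).
  by apply: intg_continuous; apply: withinM => //; exact: withinB.
have : - itg T (fun t => (dphi (q2 t) - dgam (z t)) * y t) <= T * (kap * H).
  have -> : T * (kap * H) = itg T (fun=> kap * H) by rewrite itg_cst// mulrC.
  rewrite -itgN//; apply: itg_le; [exact: intgN|exact: intg_cst|].
  move=> t tT; have := hg t tT; have := dgam_le0 (z0 tT); have := hH t tT.
  have := hp t tT; have := dphi_le0 (q2 t).
  rewrite ler_norml => a b /andP[c d] e1 e2; rewrite /y mulN1r; nra.
have : itg T (fun t => phi (q2 t)) <= T * kap.
  have -> : T * kap = itg T (fun=> kap) by rewrite itg_cst// mulrC.
  by apply: itg_le => //; exact: intg_cst.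
rewrite /action1 itgD//; last exact: intgZ.
rewrite itgZ// -/d2.
have : 0 <= itg T (fun t => d2 t ^+ 2) by apply: itg_ge0 => t _; exact: sqr_ge0.
set A := itg _ _; set B := itg _ _; set C := itg _ _; lra.
Qed.

Lemma pair_action_ge m : 0 < m -> (forall t, 0 <= t <= T -> m <= z t) ->
  action1 T phi q1 + action1 T phi q2 - T * gam m <= action2 T phi gam (q1, q2).
Proof.
move=> m0 hm; rewrite action_split lerD2l lerN2.
have -> : T * gam m = itg T (fun=> gam m) by rewrite itg_cst ?ltW// mulrC.
apply: itg_le; [exact: intg_continuous|exact: intg_cst|].
by move=> t tT; apply: gam_ni => //; exact: hm.
Qed.

Lemma pair_action_le : action2 T phi gam (q1, q2) <= action1 T phi q1 + action1 T phi q2.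
Proof.
rewrite action_split gerBl; apply: itg_ge0 => t tT; apply: gam_ge0; exact: z0.
Qed.

(** A curve that starts near 0 has a larger action than the constant X, the end
    point of the minimiser: phi lies above its tangent at X, and moving away from
    y 0 costs kinetic energy. *)
Lemma action_start_ge y X : in_H1 T y -> (forall t, 0 <= t <= T -> 0 <= y t) ->
  0 <= X -> dphi X < 0 -> - dphi X * T ^+ 2 <= 2 * X ->
  T * phi X + - dphi X * T * (X / 2 - y 0) <= action1 T phi y.
Proof.
move=> yH yge X0 dX hX; have T0' := T0; have Tle := ltW T0.
have yw := in_H1_wderiv yH; have yc := weak_continuous yw.
set dy := wderiv T y in yw; have dyi : sqint T dy by case/weakP : yw.
have dysq : intg T (fun t => dy t ^+ 2) by case: dyi.
set b := - dphi X; have b0 : 0 < b by rewrite oppr_gt0.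
(* with this c the modulus of y costs N / (2 T) at each time, and in total
   exactly the kinetic part of the action *)
pose c := (b * T)^-1; have c0 : 0 < c by rewrite invr_gt0 mulr_gt0.
set N := itg T (fun t => dy t ^+ 2).
have idi : intg T id.
  by apply: intg_continuous; apply: continuous_subspaceT => r; exact: cvg_id.
have lowi : intg T (fun t => phi X + b * X - b * y 0 - b * c * N / 2 - b / (2 * c) * t).
  by apply: intgB; [exact: intg_cst|exact: intgZ].
have h1 : itg T (fun t => 2^-1 * dy t ^+ 2 +
    (phi X + b * X - b * y 0 - b * c * N / 2 - b / (2 * c) * t)) <= action1 T phi y.
  apply: itg_le.
  - by apply: intgD => //; exact: intgZ.
  - apply: intgD; first exact: intgZ.
    by apply: intg_continuous; apply: (within_comp yc) => t _; exact: phi_c.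
  - move=> t tT; rewrite -/dy lerD2l; apply: le_trans (phi_tangent X0 (yge t tT)).
    move: tT => /andP[t0 tT].
    have := weak_modulus (lexx 0) t0 tT c0 yw; rewrite -/N subr0 => /ler_normlP[_ h].
    have : b * (y t - y 0) <= b * ((c * N + t / c) / 2) by rewrite ler_pM2l.
    rewrite invfM; have -> : dphi X = - b by rewrite opprK.
    lra.
apply: le_trans h1; rewrite itgD//; last exact: intgZ.
rewrite itgZ// -/N itgB//; [|exact: intg_cst|exact: intgZ].
rewrite itgZ// itg_id// itg_cst//.
have -> : b * c * N / 2 = N / (2 * T) by rewrite /c; field; rewrite !gt_eqF.
have -> : b / (2 * c) * (T ^+ 2 / 2) = b * T * (b * T ^+ 2 / 4).
  by rewrite /c; field; rewrite !gt_eqF.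
have -> : 2^-1 * N = N / (2 * T) * T by field; rewrite gt_eqF.
have : b * T * (b * T ^+ 2 / 4) <= b * T * (X / 2).
  have hX' : b * T ^+ 2 <= 2 * X := hX.
  by rewrite ler_pM2l ?mulr_gt0//; lra.
lra.
Qed.

End critical_pair.

(** * Bounds at the mountain pass level *)

Section constants.
Variables (R : realType) (T : R) (T0 : 0 < T).
Implicit Types (k l : R).

Lemma in_H1_cst k : in_H1 T (fun=> k).
Proof. by exists (fun=> 0); exact: weak_cst. Qed.

Lemma action1_cst phi k : continuous phi -> action1 T phi (fun=> k) = T * phi k.
Proof.
move=> phic; rewrite mulrC -(itg_cst (phi k) (ltW T0)); apply: itg_ae.
- apply: measurable_funD; last by apply: intg_measurable; exact: intg_cst.
  apply: measurable_funM => //; apply: measurable_funX.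
  by have [] := sqint_wderiv (in_H1_cst k).
- by apply: intg_measurable; exact: intg_cst.
- apply: (@filterS _ _ (ae_filter_ringOfSetsType lebesgue_measure)) (ae_wderiv (weak_cst T k)) => t h tT.
  by rewrite h// expr0n mulr0 add0r.
Qed.

Lemma H1_norm2_cst k : H1_norm2 T (fun=> k) = k ^+ 2 * T.
Proof.
rewrite -(itg_cst (k ^+ 2) (ltW T0)); apply: itg_ae.
- apply: measurable_funD; first by apply: intg_measurable; exact: intg_cst.
  by apply: measurable_funX; have [] := sqint_wderiv (in_H1_cst k).
- by apply: intg_measurable; exact: intg_cst.
- apply: (@filterS _ _ (ae_filter_ringOfSetsType lebesgue_measure)) (ae_wderiv (weak_cst T k)) => t h tT.
  by rewrite h// expr0n addr0.
Qed.

Lemma straight_path x c C : in_H1 T x -> x 0 = 0 ->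
  (forall t, 0 <= t <= T -> x t < c) -> c < C ->
  Gamma T x c C (fun s => (x, fun=> c + s * (C - c))).
Proof.
move=> xH x0 xc cC; split.
- move=> s; rewrite in_itv/= => /andP[s0 s1]; split => //=; first exact: in_H1_cst.
  move=> t; rewrite in_itv/= => /xc /lt_le_trans; apply.
  by rewrite lerDl mulr_ge0// subr_ge0 ltW.
- move=> s _; rewrite /H1_dist/=.
  have -> : (fun r : R => Num.sqrt (H1_norm2 T (fun t => x t - x t) +
      H1_norm2 T (fun=> c + r * (C - c) - (c + s * (C - c))))) =
      (fun r => Num.sqrt (((r - s) * (C - c)) ^+ 2 * T)).
    apply/funext => r; rewrite (_ : (fun t => x t - x t) = (fun=> 0)); last first.
      by apply/funext => t; rewrite subrr.
    rewrite !H1_norm2_cst expr0n mul0r add0r; congr (Num.sqrt (_ ^+ 2 * _)); ring.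
  apply: cvg_within_filter.
  have e : Num.sqrt (((s - s) * (C - c)) ^+ 2 * T) = 0.
    by rewrite subrr mul0r expr0n mul0r sqrtr0.
  have : (fun r : R => Num.sqrt (((r - s) * (C - c)) ^+ 2 * T)) r @[r --> s] -->
      Num.sqrt (((s - s) * (C - c)) ^+ 2 * T).
    have h : {for s, continuous (fun r : R => ((r - s) * (C - c)) ^+ 2 * T)}.
      apply: cvgMl; apply: (cvg_comp (fun r : R => (r - s) * (C - c)) (fun r => r ^+ 2)); last exact: exprn_continuous.
      by apply: cvgMl; apply: cvgB; [exact: cvg_id|exact: cvg_cst].
    by apply: (continuous_comp h); exact: sqrt_continuous.
  by rewrite e.
- by move=> t _ /=; rewrite mul0r addr0.
- by move=> t _ /=; rewrite mul1r addrC subrK.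
Qed.

End constants.

Section level.
Variables (R : realType) (T alpha mu e1 e2 d0 : R) (f g : R -> R).
Implicit Types (t s r m : R).
Hypotheses (T0 : 0 < T) (alpha0 : 0 < alpha) (alpha2 : alpha < 2).
Hypotheses (fP : singular_potential f) (gP : singular_potential g).
Hypothesis f_alpha : forall s, 0 < s -> 0 <= s * derive1 f s + alpha * f s.
Hypothesis g_alpha : forall s, 0 < s -> s * derive1 g s + alpha * g s <= 0.
Hypotheses (mu0 : 0 < mu) (e10 : 0 < e1) (e20 : 0 < e2).
Let phi := f_reg f e1.
Let dphi := df_reg f e1.

Let phiP : attractive alpha phi dphi.
Proof. exact: f_reg_attractive. Qed.
Let phi_c : continuous phi.
Proof. exact: (f_reg_continuous fP e10). Qed.

Section minimiser_level.
Variables (psi x : R -> R) (c C d1 d2 : R).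
Hypothesis psiP : cutoff e2 psi.
Hypothesis xmin : minimiser f T e1 x.
Let gam := G_reg g psi mu.
Let dgam := dG_reg g psi mu.
Let gamP : repulsive alpha gam dgam.
Proof. exact: (G_reg_repulsive gP alpha2 g_alpha psiP). Qed.

Let xH : in_H1 T x. Proof. by case: xmin. Qed.
Let x0 : x 0 = 0. Proof. by case: xmin. Qed.
Let xm y : in_H1 T y -> y 0 = 0 -> action1 T phi x <= action1 T phi y.
Proof. by case: xmin => _ _; exact. Qed.
Let x_end t : 0 <= t -> t <= T -> x t <= x T.
Proof. exact: (min_le_end phiP xH x0 xm). Qed.

Hypotheses (xc : x T < c) (cC : c < C).
Hypothesis geom : mountain_pass_geometry f g psi T mu e1 x d1 d2 c C.

Let gam0 : Gamma T x c C (fun s => (x, fun=> c + s * (C - c))).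
Proof.
apply: straight_path => // t /andP[t0 tT].
by apply: le_lt_trans xc; exact: x_end.
Qed.

Lemma level_ge : calF f T e1 x + d1 <= mountain_pass_level f g psi T mu e1 x c C.
Proof.
apply: lb_le_inf.
  by exists (max_action f g psi T mu e1 (fun s => (x, fun=> c + s * (C - c))));
    exists (fun s => (x, fun=> c + s * (C - c))).
by move=> _ [y yG <-]; have [_ /ltW] := geom yG.
Qed.

(** The straight path is a competitor along which the repulsion only lowers the
    action, and its constant components stay beyond x T. *)
Lemma level_le : mountain_pass_level f g psi T mu e1 x c C <=
  calF f T e1 x + T * phi (x T).
Proof.
set y := (fun s : R => (x, fun _ : R => c + s * (C - c))).
apply: (@le_trans _ _ (max_action f g psi T mu e1 y)).
  apply: ge_inf; last by exists y.
  by exists (calF f T e1 x + d1) => _ [w wG <-]; have [_ /ltW] := geom wG.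
apply: ge_sup.
  by exists (calA f g psi T mu e1 (y 0)); exists 0 => //=; rewrite in_itv/= lexx ler01.
move=> r [s /=]; rewrite in_itv/= => /[dup] sI /andP[s0 s1] <-.
have yD : calD T (y s) by case: gam0 => h _ _ _; apply: h; rewrite in_itv.
apply: (@le_trans _ _ (action1 T phi x + action1 T phi (fun=> c + s * (C - c)))).
  exact: (pair_action_le phiP gamP yD).
rewrite action1_cst// lerD2l ler_pM2l//; apply: (f_reg_ni fP e10).
apply: (le_trans (ltW xc)); rewrite lerDl mulr_ge0// subr_ge0 ltW//.
Qed.

End minimiser_level.

Section point.
Variables (q1 q2 : R -> R).
Hypothesis qP : mountain_pass_point f g T d0 mu e1 e2 (q1, q2).
Hypotheses (mu1 : mu <= 1) (d00 : 0 < d0).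
Variable c0 : R.
Hypotheses (c00 : 0 < c0) (c01 : c0 <= 1) (fc0 : derive1 f c0 * T ^+ 2 <= - 4).
Hypothesis e1c0 : e1 <= c0.

(** A bound for the mountain pass level when the end point of the minimiser is at
    least c0: min_action_le for the minimiser, and T f c0 for the straight path. *)
Definition action_bound := (2 + alpha) / (2 - alpha) * (T * f c0) + T * f c0.
Let K := action_bound.
Let H := (2 * K + T) / 2.

(** The constants K and H do not depend on mu, on the regularisation or on c and C.
    The level lies between d0 and T phi (x T) above the minimal action, and both
    sides are used.  If q2 starts near 0, then its action alone exceeds the upper
    bound, unless the repulsion compensates (second estimate).  If the gap is large
    everywhere, then q1 is almost minimal, q2 contributes almost nothing, and the
    barrier d0 is almost 0 (third estimate). *)
Lemma mountain_pass_point_bounds :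
  [/\ forall k s t, 0 < k -> 0 <= s -> s <= t -> t <= T ->
        `|q1 t - q1 s| <= (k * (2 * K) + (t - s) / k) / 2 /\
        `|q2 t - q2 s| <= (k * (2 * K) + (t - s) / k) / 2,
      forall m, e2 < m -> (forall t, 0 <= t <= T -> m <= q2 t - q1 t) ->
        q2 0 <= c0 / 4 -> - derive1 f H * (c0 / 4) <= mu * g m,
      forall kap M, e2 < M -> e1 <= M -> 0 < kap ->
        (forall s, M <= s -> f s <= kap) ->
        (forall s, M <= s -> - kap <= derive1 f s) ->
        (forall s, M <= s -> - kap <= derive1 g s) ->
        (forall t, 0 <= t <= T -> M <= q2 t - q1 t) ->
        d0 <= T * (kap * (2 * H + 1))
    & q1 0 = 0 /\ (forall t, 0 <= t <= T -> 0 <= q1 t < q2 t)].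
Proof.
have T0' := T0; have Tle := ltW T0; have a0 := alpha0; have a2 := alpha2.
have virK k : 0 <= k -> alpha * k <= (1 + alpha / 2) * (2 * k) by lra.
have e10' := e10; have c00' := c00; have c01' := c01; have ec := e1c0.
have [psi [x [d1 [d2 [c [C [psiP xmin [d20 d21 d01 xTc cC] geom [crit lev]]]]]]]] := qP.
have gamP := G_reg_repulsive gP alpha2 g_alpha psiP mu0 e20.
set gam := G_reg g psi mu in gamP *; set dgam := dG_reg g psi mu in gamP *.
have [qD crit'] := crit.
have [xH x0 xm] := xmin.
have xm' : forall y, in_H1 T y -> y 0 = 0 -> action1 T phi x <= action1 T phi y by [].
have crit2 : forall y1 y2, in_H1 T y1 -> in_H1 T y2 -> y1 0 = 0 ->
  is_derive (0 : R) (1 : R)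
    (fun s => action2 T phi gam (fun t => q1 t + s * y1 t, fun t => q2 t + s * y2 t)) 0.
  by [].
have [/= q1H q2H q10 q12] := qD.
have lge := level_ge xmin xTc cC geom.
have lle := level_le psiP xmin xTc cC geom.
rewrite -lev in lge lle.
set A := calA _ _ _ _ _ _ _ in lev lge lle.
set a := calF _ _ _ _ in lge lle.
set X := x T in xTc lle.
have Xge0 : 0 <= X by apply: (min_ge0 phiP xH x0 xm').
have XT : - dphi X * T ^+ 2 <= 2 * X := min_end_ge T0 phiP xH x0 xm'.
(* below c0 the slope of f is too steep for the inequality XT *)
have Xc0 : c0 <= X.
  rewrite leNgt; apply/negP => Xc.
  have h : dphi X <= dphi c0 by apply: (att_nd phiP) => //; exact: ltW.
  have e : dphi c0 = derive1 f c0 by exact: df_regr.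
  have : dphi X * T ^+ 2 <= derive1 f c0 * T ^+ 2.
    by rewrite -e; apply: ler_wpM2r => //; rewrite sqr_ge0.
  have := fc0; lra.
have phiX : phi X <= f c0.
  have -> : f c0 = phi c0 by apply/esym; exact: f_regr.
  exact: (f_reg_ni fP e10).
have phiX0 : 0 < phi X by exact: (att_gt0 phiP).
have aE : (2 - alpha) * a <= (2 + alpha) * (T * phi X).
  exact: (min_action_le T0 alpha0 alpha2 phiP xH x0 xm').
have a_ge0 : 0 <= a by exact: (@action1_ge0 _ T _ _ _ phiP x).
have aK : a + T * phi X <= K.
  rewrite /K /action_bound; apply: lerD; last by rewrite ler_pM2l.
  have -> : (2 + alpha) / (2 - alpha) * (T * f c0) = (2 + alpha) * (T * f c0) / (2 - alpha).
    by field; rewrite gt_eqF//; lra.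
  rewrite ler_pdivlMr; last lra.
  rewrite mulrC; apply: le_trans aE _.
  by rewrite ler_pM2l ?ler_pM2l//; lra.
have AK : A <= K by apply: le_trans aK.
have K0 : 0 < K by apply: lt_le_trans aK; rewrite ltr_wpDl// mulr_gt0.
have AE : A = action2 T phi gam (q1, q2) by [].
have aE' : a = action1 T phi x by [].
have XE : X = x T by [].
have HE : H = (2 * K + T) / 2 by [].
have q1min : a <= action1 T phi q1 by exact: xm'.
clearbody A a X.
have d1sq0 : 0 <= itg T (fun t => wderiv T q1 t ^+ 2) by apply: itg_ge0 => t _; exact: sqr_ge0.
have d2sq0 : 0 <= itg T (fun t => wderiv T q2 t ^+ 2) by apply: itg_ge0 => t _; exact: sqr_ge0.
have vir : (1 + alpha / 2) * (itg T (fun t => wderiv T q1 t ^+ 2) + itg T (fun t => wderiv T q2 t ^+ 2)) <= alpha * A.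
  by rewrite AE; exact: (pair_virial T0 phiP gamP qD crit2).
have N2K : itg T (fun t => wderiv T q1 t ^+ 2) + itg T (fun t => wderiv T q2 t ^+ 2) <= 2 * K.
  have h : alpha * A <= alpha * K by rewrite ler_pM2l.
  rewrite -(@ler_pM2l _ (1 + alpha / 2)) ?addr_gt0 ?divr_gt0//.
  by apply: le_trans vir _; apply: le_trans h _; exact/virK/ltW.
have modul : forall k s t, 0 < k -> 0 <= s -> s <= t -> t <= T ->
        `|q1 t - q1 s| <= (k * (2 * K) + (t - s) / k) / 2 /\
        `|q2 t - q2 s| <= (k * (2 * K) + (t - s) / k) / 2.
  move=> k s t k0 s0 st tT.
  have h1 := weak_modulus s0 st tT k0 (in_H1_wderiv q1H).
  have h2 := weak_modulus s0 st tT k0 (in_H1_wderiv q2H).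
  have i1 : k * itg T (fun t => wderiv T q1 t ^+ 2) <= k * (2 * K).
    by rewrite ler_pM2l//; apply: le_trans N2K; rewrite lerDl.
  have i2 : k * itg T (fun t => wderiv T q2 t ^+ 2) <= k * (2 * K).
    by rewrite ler_pM2l//; apply: le_trans N2K; rewrite lerDr.
  by split; [apply: le_trans h1 _|apply: le_trans h2 _];
    rewrite ler_pM2r ?invr_gt0// lerD2r.
have modul0 t : 0 <= t -> t <= T -> `|q1 t - q1 0| <= H /\ `|q2 t - q2 0| <= H.
  move=> t0 tT; have [h1 h2] := modul 1 0 t ltr01 (lexx 0) t0 tT.
  by split; [apply: le_trans h1 _|apply: le_trans h2 _]; 
    rewrite HE mul1r subr0 divr1 ler_pM2r ?invr_gt0// lerD2l.
have q1ge t : 0 <= t <= T -> 0 <= q1 t by exact: (pair_first_ge0 T0 phiP gamP qD crit2).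
have q2ge t : 0 <= t <= T -> 0 <= q2 t by exact: (pair_second_ge0 T0 phiP gamP qD crit2).
have q1le t : 0 <= t <= T -> q1 t <= H.
  move=> /andP[t0 tT]; have [+ _] := modul0 t t0 tT.
  by rewrite q10 subr0; apply: le_trans; exact: ler_norm.
have xle t : 0 <= t <= T -> x t <= H.
  move=> /andP[t0 tT].
  have := weak_modulus (lexx 0) t0 tT ltr01 (in_H1_wderiv xH); rewrite x0 subr0.
  move=> /(le_trans (ler_norm _)); have e : 2^-1 * itg T (fun t => wderiv T x t ^+ 2) <= a.
    rewrite aE' /action1 -itgZ; last by have [] := sqint_wderiv xH.
    apply: itg_le.
    - by apply: intgZ; have [] := sqint_wderiv xH.
    - apply: intgD; first by apply: intgZ; have [] := sqint_wderiv xH.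
      apply: intg_continuous; apply: (within_comp (weak_continuous (in_H1_wderiv xH))) => r _.
      exact: phi_c.
    - by move=> r _; rewrite lerDl; exact/ltW/(att_gt0 phiP).
  have TphiX : 0 < T * phi X by rewrite mulr_gt0.
  by rewrite HE; lra.
have xge t : 0 <= t <= T -> 0 <= x t.
  by move=> /andP[t0 tT]; apply: (min_ge0 phiP xH x0 xm').
split => //.
- move=> m em hm q20.
  have m0 : 0 < m by apply: lt_trans em.
  have h1 := pair_action_ge T0 phiP gamP qD m0 hm.
  have XH : X <= H by rewrite XE; apply: xle; rewrite lexx Tle.
  have H0 : 0 < H by apply: lt_le_trans XH; exact: lt_le_trans Xc0.
  have dX : dphi X = derive1 f X by apply: df_regr => //; exact: (le_trans ec Xc0).
  have X0 : 0 < X by exact: lt_le_trans Xc0.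
  have dX0 : dphi X < 0 by rewrite dX; exact: (pot_d_lt0 fP).
  have h2 := action_start_ge T0 phiP q2H q2ge Xge0 dX0 XT.
  have h3 : derive1 f X <= derive1 f H by apply: (pot_d_nd fP).
  have h4 : gam m = mu * g m by exact: (G_regr _ _ psiP).
  rewrite -h4 -(ler_pM2l T0).
  have h5 : - derive1 f H * (c0 / 4) <= - dphi X * (X / 2 - q2 0).
    have fH : derive1 f H < 0 by exact: (pot_d_lt0 fP).
    apply: ler_pM; rewrite ?oppr_ge0 ?dX ?lerN2 ?divr_ge0 ?(ltW fH) ?(ltW c00)//.
    by lra.
  have h6 : T * (- derive1 f H * (c0 / 4)) <= T * (- dphi X * (X / 2 - q2 0)).
    by rewrite ler_pM2l.
  apply: le_trans h6 _.
  have : A <= a + T * phi X := lle.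
  rewrite AE.
  by move: h1 h2; rewrite /=; lra.
- move=> kap M eM e1M kap0 fk dfk dgk hz.
  have M0 : 0 < M by apply: lt_trans eM.
  have q2M t : 0 <= t <= T -> M <= q2 t.
    by move=> tT; rewrite (le_trans (hz t tT))// gerBl q1ge.
  have zg t : 0 <= t <= T -> - kap <= dgam (q2 t - q1 t).
    move=> tT; rewrite /dgam (dG_regr _ _ psiP); last exact: lt_le_trans (hz t tT).
    have := dgk _ (hz t tT).
    have gz : derive1 g (q2 t - q1 t) <= 0 by apply: (pot_d_le0 gP); exact: lt_le_trans (hz t tT).
    by move/le_trans; apply; rewrite ler_niMl.
  have xq t : 0 <= t <= T -> `|x t - q1 t| <= H.
    move=> tT; rewrite ler_norml; apply/andP; split.
      by rewrite -opprB lerN2 lerBlDr ler_wpDr ?xge ?q1le.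
    by rewrite lerBlDr ler_wpDr ?xle ?q1ge.
  have h1 := pair_first_action_le T0 phiP gamP qD crit2 xH x0 xge (ltW kap0) zg xq.
  have h2 : action1 T phi q2 <= T * (kap * H) + T * kap.
    apply: (pair_second_action_le T0 phiP gamP qD crit2 (ltW kap0) zg).
    - by move=> t tT; rewrite /dphi df_regr//; [exact/dfk/q2M|exact/(le_trans e1M)/q2M].
    - by move=> t tT; rewrite /phi f_regr//; [exact/fk/q2M|exact/(le_trans e1M)/q2M].
    - by move=> t /andP[t0 tT]; have [] := modul0 t t0 tT.
  have h3 := pair_action_le phiP gamP qD.
  have : a + d1 <= A := lge.
  rewrite AE.
  by move: h1 h2 h3; rewrite -aE' /=; lra.
- split => // t tT; rewrite q1ge//=; apply: q12; by rewrite in_itv.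
Qed.

End point.
End level.

(** * Bounds independent of the coupling *)

Lemma uniform_cvg_dist (R : realType) (I : Type) (F : set_system I) (FF : Filter F)
  (D : set R) (u : I -> R -> R) (y : R -> R) :
  {uniform D, u @ F --> y} <->
  (forall e : R, 0 < e -> \forall i \near F, forall t, D t -> `|y t - u i t| < e).
Proof.
split=> [uy e e0|h].
  have := uy [set v | forall t, D t -> ball (y t) e (v t)].
  apply; apply/uniform_nbhs; exists [set xy | ball xy.1 e xy.2]; split => //.
  exact: entourage_ball (PosNum e0).
move=> P /uniform_nbhs[E [entE hE]].
move: entE; rewrite -entourage_ballE => -[e /= e0 he].
have := h e e0; apply: filterS => i hi; apply: hE => t Dt /=.
by apply: he => /=; exact: hi.
Qed.

Section orbit_bounds.
Variables (R : realType) (T alpha d0 : R) (f g : R -> R).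
Implicit Types (t s r m k : R).
Hypotheses (T0 : 0 < T) (alpha0 : 0 < alpha) (alpha2 : alpha < 2).
Hypotheses (fP : singular_potential f) (gP : singular_potential g).
Hypothesis f_alpha : forall s, 0 < s -> 0 <= s * derive1 f s + alpha * f s.
Hypothesis g_alpha : forall s, 0 < s -> s * derive1 g s + alpha * g s <= 0.
Hypothesis d00 : 0 < d0.

(** The minimum over k of the right-hand side is the square root of K (t - s). *)
Definition modulus_bound (K : R) (x : R -> R) := forall k s t,
  0 < k -> 0 <= s -> s <= t -> t <= T -> `|x t - x s| <= (k * K + (t - s) / k) / 2.

Lemma modulus_bound_rev K x : modulus_bound K x -> modulus_bound K (fun t => x (T - t)).
Proof.
move=> h k s t k0 s0 st tT; rewrite distrC.
have -> : t - s = (T - s) - (T - t) by ring.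
by apply: h => //; lra.
Qed.

Lemma modulus_bound_limit K (x : R -> R) (u : nat -> R -> R) :
  {uniform `[0, T], u @ \oo --> x} -> (\forall n \near \oo, modulus_bound K (u n)) ->
  modulus_bound K x.
Proof.
move=> /uniform_cvg_dist ux uK k s t k0 s0 st tT.
apply/ler_addgt0Pr => e e0.
have e2 : 0 < e / 2 by rewrite divr_gt0.
have [n [h1 h2]] := filter_ex (filterI (ux _ e2) uK).
have ts : `[0, T]%classic s by rewrite /= in_itv/= s0 (le_trans st).
have tt : `[0, T]%classic t by rewrite /= in_itv/= tT (le_trans s0).
have := h1 s ts; have := h1 t tt; have := h2 k s t k0 s0 st tT.
rewrite !ler_norml !ltr_norml => /andP[a1 a2] /andP[b1 b2] /andP[c1 c2].
by apply/andP; split; lra.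
Qed.

Definition steep (c0 : R) :=
  [/\ 0 < c0, c0 <= 1 & derive1 f c0 * T ^+ 2 <= - 4].

Lemma steep_exists : exists c0, steep c0.
Proof.
have T0' := T0; have T2 : 0 < T ^+ 2 by rewrite exprn_gt0.
have [s0 s00 hs] := pot_d_unbounded fP (4 / T ^+ 2).
exists (Num.min s0 1).
have c0 : 0 < Num.min s0 1 by rewrite lt_min s00 ltr01.
split => //; first by rewrite ge_min lexx orbT.
have h : derive1 f (Num.min s0 1) <= - (4 / T ^+ 2).
  by apply: le_trans hs; apply: (pot_d_nd fP) => //; rewrite ge_min lexx.
by rewrite -ler_pdivlMr// mulNr.
Qed.

(** The estimates for regularised critical points pass to the limit.  The constant
    M exists because the barrier d0 does not shrink with mu: critical pairs far away
    would violate the third estimate of mountain_pass_point_bounds. *)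
Lemma orbit_bounds : exists K M c0 kap : R,
  [/\ 0 < K, 0 < M, 0 < c0, 0 < kap &
    forall mu q, 0 < mu -> mu <= 1 -> mountain_pass_orbit f g T d0 mu q ->
    [/\ modulus_bound K q.1, modulus_bound K q.2,
      forall t, 0 <= t <= T -> q.2 t <= M,
      (forall m, 0 < m -> (forall t, 0 <= t <= T -> m <= q.2 t - q.1 t) ->
        q.2 T < c0 -> kap <= mu * g m)
    & forall t, 0 <= t <= T -> q.1 t <= q.2 t]].
Proof.
have [c0 [c00 c01 fc0]] := steep_exists; have T0' := T0; have a0 := alpha0; have a2 := alpha2; have d00' := d00.
set K := action_bound T alpha f c0; pose H := (2 * K + T) / 2.
have fc00 : 0 < T * f c0 by rewrite mulr_gt0//; exact: (pot_gt0 fP).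
have K0 : 0 < K.
  by rewrite /K /action_bound addr_gt0// mulr_gt0// divr_gt0//; lra.
have H0 : 0 < H by rewrite /H; lra.
(* T (k0 (2 H + 1)) = d0 / 2 contradicts the third estimate *)
pose k0 := d0 / (2 * T * (2 * H + 1)).
have den0 : 0 < 2 * T * (2 * H + 1) by rewrite !mulr_gt0//; lra.
have k00 : 0 < k0 by rewrite divr_gt0.
have [M1 M10 h1] := pot_small fP k00.
have [M2 M20 h2] := pot_d_small fP k00.
have [M3 M30 h3] := pot_d_small gP k00.
pose M := M1 + M2 + M3.
have hdf : 0 < - derive1 f H * (c0 / 4).
  by rewrite mulr_gt0 ?divr_gt0// oppr_gt0; exact: (pot_d_lt0 fP).
exists (2 * K), (M + 1 + 3 * H + 3), (c0 / 4), (- derive1 f H * (c0 / 4)).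
split => //; [by rewrite mulr_gt0|by rewrite /M; lra|by rewrite divr_gt0|].
move=> mu [q1 q2] mu0 mu1 [_ [[y1 y2] [[e1 [e2 [u [e12 [e1c e2c] up [u1 u2] _]]]] qy]]] /=.
rewrite /= in u1 u2 qy.
have near_small l : 0 < l -> \forall n \near \oo, e1 n <= c0 /\ e1 n <= M /\ e2 n < l.
  move=> l0; have M0 : 0 < M by rewrite /M; lra.
  have s1 : \forall n \near \oo, e1 n < c0 by apply: cvgr_lt e1c _ c00.
  have s2 : \forall n \near \oo, e1 n < M by apply: cvgr_lt e1c _ M0.
  have s3 : \forall n \near \oo, e2 n < l by apply: cvgr_lt e2c _ l0.
  near=> n; have b1 : e1 n < c0 by near: n.
  have b2 : e1 n < M by near: n.
  have b3 : e2 n < l by near: n.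
  by split; [exact: ltW|split => //; exact: ltW].
have up' n : mountain_pass_point f g T d0 mu (e1 n) (e2 n) ((u n).1, (u n).2).
  by rewrite -surjective_pairing; exact: up.
have B n (en : e1 n <= c0) := mountain_pass_point_bounds T0 alpha0 alpha2 fP gP
  f_alpha g_alpha mu0 (e12 n).1 (e12 n).2 (up' n) mu1 c00 c01 fc0 en.
rewrite -/K -/H in B.
have y1m : modulus_bound (2 * K) y1.
  apply: (modulus_bound_limit u1); apply: filterS (near_small 1 ltr01) => n [en _].
  by have [h _ _ _] := B n en => k s t k_0 s0 st tT; have [] := h k s t k_0 s0 st tT.
have y2m : modulus_bound (2 * K) y2.
  apply: (modulus_bound_limit u2); apply: filterS (near_small 1 ltr01) => n [en _].
  by have [h _ _ _] := B n en => k s t k_0 s0 st tT; have [] := h k s t k_0 s0 st tT.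
move/uniform_cvg_dist : u1 => u1; move/uniform_cvg_dist : u2 => u2.
have inT t : 0 <= t <= T -> `[0, T]%classic t by rewrite /= in_itv.
have modH x : modulus_bound (2 * K) x -> forall s t, 0 <= s <= T -> 0 <= t <= T -> `|x t - x s| <= H.
  move=> xm s t /andP[s0 sT] /andP[t0 tT].
  have [st|/ltW ts] := leP s t.
    by apply: le_trans (xm 1 s t ltr01 s0 st tT) _; rewrite /H; lra.
  by rewrite distrC; apply: le_trans (xm 1 t s ltr01 t0 ts sT) _; rewrite /H; lra.
(* q1 and the oscillation of q2 are at most H, so if q2 is this large at some
   time, then the gap is at least M at all times *)
have y2M r : 0 <= r <= T -> y2 r <= M + 1 + 3 * H + 3.
  move=> rT; rewrite leNgt; apply/negP => hr.
  have M0 : 0 < M by rewrite /M; lra.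
  have [n [[[en [eM e2M]] hu1] hu2]] := filter_ex (filterI (filterI (near_small M M0) (u1 1 ltr01)) (u2 1 ltr01)).
  have [hm _ hB [u10 hq]] := B n en.
  have : d0 <= T * (k0 * (2 * H + 1)).
    apply: (hB k0 M) => //.
    - by move=> s Ms; apply: h1; rewrite /M in Ms; lra.
    - by move=> s Ms; apply: h2; rewrite /M in Ms; lra.
    - by move=> s Ms; apply: h3; rewrite /M in Ms; lra.
    - move=> t tT.
      have b1 : (u n).1 t <= H.
        have t0T : 0 <= (0 : R) <= T by rewrite lexx ltW.
        have mm : modulus_bound (2 * K) (u n).1.
          by move=> k s r' k_0 s0 st tT'; have [] := hm k s r' k_0 s0 st tT'.
        have := modH _ mm _ _ t0T tT; rewrite u10 subr0; apply: le_trans; exact: ler_norm.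
      have := hu2 t (inT t tT); have := modH _ y2m r t rT tT.
      rewrite ler_norml ltr_norml => /andP[c1 c2] /andP[c3 c4]; lra.
  have -> : T * (k0 * (2 * H + 1)) = d0 / 2.
    by rewrite /k0; field; rewrite !gt_eqF//; lra.
  lra.
have rT t : 0 <= t <= T -> 0 <= T - t <= T by move=> tT; apply/andP; split; lra.
have qE t : 0 <= t <= T -> q1 t = y1 (T - t) /\ q2 t = y2 (T - t).
  by move=> tT; apply: qy; rewrite in_itv.
split.
- move=> k s t k_0 s0 st tT.
  have [-> _] := qE t (introT andP (conj (le_trans s0 st) tT)).
  have [-> _] := qE s (introT andP (conj s0 (le_trans st tT))).
  exact: modulus_bound_rev y1m k s t k_0 s0 st tT.
- move=> k s t k_0 s0 st tT.
  have [_ ->] := qE t (introT andP (conj (le_trans s0 st) tT)).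
  have [_ ->] := qE s (introT andP (conj s0 (le_trans st tT))).
  exact: modulus_bound_rev y2m k s t k_0 s0 st tT.
- by move=> t tT; have [_ ->] := qE t tT; apply: y2M; exact: rT.
- move=> m m0 hz q2T.
  have y2T : y2 0 < c0 / 4.
    have TT : 0 <= T <= T by rewrite lexx ltW.
    by have [_ e] := qE T TT; rewrite -(subrr T) -e.
  (* the critical pairs have gap at least l for each l < m; then l tends to m *)
  have key l : 0 < l -> l < m -> - derive1 f H * (c0 / 4) <= mu * g l.
    move=> l0 lm; pose e := (m - l) / 2; have e0 : 0 < e by rewrite divr_gt0// subr_gt0.
    have e0' : 0 < c0 / 4 - y2 0 by rewrite subr_gt0.
    have [n [[[[en [_ e2l]] hu1] hu2] hu0]] := filter_ex (filterI (filterI (filterI (near_small l l0) (u1 e e0)) (u2 e e0)) (u2 _ e0')).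
    have [_ hC _ _] := B n en; apply: hC => //.
      move=> t tT; have := hu1 t (inT t tT); have := hu2 t (inT t tT).
      have := hz (T - t) (rT t tT); have [-> ->] := qE (T - t) (rT t tT).
      have -> : T - (T - t) = t by ring.
      rewrite !ltr_norml => c1 /andP[c2 c3] /andP[c4 c5].
      have : e = (m - l) / 2 by []. lra.
    have t0T : 0 <= (0 : R) <= T by rewrite lexx ltW.
    by have := hu0 0 (inT 0 t0T); rewrite ltr_norml => /andP[c1 c2]; lra.
  rewrite leNgt; apply/negP => hlt.
  have gc : {for m, continuous (fun l => mu * g l)}.
    by apply: cvgMr; exact: (pot_continuous gP).
  have [e /= e0 he] := cvgr_lt _ gc _ hlt.
  pose l := Num.max (m / 2) (m - e / 2).
  have l0 : 0 < l by rewrite lt_max divr_gt0.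
  have lm : l < m by rewrite gt_max; apply/andP; split; lra.
  have := key l l0 lm; rewrite leNgt => /negP; apply; apply: he => /=.
  have : m - e / 2 <= l by rewrite le_max lexx orbT.
  move=> hl; rewrite ltr_norml; apply/andP; split; lra.
- move=> t tT; have [-> ->] := qE t tT.
  apply/ler_addgt0Pr => e e0; have e2' : 0 < e / 2 by rewrite divr_gt0.
  have [n [[[en _] hu1] hu2]] := filter_ex (filterI (filterI (near_small 1 ltr01) (u1 _ e2')) (u2 _ e2')).
  have [_ _ _ [_ hq]] := B n en.
  have := hu1 _ (inT _ (rT t tT)); have := hu2 _ (inT _ (rT t tT)).
  have /andP[_] := hq _ (rT t tT).
  rewrite !ltr_norml => c1 /andP[c2 c3] /andP[c4 c5]; lra.
Unshelve. all: by end_near. Qed.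

End orbit_bounds.

(** * Frozen planet orbits, extended through the initial time *)

Section slopes.
Variable R : realType.
Implicit Types (D : set R) (x v F : R -> R) (t d s h T : R).

Lemma derivative_withinP D x t d : derivative_within D x t d <->
  forall e : R, 0 < e -> exists2 r : R, 0 < r &
    forall s, D s -> s != t -> `|s - t| < r -> `|d - (x s - x t) / (s - t)| <= e.
Proof.
split=> [/cvgrPdist_le h e e0|h].
  have [r /= r0 hr] := h e e0.
  by exists r => // s Ds st sr; apply: hr => //; rewrite /ball/= distrC.
apply/cvgrPdist_le => e e0; have [r r0 hr] := h e e0.
by exists r => //= s; rewrite /ball/= distrC => sr st Ds; apply: hr.
Qed.

Lemma is_deriveP F t d : is_derive t (1 : R) F d <->
  forall e : R, 0 < e -> exists2 r : R, 0 < r &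
    forall h, h != 0 -> `|h| < r -> `|d - h^-1 * (F (h + t) - F t)| <= e.
Proof.
split=> [[dF eF] e e0|H].
  have cv : h^-1 *: (F (h *: 1 + t) - F t) @[h --> 0^'] --> d by rewrite -[X in _ --> X]eF.
  move/cvgrPdist_le : cv => /(_ e e0)[r /= r0 hr]; exists r => // h h0 hh.
  by have := hr h; rewrite /ball/= sub0r normrN /GRing.scale/= mulr1; apply.
have cv : h^-1 *: (F (h *: 1 + t) - F t) @[h --> 0^'] --> d.
  apply/cvgrPdist_le => e e0; have [r r0 hr] := H e e0.
  exists r => //= h; rewrite /ball/= sub0r normrN => hh h0.
  by rewrite /GRing.scale/= mulr1; apply: hr.
split; first by apply/cvg_ex; exists d.
exact: cvg_lim cv.
Qed.

Lemma is_derive_within D F t d : is_derive t (1 : R) F d -> derivative_within D F t d.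
Proof.
move=> /is_deriveP h; apply/derivative_withinP => e e0; have [r r0 hr] := h e e0.
exists r => // s _ st sr; have := hr (s - t); rewrite subr_eq0 subrK mulrC; exact.
Qed.

Lemma derivative_within_eq D x y t d (k : R) : 0 < k ->
  (forall s, D s -> `|s - t| < k -> x s = y s) -> D t ->
  derivative_within D x t d -> derivative_within D y t d.
Proof.
move=> k0 xy Dt /derivative_withinP h; apply/derivative_withinP => e e0.
have [r r0 hr] := h e e0; exists (Num.min r k); first by rewrite lt_min r0.
move=> s Ds st; rewrite lt_min => /andP[sr sk].
by rewrite -!xy ?subrr ?normr0//; exact: hr.
Qed.

Definition even_ext x t := x `|t|.
Definition odd_ext v t := if 0 <= t then v t else - v (- t).

(** Even reflection turns one-sided derivatives at 0 into two-sided ones, because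
    the velocity vanishes there. *)
Lemma even_ext_derive D x v T t : (forall s, 0 <= s -> s < T -> D s) ->
  v 0 = 0 -> (forall s, 0 <= s < T -> derivative_within D x s (v s)) ->
  0 <= t < T -> is_derive t (1 : R) (even_ext x) (v t).
Proof.
move=> DT v0 xv /[dup] tT /andP[t0 t1]; apply/is_deriveP => e e0.
have /derivative_withinP/(_ e e0)[r r0 hr] := xv t tT.
have {}t0 : 0 = t \/ 0 < t by apply/predU1P; rewrite -le_eqVlt.
case: t0 => [?|t0].
- subst t; exists (Num.min r T); first by rewrite lt_min r0.
  move=> h h0; rewrite lt_min => /andP[h1 h2].
  have := hr `|h|; rewrite normr_eq0 subr0 normr_id => /(_ _ h0 h1).
  rewrite v0 !sub0r /even_ext normr0 addr0 !normrN => H.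
  by rewrite normrM normfV mulrC -[X in _ / X]normr_id -normfV -normrM; apply: H; exact: DT.
- exists (Num.min r (Num.min t (T - t))); first by rewrite !lt_min r0 t0 subr_gt0.
  move=> h h0; rewrite !lt_min => /and3P[h1 h2 h3].
  have := hr (h + t); rewrite addrK -subr_eq0 addrK => H.
  move: h2 h3; rewrite !ltr_norml => /andP[a1 a2] /andP[a3 a4].
  rewrite /even_ext (ger0_norm (ltW t0)) (@ger0_norm _ (h + t)); last lra.
  by rewrite mulrC; apply: H => //; apply: DT; lra.
Qed.

Lemma odd_ext_derive D v w T t : (forall s, 0 <= s -> s < T -> D s) ->
  v 0 = 0 -> (forall s, 0 <= s < T -> derivative_within D v s (w s)) ->
  0 <= t < T -> is_derive t (1 : R) (odd_ext v) (w t).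
Proof.
move=> DT v0 xv /[dup] tT /andP[t0 t1]; apply/is_deriveP => e e0.
have /derivative_withinP/(_ e e0)[r r0 hr] := xv t tT.
have {}t0 : 0 = t \/ 0 < t by apply/predU1P; rewrite -le_eqVlt.
case: t0 => [?|t0].
- subst t; exists (Num.min r T); first by rewrite lt_min r0.
  move=> h h0; rewrite lt_min => /andP[h1 h2].
  have := hr `|h|; rewrite normr_eq0 subr0 normr_id v0 subr0 => /(_ _ h0 h1) H.
  rewrite addr0 /odd_ext lexx v0 subr0; case: ifPn => hs.
    by have := H _; rewrite ger0_norm// mulrC; apply; apply: DT => //; rewrite -(ger0_norm hs).
  have hn : h < 0 by rewrite ltNge.
  have := H _; rewrite ltr0_norm// invrN mulrN mulrC -mulrN; apply.
  by apply: DT; [lra|rewrite -(ltr0_norm hn)].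
- exists (Num.min r (Num.min t (T - t))); first by rewrite !lt_min r0 t0 subr_gt0.
  move=> h h0; rewrite !lt_min => /and3P[h1 h2 h3].
  have := hr (h + t); rewrite addrK -subr_eq0 addrK => H.
  move: h2 h3; rewrite !ltr_norml => /andP[a1 a2] /andP[a3 a4].
  have b1 : 0 <= h + t by lra.
  rewrite /odd_ext (ltW t0) b1.
  by rewrite mulrC; apply: H => //; apply: DT; lra.
Qed.

Lemma deriv_ge0_le_within (f df : R -> R) (a b : R) : a <= b -> {within `[a, b], continuous f} ->
  (forall s, a < s < b -> is_derive s (1 : R) f (df s)) ->
  (forall s, a < s < b -> 0 <= df s) -> f a <= f b.
Proof.
rewrite le_eqVlt => /predU1P[->//|ab] fc fd df0.
have [c cab e] := mean_value_within ab fc fd.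
by rewrite -subr_ge0 e mulr_ge0 ?df0// subr_ge0 ltW.
Qed.

Lemma within_sub (a b c d : R) (f : R -> R) : a <= c -> d <= b ->
  {within `[a, b], continuous f} -> {within `[c, d], continuous f}.
Proof.
move=> ac db; apply: continuous_subspaceW => s /=.
by rewrite !in_itv/= => /andP[cs sd]; rewrite (le_trans ac)// (le_trans sd).
Qed.

(** At T the velocity v need not be continuous, and the vanishing slope of y is known
    through difference quotients only; by the mean value theorem these are values
    of v near T. *)
Lemma zero_end_velocity (y v a : R -> R) (d T B : R) : 0 <= d -> 0 <= B ->
  {within `[0, T], continuous y} -> derivative_within `[0, T] y T 0 ->
  (forall t, d <= t < T -> is_derive t (1 : R) y (v t)) ->
  (forall t, d <= t < T -> is_derive t (1 : R) v (a t)) ->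
  (forall t, d <= t < T -> `|a t| <= B) ->
  forall t, d <= t < T -> `|v t| <= B * (T - t).
Proof.
move=> d0 B0 yc slope yd vd hB t /andP[dt tT].
have t0 : 0 <= t by apply: le_trans dt.
apply/ler_addgt0Pr => e e0.
have /derivative_withinP/(_ _ e0)[r r0 hr] := slope.
pose s := Num.max t (T - r / 2).
have s1 : t <= s by rewrite le_max lexx.
have s2 : T - r / 2 <= s by rewrite le_max lexx orbT.
have sT : s < T by rewrite gt_max tT/=; lra.
have s0 : 0 <= s by exact: le_trans s1.
have [c /andP[sc cT] ec] : exists2 c, s < c < T & y T - y s = v c * (T - s).
  apply: (mean_value_within sT (within_sub s0 (lexx T) yc)) => h /andP[sh hT].
  by apply: yd; rewrite hT (le_trans dt (le_trans s1 (ltW sh))).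
have := hr s _ _ _; rewrite sub0r normrN.
have -> : (y s - y T) / (s - T) = v c.
  have -> : y s - y T = v c * (s - T) by rewrite -opprB ec; ring.
  by rewrite mulfK// subr_eq0 lt_eqF.
have a1 : `[0, T]%classic s by rewrite /= in_itv/=; apply/andP; split; lra.
have a2 : s != T by rewrite lt_eqF.
have a3 : `|s - T| < r by rewrite ltr0_norm; lra.
move=> /(_ a1 a2 a3) hc.
have tc : t <= c by lra.
have hd h : t <= h <= c -> is_derive h (1 : R) v (a h).
  by move=> /andP[th hc']; apply: vd; rewrite (le_trans dt th) (le_lt_trans hc').
have hb h : t < h < c -> - B <= a h <= B.
  move=> /andP[th hc']; rewrite -ler_norml; apply: hB.
  by rewrite (le_trans dt (ltW th)) (lt_trans hc').
have b1 := deriv_ge_lin tc hd (fun h hI => (andP (hb h hI)).1).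
have b2 := deriv_le_lin tc hd (fun h hI => (andP (hb h hI)).2).
have b3 : B * (c - t) <= B * (T - t) by apply: ler_wpM2l => //; lra.
move: hc; rewrite !ler_norml => /andP[h1 h2]; apply/andP; split; lra.
Qed.

End slopes.

(** The order 0 < q1 < q2 removes the absolute values from the equations, and the
    even extension through t = 0 makes all derivatives on [0, T[ two-sided. *)
Record frozen_orbit (R : realType) (f g : R -> R) (T mu : R) (q1 q2 v1 v2 : R -> R)
    : Prop := {
  fo_pos : forall t, 0 <= t < T -> 0 < q1 t < q2 t;
  fo_q1 : forall t : R, 0 <= t < T -> is_derive t (1 : R) q1 (v1 t);
  fo_q2 : forall t : R, 0 <= t < T -> is_derive t (1 : R) q2 (v2 t);
  fo_v1 : forall t : R, 0 <= t < T -> is_derive t (1 : R) v1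
    (derive1 f (q1 t) + mu * derive1 g (q2 t - q1 t));
  fo_v2 : forall t : R, 0 <= t < T -> is_derive t (1 : R) v2
    (derive1 f (q2 t) - mu * derive1 g (q2 t - q1 t));
  fo_v10 : v1 0 = 0;
  fo_v20 : v2 0 = 0;
  fo_c1 : {within `[0, T], continuous q1};
  fo_c2 : {within `[0, T], continuous q2};
  fo_q1T : q1 T = 0;
  fo_slope : derivative_within `[0, T] q2 T 0 }.

(** The forces on q1 are nonpositive, so q1 is nonincreasing; it vanishes at T, and
    not before. *)
Lemma frozen_orbit_of (R : realType) (f g : R -> R) (T mu : R) (q1 q2 : R -> R) :
  singular_potential f -> singular_potential g -> 0 < T -> 0 < mu ->
  frozen_planet_orbit f g T mu (q1, q2) ->
  (forall t, 0 <= t <= T -> q1 t <= q2 t) ->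
  exists Q1 Q2 V1 V2, (forall t, 0 <= t <= T -> Q1 t = q1 t /\ Q2 t = q2 t) /\
    frozen_orbit f g T mu Q1 Q2 V1 V2.
Proof.
move=> fP gP T0 mu0 [q1c [q2c [v1 [v2 [qn d1 d2 [v10 v20] [q1T q2T]]]]]] q12.
have QE x t : 0 <= t <= T -> even_ext x t = x t by move=> /andP[t0 _]; rewrite /even_ext ger0_norm.
exists (even_ext q1), (even_ext q2), (odd_ext v1), (odd_ext v2).
split; first by move=> t tT; rewrite !QE.
have inT t : 0 <= t < T -> t \in `[0, T[ by move=> tT; rewrite in_itv.
have VE v t : 0 <= t < T -> odd_ext v t = v t by move=> /andP[t0 _]; rewrite /odd_ext t0.
have D1 s : 0 <= s -> s < T -> `[0, T]%classic s by move=> s0 sT; rewrite /= in_itv/= s0 ltW.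
have D2 s : 0 <= s -> s < T -> `[0, T[%classic s by move=> s0 sT; rewrite /= in_itv/= s0.
have Q1d t : 0 <= t < T -> is_derive t (1 : R) (even_ext q1) (odd_ext v1 t).
  move=> tT; rewrite VE//; by apply: (even_ext_derive D1 v10 _ tT) => s /inT /d1[].
have Q2d t : 0 <= t < T -> is_derive t (1 : R) (even_ext q2) (odd_ext v2 t).
  move=> tT; rewrite VE//; by apply: (even_ext_derive D1 v20 _ tT) => s /inT /d2[].
have V1d t : 0 <= t < T -> is_derive t (1 : R) (odd_ext v1) (derive1 f `|q1 t| + mu * derive1 g `|q2 t - q1 t|).
  move=> tT; by apply: (@odd_ext_derive _ _ v1 (fun t => derive1 f `|q1 t| + mu * derive1 g `|q2 t - q1 t|) _ _ D2 v10 _ tT) => s /inT /d1[].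
have V2d t : 0 <= t < T -> is_derive t (1 : R) (odd_ext v2) (derive1 f `|q2 t| - mu * derive1 g `|q2 t - q1 t|).
  move=> tT; by apply: (@odd_ext_derive _ _ v2 (fun t => derive1 f `|q2 t| - mu * derive1 g `|q2 t - q1 t|) _ _ D2 v20 _ tT) => s /inT /d2[].
have Q1c : {within `[0, T], continuous (even_ext q1)}.
  by apply: subspace_eq_continuous q1c => t; rewrite inE/= in_itv/= => tT; apply/esym/QE.
have Q2c : {within `[0, T], continuous (even_ext q2)}.
  by apply: subspace_eq_continuous q2c => t; rewrite inE/= in_itv/= => tT; apply/esym/QE.
have V1le t : 0 <= t < T -> odd_ext v1 t <= 0.
  move=> /andP[t0 tT]; have -> : 0 = odd_ext v1 0 by rewrite /odd_ext lexx.
  apply: (deriv_le0_ge t0) => s /andP[s0 st].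
    by apply: V1d; rewrite s0 (le_lt_trans st).
  have sT : 0 <= s < T by rewrite ltW//= (lt_trans st).
  have [n1 n2 n3] := qn s (inT s sT).
  rewrite -[leRHS]addr0; apply: lerD; first by apply: (pot_d_le0 fP); rewrite normr_gt0.
  apply: mulr_ge0_le0; first exact: ltW.
  by apply: (pot_d_le0 gP); rewrite normr_gt0 subr_eq0.
have q1pos t : 0 <= t < T -> 0 < q1 t.
  move=> /[dup] tT /andP[t0 t1].
  have [n1 n2 n3] := qn t (inT t tT).
  rewrite lt_neqAle eq_sym n1/=.
  have := @deriv_ge0_le_within _ (fun s => - even_ext q1 s) (fun s => - odd_ext v1 s) t T (ltW t1).
  rewrite !QE ?t0 ?lexx ?(ltW T0) ?(ltW t1)// q1T oppr0 oppr_le0; apply.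
  - by apply: (within_sub t0 (lexx T)) => s; apply: cvgN; exact: Q1c.
  - move=> s /andP[s0 sT]; have sT' : 0 <= s < T by rewrite sT (le_trans t0)// ltW.
    by have h := Q1d s sT'; apply: is_derive_eq.
  - by move=> s /andP[s0 sT]; rewrite oppr_ge0; apply: V1le; rewrite sT (le_trans t0)// ltW.
have q12pos t : 0 <= t < T -> q1 t < q2 t.
  move=> /[dup] tT /andP[t0 t1]; have [n1 n2 n3] := qn t (inT t tT).
  by rewrite lt_neqAle eq_sym n3 q12// t0 ltW.
have le t : 0 <= t < T -> 0 <= t <= T by move=> /andP[-> /ltW].
have absE t : 0 <= t < T -> [/\ `|q1 t| = even_ext q1 t, `|q2 t| = even_ext q2 t &
    `|q2 t - q1 t| = even_ext q2 t - even_ext q1 t].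
  move=> tT; have h1 := q1pos t tT; have h2 := q12pos t tT.
  rewrite !QE ?le//; split; rewrite ger0_norm//; lra.
split => //.
- by move=> t tT; rewrite !QE ?le// q1pos// q12pos.
- by move=> t tT; have [<- _ <-] := absE t tT; exact: V1d.
- by move=> t tT; have [_ <- <-] := absE t tT; exact: V2d.
- by rewrite /odd_ext lexx.
- by rewrite /odd_ext lexx.
- by rewrite QE// lexx ltW.
- apply: (derivative_within_eq ltr01 _ _ q2T); last by rewrite /= in_itv/= lexx ltW.
  by move=> s; rewrite /= in_itv/= => sT _; rewrite QE.
Qed.

(** * Estimates for a single orbit *)

Section orbit.
Variables (R : realType) (f g : R -> R) (T mu alpha : R) (q1 q2 v1 v2 : R -> R).
Implicit Types (t s b d e L M B : R).
Hypotheses (T0 : 0 < T) (mu0 : 0 < mu) (alpha0 : 0 < alpha) (alpha2 : alpha < 2).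
Hypotheses (fP : singular_potential f) (gP : singular_potential g).
Hypothesis g_alpha : forall s, 0 < s -> s * derive1 g s + alpha * g s <= 0.
Hypothesis o : frozen_orbit f g T mu q1 q2 v1 v2.
Local Notation f' := (derive1 f).
Local Notation g' := (derive1 g).
Let z t := q2 t - q1 t.
Let w t := v2 t - v1 t.

Let sub a b t : 0 <= a -> b < T -> a <= t <= b -> 0 <= t < T.
Proof. by move=> a0 bT /andP[at' tb]; rewrite (le_trans a0)// (le_lt_trans tb). Qed.
Let subo a b t : 0 <= a -> b <= T -> a < t < b -> 0 <= t < T.
Proof. by move=> a0 bT /andP[at' tb]; rewrite (le_trans a0 (ltW at'))// (lt_le_trans tb). Qed.

Lemma orbit_z_gt0 t : 0 <= t < T -> 0 < z t.
Proof. by move=> /(fo_pos o)/andP[_]; rewrite subr_gt0. Qed.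
Let q1p t : 0 <= t < T -> 0 < q1 t.
Proof. by move=> /(fo_pos o)/andP[]. Qed.
Let q2p t : 0 <= t < T -> 0 < q2 t.
Proof. by move=> /(fo_pos o)/andP[]; exact: lt_trans. Qed.

Lemma orbit_dz t : 0 <= t < T -> is_derive t (1 : R) z (w t).
Proof.
by move=> tT; have h1 := fo_q1 o tT; have h2 := fo_q2 o tT; apply: is_derive_eq.
Qed.

Lemma orbit_dw t : 0 <= t < T ->
  is_derive t (1 : R) w (f' (q2 t) - f' (q1 t) - 2 * (mu * g' (z t))).
Proof.
move=> tT; have h1 := fo_v1 o tT; have h2 := fo_v2 o tT.
by apply: is_derive_eq; rewrite /z; ring.
Qed.

Let w0 : w 0 = 0. Proof. by rewrite /w (fo_v10 o) (fo_v20 o) subrr. Qed.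

Let mug t : 0 <= t < T -> mu * g' (z t) <= 0.
Proof.
by move=> tT; apply: mulr_ge0_le0; [exact: ltW|exact: (pot_d_le0 gP (orbit_z_gt0 tT))].
Qed.

Let df12 t : 0 <= t < T -> 0 <= f' (q2 t) - f' (q1 t).
Proof.
move=> tT; rewrite subr_ge0; apply: (pot_d_nd fP); first exact: q1p.
by move: (fo_pos o tT) => /andP[_ /ltW].
Qed.

(** The gap is convex: f' is nondecreasing and the components repel each other. *)
Lemma orbit_w_ge0 t : 0 <= t < T -> 0 <= w t.
Proof.
move=> /andP[t0 tT]; rewrite -w0.
apply: (deriv_ge0_le t0) => s sI; first exact: orbit_dw (sub (lexx 0) tT sI).
have sT := subo (lexx 0) (ltW tT) sI.
have := df12 sT; have := mug sT; lra.
Qed.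

Lemma orbit_v1_le s t : 0 <= s -> s <= t -> t < T -> v1 t <= v1 s.
Proof.
move=> s0 st tT; apply: (deriv_le0_ge st) => r rI; first exact: (fo_v1 o (sub s0 tT rI)).
have rT := subo s0 (ltW tT) rI.
by have := pot_d_le0 fP (q1p rT); have := mug rT; rewrite -/(z r); lra.
Qed.

Lemma orbit_v1_le0 t : 0 <= t < T -> v1 t <= 0.
Proof. by move=> /andP[t0 tT]; rewrite -(fo_v10 o); exact: orbit_v1_le. Qed.

Lemma orbit_q1_ni s t : 0 <= s -> s <= t -> t <= T -> q1 t <= q1 s.
Proof.
move=> s0 st tT; rewrite -lerN2.
apply: (@deriv_ge0_le_within _ (fun s => - q1 s) (fun s => - v1 s)) => //.
- by apply: (within_sub s0 tT) => r; apply: cvgN; exact: (fo_c1 o).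
- by move=> r rI; have h := fo_q1 o (subo s0 tT rI); apply: is_derive_eq.
- by move=> r rI; rewrite oppr_ge0; exact: orbit_v1_le0 (subo s0 tT rI).
Qed.

Lemma orbit_z_nd s t : 0 <= s -> s <= t -> t <= T -> z s <= z t.
Proof.
move=> s0 st tT.
apply: (@deriv_ge0_le_within _ z w) => //.
- apply: (within_sub s0 tT) => r; apply: cvgB; [exact: (fo_c2 o)|exact: (fo_c1 o)].
- by move=> r rI; exact: orbit_dz (subo s0 tT rI).
- by move=> r rI; exact: orbit_w_ge0 (subo s0 tT rI).
Qed.

Let T00 : 0 <= (0 : R) < T. Proof. by rewrite lexx T0. Qed.

Lemma orbit_z_gt0T t : 0 <= t <= T -> 0 < z t.
Proof.
move=> /andP[t0 tT]; apply: lt_le_trans (orbit_z_nd (lexx 0) t0 tT).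
exact: orbit_z_gt0.
Qed.

Let En t := w t ^+ 2 / 2 + 2 * (mu * g (z t)).
Let E0 := 2 * (mu * g (z 0)).

Let dEn t : 0 <= t < T -> is_derive t (1 : R) En (w t * (f' (q2 t) - f' (q1 t))).
Proof.
move=> tT; have h1 := orbit_dw tT; have h2 := orbit_dz tT.
have h3 := @is_derive1_comp _ g z t _ _ (pot_derive gP (orbit_z_gt0 tT)) h2.
rewrite (_ : En = fun t => w t ^+ 2 / 2 + 2 * (mu * (g \o z) t))//.
by apply: is_derive_eq; rewrite /GRing.scale/=; field.
Qed.

(** The attraction can only increase the energy En of the relative motion, since
    w >= 0 and f' is nondecreasing. *)
Lemma orbit_energy_ge t : 0 <= t < T -> E0 <= En t.
Proof.
move=> /andP[t0 tT].
have -> : E0 = En 0 by rewrite /En w0 expr0n mul0r add0r.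
apply: (deriv_ge0_le t0) => s sI; first exact: dEn (sub (lexx 0) tT sI).
have sT := subo (lexx 0) (ltW tT) sI.
by apply: mulr_ge0; [exact: orbit_w_ge0|exact: df12].
Qed.

(** The Lagrange-Jacobi inequality: (z^2 / 2)'' = w^2 + z w' is at least
    alpha En, by the homogeneity inequality for g and alpha < 2. *)
Lemma orbit_lagrange_jacobi t : 0 <= t <= T -> alpha * E0 * t ^+ 2 <= z t ^+ 2.
Proof.
move=> /andP[t0 tT]; have a0 := alpha0; have a2 := alpha2.
have key s : 0 <= s < T -> alpha * E0 * s <= z s * w s.
  move=> /andP[s0 sT].
  have := @deriv_ge_lin _ (fun s => z s * w s) (fun s => w s ^+ 2 + z s * (f' (q2 s) - f' (q1 s) - 2 * (mu * g' (z s)))) 0 s (alpha * E0) s0.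
  rewrite w0 mulr0 add0r subr0; apply.
  - move=> r rI; have h1 := orbit_dz (sub (lexx 0) sT rI); have h2 := orbit_dw (sub (lexx 0) sT rI).
    by apply: is_derive_eq; rewrite /GRing.scale/=; ring.
  - move=> r rI; have rT := subo (lexx 0) (ltW sT) rI.
    have zr := orbit_z_gt0 rT.
    have h1 : 0 <= z r * (f' (q2 r) - f' (q1 r)) by apply: mulr_ge0; [exact: ltW|exact: df12].
    have h2 : mu * (z r * g' (z r) + alpha * g (z r)) <= 0.
      by apply: mulr_ge0_le0; [exact: ltW|exact: g_alpha].
    have h3 : alpha * E0 <= alpha * En r by rewrite ler_pM2l//; exact: orbit_energy_ge.
    have h4 : 0 <= (2 - alpha) * w r ^+ 2 by apply: mulr_ge0; [lra|exact: sqr_ge0].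
    rewrite /En in h3; lra.
have z00 : 0 <= z 0 ^+ 2 by exact: sqr_ge0.
suff : z 0 ^+ 2 <= z t ^+ 2 - alpha * E0 * t ^+ 2 by lra.
have -> : z 0 ^+ 2 = z 0 ^+ 2 - alpha * E0 * 0 ^+ 2 by rewrite expr0n mulr0 subr0.
apply: (@deriv_ge0_le_within _ (fun t => z t ^+ 2 - alpha * E0 * t ^+ 2)
  (fun t => 2 * (z t * w t) - alpha * E0 * (2 * t))) => //.
- have zc : {within `[0, t], continuous z}.
    by apply: (within_sub (lexx 0) tT) => r; apply: cvgB; [exact: (fo_c2 o)|exact: (fo_c1 o)].
  have c2 : {within `[0, t], continuous (fun r : R => r ^+ 2)}.
    by apply: continuous_subspaceT => s; exact: exprn_continuous.
  move=> r; apply: cvgB; first by apply: (cvg_comp z (fun r => r ^+ 2) (zc r)); exact: exprn_continuous.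
  by apply: cvgMr; exact: c2.
- move=> s sI; have h1 := orbit_dz (subo (lexx 0) tT sI).
  by apply: is_derive_eq; rewrite /GRing.scale/=; ring.
- move=> s sI; have := key s (subo (lexx 0) tT sI); lra.
Qed.

(** q1 falls from q1 0 to 0 within time T, with acceleration at most f' Q < 0. *)
Lemma orbit_q1_start_ge Q : q1 0 <= Q -> - f' Q * (T ^+ 2 / 2) <= q1 0.
Proof.
move=> q1Q; have Tle := ltW T0.
have Q0 : 0 < Q by apply: lt_le_trans q1Q; exact: q1p.
have dv t : 0 <= t < T -> v1 t <= f' Q * t.
  move=> /andP[t0 tT].
  have := @deriv_le_lin _ v1 _ 0 t (f' Q) t0 (fun s sI => fo_v1 o (sub (lexx 0) tT sI)).
  rewrite (fo_v10 o) add0r subr0; apply => s sI; have sT := subo (lexx 0) (ltW tT) sI.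
  have : f' (q1 s) <= f' Q.
    apply: (pot_d_nd fP); first exact: q1p.
    apply: le_trans q1Q; move: sI => /andP[s0 st].
    by apply: orbit_q1_ni => //; apply: ltW => //; exact: (lt_trans st).
  by have := mug sT; rewrite -/(z s); lra.
have := @deriv_ge0_le_within _ (fun s => f' Q / 2 * s ^+ 2 - q1 s) (fun s => f' Q * s - v1 s) 0 T Tle.
rewrite (fo_q1T o) expr0n mulr0 sub0r subr0 => h.
suff : - q1 0 <= f' Q / 2 * T ^+ 2 by lra.
apply: h.
- have c2 : {within `[0, T], continuous (fun r : R => r ^+ 2)}.
    by apply: continuous_subspaceT => s; exact: exprn_continuous.
  move=> r; apply: cvgB; last exact: (fo_c1 o).
  by apply: cvgMr; exact: c2.
- move=> s sI; have h1 := fo_q1 o (subo (lexx 0) (lexx T) sI).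
  by apply: is_derive_eq; rewrite /GRing.scale/=; field.
- by move=> s sI; rewrite subr_ge0; exact: dv (subo (lexx 0) (lexx T) sI).
Qed.

(** q1 is concave and vanishes at T. *)
Lemma orbit_q1_chord t : 0 <= t <= T -> q1 0 * (T - t) <= T * q1 t.
Proof.
have T0' := T0; move=> /andP[]; rewrite le_eqVlt => /predU1P[<- _|t0].
  by rewrite subr0 mulrC.
rewrite le_eqVlt => /predU1P[->|tT]; first by rewrite subrr mulr0 (fo_q1T o) mulr0.
have c1 := within_sub (lexx 0) (ltW tT) (fo_c1 o).
have c2 := within_sub (ltW t0) (lexx T) (fo_c1 o).
have [a /andP[a0 at'] ea] := mean_value_within t0 c1 (fun s sI => fo_q1 o (subo (lexx 0) (ltW tT) sI)).
have [b /andP[tb bT] eb] := mean_value_within tT c2 (fun s sI => fo_q1 o (subo (ltW t0) (lexx T) sI)).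
rewrite (fo_q1T o) subr0 in ea eb.
have vab : v1 b <= v1 a by apply: orbit_v1_le => //; lra.
have : v1 b * ((T - t) * t) <= v1 a * ((T - t) * t).
  by rewrite ler_pM2r// mulr_gt0// subr_gt0.
have -> : v1 b * ((T - t) * t) = - q1 t * t by rewrite mulrA -eb sub0r.
have -> : v1 a * ((T - t) * t) = (q1 t - q1 0) * (T - t) by rewrite ea; ring.
lra.
Qed.

Let q2_slope t : 0 <= t < T -> exists2 c, t < c < T & q2 T - q2 t = v2 c * (T - t).
Proof.
move=> /andP[t0 tT]; have c2 := within_sub t0 (lexx T) (fo_c2 o).
exact: (mean_value_within tT c2 (fun s sI => fo_q2 o (subo t0 (lexx T) sI))).
Qed.

(** Otherwise q2 would be strictly concave, with vanishing velocity at both ends. *)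
Lemma orbit_force_ge M : 0 < M -> (forall t, 0 <= t <= T -> q2 t <= M) ->
  - f' M <= mu * - g' (z 0).
Proof.
move=> M0 q2M; have T0' := T0; rewrite leNgt; apply/negP => hlt.
pose k := - f' M - mu * - g' (z 0); have k0 : 0 < k by rewrite subr_gt0.
have v2k t : 0 <= t < T -> v2 t <= - k * t.
  move=> /andP[t0 tT].
  have := @deriv_le_lin _ v2 _ 0 t (- k) t0 (fun s sI => fo_v2 o (sub (lexx 0) tT sI)).
  rewrite (fo_v20 o) add0r subr0; apply => s sI; have sT := subo (lexx 0) (ltW tT) sI.
  have sT' : 0 <= s <= T by move: sT => /andP[-> /ltW].
  have h1 : f' (q2 s) <= f' M by apply: (pot_d_nd fP); [exact: q2p|exact: q2M].
  have h2 : mu * g' (z 0) <= mu * g' (z s).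
    rewrite ler_pM2l//; apply: (pot_d_nd gP); first exact: orbit_z_gt0.
    by move: sT' => /andP[s0 sT']; exact: orbit_z_nd.
  by rewrite -/(z s) /k; lra.
have /derivative_withinP := fo_slope o.
have e0 : 0 < k * T / 4 by rewrite divr_gt0// mulr_gt0.
move=> /(_ _ e0)[r r0 hr].
pose t := Num.max (T / 2) (T - r / 2).
have t1 : T / 2 <= t by rewrite le_max lexx.
have t2 : T - r / 2 <= t by rewrite le_max lexx orbT.
have tT : t < T by rewrite gt_max; apply/andP; split; lra.
have tI : 0 <= t < T by apply/andP; split; lra.
have [c /andP[tc cT] ec] := q2_slope tI.
have := hr t _ _ _; rewrite sub0r normrN.
have -> : (q2 t - q2 T) / (t - T) = v2 c.
  have -> : q2 t - q2 T = v2 c * (t - T) by rewrite -opprB ec; ring.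
  by rewrite mulfK// subr_eq0 lt_eqF.
have a1 : `[0, T]%classic t by rewrite /= in_itv/=; apply/andP; split; lra.
have a2 : t != T by rewrite lt_eqF.
have a3 : `|t - T| < r by rewrite ltr0_norm; lra.
move=> /(_ a1 a2 a3); rewrite ler_norml => /andP[h1 h2].
have cI : 0 <= c < T by apply/andP; split; lra.
have := v2k c cI.
have : k * (T / 2) <= k * c by rewrite ler_pM2l//; lra.
lra.
Qed.

(** Gronwall's inequality for z^2 + 2 E0: as long as f' is Lipschitz between q1 and
    q2, a small initial gap with a small energy remains small. *)
Lemma orbit_gronwall b L : 0 <= b -> b < T -> 1 <= L ->
  (forall t, 0 <= t <= b -> f' (q2 t) - f' (q1 t) <= L * z t) ->
  z b ^+ 2 <= (z 0 ^+ 2 + 2 * E0) * expR ((1 + L) * b).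
Proof.
move=> b0 bT L1 hL.
have wle t : 0 <= t <= b -> w t ^+ 2 <= 2 * E0 + L * z t ^+ 2.
  move=> /andP[t0 tb]; have tT := le_lt_trans tb bT.
  have : En t - L / 2 * z t ^+ 2 <= E0 - L / 2 * z 0 ^+ 2.
    have -> : E0 - L / 2 * z 0 ^+ 2 = En 0 - L / 2 * z 0 ^+ 2.
      by rewrite /En w0 expr0n mul0r add0r.
    apply: (@deriv_le0_ge _ (fun t => En t - L / 2 * z t ^+ 2)
      (fun t => w t * (f' (q2 t) - f' (q1 t)) - L * (z t * w t)) 0 t t0).
    - move=> s sI; have h1 := dEn (sub (lexx 0) tT sI); have h2 := orbit_dz (sub (lexx 0) tT sI).
      by apply: is_derive_eq; rewrite /GRing.scale/=; field.
    - move=> s sI; have sT := subo (lexx 0) (ltW tT) sI.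
      have : w s * (f' (q2 s) - f' (q1 s)) <= w s * (L * z s).
        apply: ler_wpM2l; first exact: orbit_w_ge0.
        by apply: hL; move: sI => /andP[/ltW -> /ltW st]; rewrite (le_trans st).
      lra.
  have : 0 <= mu * g (z t).
    by apply: mulr_ge0; [exact: ltW|apply/ltW/(pot_gt0 gP)/orbit_z_gt0; rewrite t0].
  have : 0 <= L * z 0 ^+ 2 by apply: mulr_ge0; [lra|exact: sqr_ge0].
  rewrite /En; lra.
pose Y t := z t ^+ 2 + 2 * E0.
have E00 : 0 <= E0.
  by rewrite !mulr_ge0//; [exact: ltW|exact/ltW/(pot_gt0 gP)/orbit_z_gt0].
have : Y b * expR (- ((1 + L) * b)) <= Y 0 * expR (- ((1 + L) * 0)).
  apply: (@deriv_le0_ge _ (fun t => Y t * expR (- ((1 + L) * t)))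
    (fun t => (2 * (z t * w t) - (1 + L) * Y t) * expR (- ((1 + L) * t))) 0 b b0).
  - move=> s sI; have h2 := orbit_dz (sub (lexx 0) bT sI).
    by apply: is_derive_eq; rewrite /GRing.scale/= /Y; ring.
  - move=> s sI; apply: mulr_le0_ge0; last exact: expR_ge0.
    have := wle s; rewrite /Y; move: sI => /andP[/ltW -> /ltW ->] /(_ isT).
    have : 0 <= (z s - w s) ^+ 2 by exact: sqr_ge0.
    have : 0 <= L * E0 by apply: mulr_ge0 => //; lra.
    lra.
rewrite mulr0 oppr0 expR0 mulr1 expRN ler_pdivrMr ?expR_gt0// => h.
by apply: le_trans h; rewrite /Y lerDl; lra.
Qed.

Lemma orbit_v2_le d B : 0 <= d -> 0 <= B ->
  (forall t, d <= t < T -> `|f' (q2 t) - mu * g' (z t)| <= B) ->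
  forall t, d <= t < T -> `|v2 t| <= B * (T - t).
Proof.
move=> d0 B0 hB.
have sub' t : d <= t < T -> 0 <= t < T by move=> /andP[dt ->]; rewrite (le_trans d0).
apply: (zero_end_velocity d0 B0 (fo_c2 o) (fo_slope o) _ _ hB).
  by move=> t tI; exact: (fo_q2 o (sub' t tI)).
by move=> t tI; exact: (fo_v2 o (sub' t tI)).
Qed.

(** The repulsion is internal and cancels in the sum. *)
Lemma orbit_sum_velocity d b : 0 <= d -> d < T -> (forall t, 0 <= t <= d -> b <= q1 t) -> 0 < b ->
  2 * f' b * d <= v1 d + v2 d <= 0.
Proof.
move=> d0 dT hb b0.
have hd x : 0 <= x <= d -> is_derive x (1 : R) (fun t => v1 t + v2 t) (f' (q1 x) + f' (q2 x)).
  move=> xI; have h1 := fo_v1 o (sub (lexx 0) dT xI); have h2 := fo_v2 o (sub (lexx 0) dT xI).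
  by apply: is_derive_eq; ring.
have := deriv_ge_lin d0 hd (k := 2 * f' b); have := deriv_le_lin d0 hd (k := 0).
rewrite (fo_v10 o) (fo_v20 o) !subr0 !addr0 !add0r mul0r => h1 h2; apply/andP; split.
- apply: h2 => x xI; have xT := subo (lexx 0) (ltW dT) xI.
  have bq : b <= q1 x by apply: hb; move: xI => /andP[/ltW -> /ltW].
  have := pot_d_nd fP b0 bq.
  have bq2 : b <= q2 x by move: (fo_pos o xT) => /andP[_ /ltW]; exact: le_trans.
  by have := pot_d_nd fP b0 bq2; lra.
- apply: h1 => x xI; have xT := subo (lexx 0) (ltW dT) xI.
  by have := pot_d_le0 fP (q1p xT); have := pot_d_le0 fP (q2p xT); lra.
Qed.

End orbit.

(** * Comparison of two orbits *)

Section comparison.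
Variables (R : realType) (f g : R -> R) (T mu nu : R).
Variables (q1 q2 v1 v2 r1 r2 u1 u2 : R -> R).
Implicit Types (t s : R).
Hypotheses (T0 : 0 < T) (mu0 : 0 < mu) (nu0 : 0 < nu).
Hypotheses (fP : singular_potential f) (gP : singular_potential g).
Hypothesis oq : frozen_orbit f g T mu q1 q2 v1 v2.
Hypothesis orr : frozen_orbit f g T nu r1 r2 u1 u2.
(* Before d the orbits move by at most rho, after d the coupling is at most e. *)
Variables (d M e S rho B eta : R).
Hypotheses (d0 : 0 < d) (dT : d < T) (e0 : 0 <= e) (S0 : 0 <= S) (rho0 : 0 <= rho) (B0 : 0 <= B) (eta0 : 0 < eta).
Hypotheses (q2M : forall t, 0 <= t <= T -> q2 t <= M)
  (r2M : forall t, 0 <= t <= T -> r2 t <= M).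
Hypotheses (qforce : forall t, d <= t < T -> - e <= mu * derive1 g (q2 t - q1 t))
  (rforce : forall t, d <= t < T -> - e <= nu * derive1 g (r2 t - r1 t)).
Hypotheses (qsum : `|v1 d + v2 d| <= S) (rsum : `|u1 d + u2 d| <= S).
Hypotheses (qz : q2 d - q1 d <= rho) (rz : r2 d - r1 d <= rho).
Hypotheses (qend : forall t, d <= t < T -> `|v2 t| <= B * (T - t))
  (rend : forall t, d <= t < T -> `|u2 t| <= B * (T - t)).
Hypotheses (qmod : forall t, 0 <= t <= d -> `|q1 t - q1 d| <= rho /\ `|q2 t - q2 d| <= rho)
  (rmod : forall t, 0 <= t <= d -> `|r1 t - r1 d| <= rho /\ `|r2 t - r2 d| <= rho).
(* The bracket bounds the product P1 below from below, and y1^2 is at most 2 T times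
   the bracket; the factor 128 makes y1 at most eta / 8. *)
Hypothesis small : 128 * T * (2 * T * (M * e) + 2 * M * S + 2 * rho * (B * T)) <= eta ^+ 2.
Hypothesis rhoeta : 8 * rho <= eta.
Local Notation f' := (derive1 f).
Local Notation g' := (derive1 g).

Let y1 t := q1 t - r1 t.
Let y2 t := q2 t - r2 t.
Let a1 t := v1 t - u1 t.
Let a2 t := v2 t - u2 t.

Let dI t : d <= t < T -> 0 <= t < T.
Proof. by move=> /andP[dt ->]; rewrite (le_trans (ltW d0) dt). Qed.
Let incl t : 0 <= t < T -> 0 <= t <= T.
Proof. by move=> /andP[-> /ltW]. Qed.

Let M0 : 0 <= M.
Proof.
have T00 : 0 <= (0 : R) < T by rewrite lexx T0.
have := fo_pos oq T00 => /andP[h1 h2].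
by apply/ltW/(lt_trans h1)/(lt_le_trans h2)/q2M/incl.
Qed.

Let y_le t : 0 <= t < T -> `|y1 t| <= M /\ `|y2 t| <= M.
Proof.
move=> tT; have := fo_pos oq tT => /andP[h1 h2]; have := fo_pos orr tT => /andP[h3 h4].
have := q2M (incl tT); have := r2M (incl tT) => h5 h6.
by rewrite /y1 /y2 !ler_norml; split; apply/andP; split; lra.
Qed.

Let mono a b : 0 < a -> 0 < b -> 0 <= (a - b) * (f' a - f' b).
Proof.
move=> a0 b0; have [ab|/ltW ba] := leP a b.
  by apply: mulr_le0; rewrite subr_le0//; exact: (pot_d_nd fP).
by apply: mulr_ge0; rewrite subr_ge0//; exact: (pot_d_nd fP).
Qed.

Let P1 t := y1 t * a1 t.
Let P2 t := y2 t * a2 t.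

Let d_y t : 0 <= t < T -> is_derive t (1 : R) y1 (a1 t) /\ is_derive t (1 : R) y2 (a2 t).
Proof.
move=> tT; have h1 := fo_q1 oq tT; have h2 := fo_q2 oq tT.
have h3 := fo_q1 orr tT; have h4 := fo_q2 orr tT.
by split; apply: is_derive_eq.
Qed.

Let forces t := mu * g' (q2 t - q1 t) - nu * g' (r2 t - r1 t).

Let forces_le t : d <= t < T -> `|forces t| <= e.
Proof.
move=> tT; have h1 := qforce tT; have h2 := rforce tT.
have h3 : mu * g' (q2 t - q1 t) <= 0.
  apply: mulr_ge0_le0; first exact: ltW.
  by apply: (pot_d_le0 gP); move: (fo_pos oq (dI tT)) => /andP[_]; rewrite subr_gt0.
have h4 : nu * g' (r2 t - r1 t) <= 0.
  apply: mulr_ge0_le0; first exact: ltW.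
  by apply: (pot_d_le0 gP); move: (fo_pos orr (dI tT)) => /andP[_]; rewrite subr_gt0.
by rewrite /forces ler_norml; apply/andP; split; lra.
Qed.

Let d_P1 t : 0 <= t < T -> is_derive t (1 : R) P1
  (a1 t ^+ 2 + (y1 t * (f' (q1 t) - f' (r1 t)) + y1 t * forces t)).
Proof.
move=> tT; have [h1 _] := d_y tT; have h2 := fo_v1 oq tT; have h3 := fo_v1 orr tT.
have h4 : is_derive t (1 : R) a1 ((f' (q1 t) - f' (r1 t)) + forces t).
  by apply: is_derive_eq; rewrite /forces; ring.
by apply: is_derive_eq; rewrite /GRing.scale/=; ring.
Qed.

Let d_P2 t : 0 <= t < T -> is_derive t (1 : R) P2
  (a2 t ^+ 2 + (y2 t * (f' (q2 t) - f' (r2 t)) - y2 t * forces t)).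
Proof.
move=> tT; have [_ h1] := d_y tT; have h2 := fo_v2 oq tT; have h3 := fo_v2 orr tT.
have h4 : is_derive t (1 : R) a2 ((f' (q2 t) - f' (r2 t)) - forces t).
  by apply: is_derive_eq; rewrite /forces; ring.
by apply: is_derive_eq; rewrite /GRing.scale/=; ring.
Qed.

(** Up to the coupling, the derivatives of P1 and P2 are sums of nonnegative terms,
    since f' is nondecreasing. *)
Let P_growth s t : d <= s -> s <= t -> t < T ->
  P1 s - M * e * (t - s) <= P1 t /\ P2 s - M * e * (t - s) <= P2 t.
Proof.
move=> ds st tT.
have sub x : s <= x <= t -> d <= x < T.
  by move=> /andP[sx xt]; rewrite (le_trans ds sx) (le_lt_trans xt tT).
have low x : d <= x < T ->
    - (M * e) <= a1 x ^+ 2 + (y1 x * (f' (q1 x) - f' (r1 x)) + y1 x * forces x) /\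
    - (M * e) <= a2 x ^+ 2 + (y2 x * (f' (q2 x) - f' (r2 x)) - y2 x * forces x).
  move=> xT; have x0T := dI xT; have [b1 b2] := y_le x0T; have b3 := forces_le xT.
  have := fo_pos oq x0T => /andP[h1 h2]; have := fo_pos orr x0T => /andP[h3 h4].
  have m1 := mono h1 h3; have m2 := mono (lt_trans h1 h2) (lt_trans h3 h4).
  have c1 : `|y1 x * forces x| <= M * e by rewrite normrM ler_pM.
  have c2 : `|y2 x * forces x| <= M * e by rewrite normrM ler_pM.
  have s1 : 0 <= a1 x ^+ 2 by exact: sqr_ge0.
  have s2 : 0 <= a2 x ^+ 2 by exact: sqr_ge0.
  move: c1 c2; rewrite !ler_norml => /andP[c1 c1'] /andP[c2 c2'].
  by rewrite -/(y1 x) in m1; rewrite -/(y2 x) in m2; split; lra.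
have g1 := @deriv_ge_lin _ P1 _ s t (- (M * e)) st (fun x xI => d_P1 (dI (sub x xI)))
  (fun x xI => (low x (sub x (introT andP (conj (ltW (andP xI).1) (ltW (andP xI).2))))).1).
have g2 := @deriv_ge_lin _ P2 _ s t (- (M * e)) st (fun x xI => d_P2 (dI (sub x xI)))
  (fun x xI => (low x (sub x (introT andP (conj (ltW (andP xI).1) (ltW (andP xI).2))))).2).
by split; lra.
Qed.

(** P2 tends to 0 at T, where both second velocities vanish, and it is almost
    nondecreasing. *)
Let P2_le t : d <= t < T -> P2 t <= M * e * T.
Proof.
move=> /[dup] tI /andP[dt tT]; have T0' := T0; have d0' := d0; have M0' := M0; have B0' := B0.
have Me : 0 <= M * e by apply: mulr_ge0.
have lim s : t <= s -> s < T -> P2 t <= M * (2 * B) * (T - s) + M * e * T.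
  move=> ts sT; have sI : d <= s < T by rewrite (le_trans dt ts).
  have [_ h1] := P_growth dt ts sT.
  have [_ h2] := y_le (dI sI).
  have h3 : `|a2 s| <= 2 * B * (T - s).
    by rewrite /a2 (le_trans (ler_normB _ _))//; have := qend sI; have := rend sI; lra.
  have h4 : P2 s <= M * (2 * B * (T - s)).
    by apply: le_trans (ler_norm _) _; rewrite normrM ler_pM.
  have h5 : M * e * (s - t) <= M * e * T by apply: ler_wpM2l => //; lra.
  lra.
apply/ler_addgt0Pr => k k0.
pose K := M * (2 * B) + 1; have K0 : 0 < K.
  by rewrite /K ltr_wpDl// mulr_ge0// mulr_ge0.
pose s := Num.max t (T - k / K).
have s1 : t <= s by rewrite le_max lexx.
have s2 : T - k / K <= s by rewrite le_max lexx orbT.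
have kK : 0 < k / K by rewrite divr_gt0.
have sT : s < T by rewrite gt_max tT/=; lra.
have h := lim s s1 sT.
have h1 : M * (2 * B) * (T - s) <= K * (k / K).
  apply: ler_pM; [by rewrite mulr_ge0// mulr_ge0|lra|by rewrite /K lerDl|lra].
have : K * (k / K) = k by rewrite mulrC divfK// gt_eqF.
lra.
Qed.

Let bnd := 2 * T * (M * e) + 2 * M * S + 2 * rho * (B * T).

(** At d the differences y1 and y2 nearly agree, because both gaps are small; hence
    P1 d + P2 d is nearly y1 d times the small difference of the total velocities,
    while P2 d is bounded above by P2_le. *)
Let P1_ge t : d <= t < T -> - bnd <= P1 t.
Proof.
move=> /andP[dt tT]; have T0' := T0; have d0' := d0; have M0' := M0; have B0' := B0.
have dT' := dT; have rho0' := rho0; have S0' := S0.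
have dd : d <= d < T by rewrite lexx dT.
have Me : 0 <= M * e by apply: mulr_ge0.
have [h1 _] := P_growth (lexx d) dt tT.
have h2 := P2_le dd.
have [b1 _] := y_le (dI dd).
have e1 : P1 d + P2 d = y1 d * (a1 d + a2 d) + (y2 d - y1 d) * a2 d by rewrite /P1 /P2; ring.
have c1 : `|y1 d * (a1 d + a2 d)| <= M * (2 * S).
  rewrite normrM ler_pM//.
  have -> : a1 d + a2 d = (v1 d + v2 d) - (u1 d + u2 d) by rewrite /a1 /a2; ring.
  by rewrite (le_trans (ler_normB _ _))//; have := qsum; have := rsum; lra.
have c2 : `|(y2 d - y1 d) * a2 d| <= rho * (2 * (B * T)).
  rewrite normrM ler_pM//.
    move: (fo_pos oq (dI dd)) => /andP[_ z1]; move: (fo_pos orr (dI dd)) => /andP[_ z2].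
    have := qz; have := rz; rewrite /y1 /y2 => z3 z4.
    by rewrite ler_norml; apply/andP; split; lra.
  have := qend dd; have := rend dd => z1 z2.
  have z3 : B * (T - d) <= B * T by apply: ler_wpM2l => //; lra.
  by rewrite /a2 (le_trans (ler_normB _ _))//; lra.
have h3 : M * e * (t - d) <= M * e * T by apply: ler_wpM2l => //; lra.
move: c1 c2; rewrite !ler_norml => /andP[c1 _] /andP[c2 _].
rewrite /bnd; lra.
Qed.

Let bnd0 : 0 <= bnd.
Proof.
by rewrite /bnd !addr_ge0//; rewrite !mulr_ge0//; exact: ltW.
Qed.

Let cont_y : {within `[0, T], continuous y1} /\ {within `[0, T], continuous y2}.
Proof.
split=> t; apply: cvgB.
- exact: (fo_c1 oq).
- exact: (fo_c1 orr).
- exact: (fo_c2 oq).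
- exact: (fo_c2 orr).
Qed.

Let sq_lin_cont (y : R -> R) k a b : 0 <= a -> b <= T -> {within `[0, T], continuous y} ->
  {within `[a, b], continuous (fun t => y t ^+ 2 + k * t)}.
Proof.
move=> a0 bT yc; have yc' := within_sub a0 bT yc.
have c2 : {within `[a, b], continuous (id : R -> R)} by apply: continuous_subspaceT => s; exact: cvg_id.
move=> r; apply: cvgD; first by apply: (cvg_comp y (fun r => r ^+ 2) (yc' r)); exact: exprn_continuous.
by apply: cvgMr; exact: c2.
Qed.

(** y1 vanishes at T, and (y1^2)' = 2 P1. *)
Let y1_sq t : d <= t <= T -> y1 t ^+ 2 <= 2 * T * bnd.
Proof.
move=> /andP[dt tT]; have d0' := d0; have bnd0' := bnd0.
have t0 : 0 <= t by apply: le_trans dt; exact: ltW.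
have := @deriv_ge0_le_within _ (fun t => y1 t ^+ 2 + 2 * bnd * t) (fun t => 2 * (P1 t) + 2 * bnd) t T tT.
have -> : y1 T = 0 by rewrite /y1 (fo_q1T oq) (fo_q1T orr) subrr.
rewrite expr0n add0r => h.
have : y1 t ^+ 2 + 2 * bnd * t <= 2 * bnd * T.
  apply: h.
  - by apply: sq_lin_cont => //; exact: cont_y.1.
  - move=> s /andP[ts sT]; have [h1 _] : is_derive s (1 : R) y1 (a1 s) /\ is_derive s (1 : R) y2 (a2 s).
      by apply: d_y; rewrite sT (le_trans t0 (ltW ts)).
    by apply: is_derive_eq; rewrite /GRing.scale/= /P1; ring.
  - move=> s /andP[ts sT]; have := @P1_ge s; rewrite sT (le_trans dt (ltW ts)) => /(_ isT).
    lra.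
have : 0 <= bnd * t by apply: mulr_ge0.
lra.
Qed.

Let y2_sq t : d <= t <= T -> y2 t ^+ 2 <= y2 d ^+ 2 + T * bnd.
Proof.
move=> /andP[dt tT]; have d0' := d0; have M0' := M0; have rho0' := rho0; have S0' := S0; have B0' := B0; have T0' := T0.
have Me : 0 <= M * e by apply: mulr_ge0.
have := @deriv_ge0_le_within _ (fun t => - (y2 t ^+ 2 + (- (2 * (M * e * T))) * t)) (fun t => - (2 * (P2 t) - 2 * (M * e * T))) d t dt.
move=> h; have : - (y2 d ^+ 2 + - (2 * (M * e * T)) * d) <= - (y2 t ^+ 2 + - (2 * (M * e * T)) * t).
  apply: h.
  - have h := @sq_lin_cont y2 (- (2 * (M * e * T))) d t (ltW d0) tT cont_y.2.
    by move=> s; apply: cvgN; exact: h.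
  - move=> s /andP[ds st]; have [_ h1] : is_derive s (1 : R) y1 (a1 s) /\ is_derive s (1 : R) y2 (a2 s).
      by apply: d_y; rewrite (lt_le_trans st tT) (le_trans (ltW d0) (ltW ds)).
    by apply: is_derive_eq; rewrite /GRing.scale/= /P2; ring.
  - move=> s /andP[ds st]; have := @P2_le s; rewrite (lt_le_trans st tT) (ltW ds) => /(_ isT).
    lra.
have h1 : M * e * T * (t - d) <= M * e * T * T.
  by apply: ler_wpM2l; [apply: mulr_ge0 => //; exact: ltW|lra].
have h2 : 0 <= T * (2 * M * S + 2 * rho * (B * T)).
  apply: mulr_ge0; first exact: ltW.
  by apply: addr_ge0; rewrite !mulr_ge0//; exact: ltW.
rewrite /bnd; lra.
Qed.

Let sq_le (x k : R) : 0 <= k -> x ^+ 2 <= k ^+ 2 -> `|x| <= k.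
Proof.
move=> k0 h; rewrite -(@ler_pXn2r _ 2) ?nnegrE//.
by rewrite real_normK ?num_real.
Qed.

Lemma orbit_comparison t : 0 <= t <= T -> `|q1 t - r1 t| <= eta /\ `|q2 t - r2 t| <= eta.
Proof.
have eta0' := eta0; have re := rhoeta; have T0' := T0; have bnd0' := bnd0; have rho0' := rho0.
have sm : 128 * (T * bnd) <= eta ^+ 2 by have := small; rewrite -/bnd; lra.
have Tb : 0 <= T * bnd by apply: mulr_ge0 => //; exact: ltW.
have far s : d <= s <= T -> `|y1 s| <= eta / 8 /\ `|y2 s| <= eta / 2.
  move=> sI; have n1 r : d <= r <= T -> `|y1 r| <= eta / 8.
    move=> rI; apply: sq_le; first by rewrite divr_ge0// ltW.
    by apply: le_trans (y1_sq rI) _; rewrite expr_div_n; lra.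
  split; first exact: n1.
  have dd : d <= d <= T by rewrite lexx ltW.
  have n2 : `|y2 d| <= eta / 4.
    have h1 := n1 d dd.
    have dd' : 0 <= d < T by rewrite (ltW d0).
    move: (fo_pos oq dd') => /andP[_ z1]; move: (fo_pos orr dd') => /andP[_ z2].
    have := qz; have := rz; move: h1; rewrite /y1 /y2 !ler_norml => /andP[h1 h2] z3 z4.
    by apply/andP; split; lra.
  apply: sq_le; first by rewrite divr_ge0// ltW.
  apply: le_trans (y2_sq sI) _.
  have : y2 d ^+ 2 <= (eta / 4) ^+ 2.
    by rewrite -[y2 d ^+ 2]real_normK ?num_real// ler_pXn2r ?nnegrE// divr_ge0// ltW.
  rewrite !expr_div_n; lra.
move=> /andP[t0 tT]; have [dt|/ltW td] := leP d t.
  have [] := far t; first by rewrite dt.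
  rewrite -/(y1 t) -/(y2 t) => h1 h2.
  by split; [apply: le_trans h1 _|apply: le_trans h2 _]; lra.
have [] := far d; first by rewrite lexx ltW.
have td' : 0 <= t <= d by rewrite t0.
have [m1 m2] := qmod td'; have [m3 m4] := rmod td'.
rewrite /y1 /y2; move: m1 m2 m3 m4; rewrite !ler_norml.
move=> /andP[a b] /andP[a' b'] /andP[c c'] /andP[k k'] /andP[l l'] /andP[m m'].
by split; apply/andP; split; lra.
Qed.

End comparison.

(** * Estimates uniform in the coupling *)

Section uniform.
Variables (R : realType) (f g : R -> R) (T alpha K M c0 kap : R).
Implicit Types (t s mu e d : R) (q v : R -> R).
Hypotheses (T0 : 0 < T) (alpha0 : 0 < alpha) (alpha2 : alpha < 2).
Hypotheses (fP : singular_potential f) (gP : singular_potential g).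
Hypothesis g_alpha : forall s, 0 < s -> s * derive1 g s + alpha * g s <= 0.
Hypotheses (K0 : 0 < K) (M0 : 0 < M) (c00 : 0 < c0) (kap0 : 0 < kap).
Local Notation f' := (derive1 f).
Local Notation g' := (derive1 g).

(** The last condition is what remains of the mountain pass level: a small q2 T has
    to be compensated by the repulsion. *)
Definition bounded_orbit mu q1 q2 v1 v2 := [/\ 0 < mu,
  frozen_orbit f g T mu q1 q2 v1 v2,
  modulus_bound T K q1 /\ modulus_bound T K q2,
  forall t, 0 <= t <= T -> q2 t <= M
  & forall m, 0 < m -> (forall t, 0 <= t <= T -> m <= q2 t - q1 t) ->
      q2 T < c0 -> kap <= mu * g m].

Let start : 0 <= (0 : R) < T. Proof. by rewrite lexx T0. Qed.

(* Keeps a large numeral folded. *)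
Let big_numeral (k : nat) : (0 < k)%N ->
  exists2 n : R, 0 < n & forall x, n * x = k%:R * x.
Proof. by move=> k0; exists k%:R; [rewrite ltr0n|]. Qed.

(** By orbit_force_ge the initial repulsion is bounded away from 0, so the initial
    gap has to close as mu tends to 0. *)
Lemma gap_small e : 0 < e -> exists2 mu0, 0 < mu0 &
  forall mu q1 q2 v1 v2, mu < mu0 -> bounded_orbit mu q1 q2 v1 v2 -> q2 0 - q1 0 < e.
Proof.
move=> e0; have fM := pot_d_lt0 fP M0; have ge := pot_d_lt0 gP e0.
exists (- f' M / - g' e); first by rewrite divr_gt0// oppr_gt0.
move=> mu q1 q2 v1 v2; rewrite ltr_pdivlMr ?oppr_gt0// => hmu [mu0 o _ q2M _].
rewrite ltNge; apply/negP => ez.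
have h := orbit_force_ge T0 mu0 fP gP o M0 q2M.
have : mu * - g' (q2 0 - q1 0) <= mu * - g' e.
  by rewrite ler_pM2l// lerN2; apply: (pot_d_nd gP).
by move=> h2; move: (le_lt_trans (le_trans h h2) hmu); rewrite ltxx.
Qed.

Let Q := (K + T) / 2.
Let m1 := - f' Q * (T / 2).

Let Q0 : 0 < Q. Proof. by rewrite divr_gt0// addr_gt0. Qed.

Let m10 : 0 < m1.
Proof. by rewrite mulr_gt0 ?divr_gt0// oppr_gt0; exact: (pot_d_lt0 fP). Qed.

(** Q bounds q1 by the modulus of continuity, so the acceleration of q1 is at most
    f' Q; hence q1 0 is bounded below, and q1 is concave. *)
Lemma first_ge mu q1 q2 v1 v2 : bounded_orbit mu q1 q2 v1 v2 ->
  forall t, 0 <= t <= T -> m1 * (T - t) <= q1 t.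
Proof.
move=> [mu0 o [h1 h2] _ _] t tT; have Tle := ltW T0; have T0' := T0.
have q1Q : q1 0 <= Q.
  have := h1 1 0 T ltr01 (lexx 0) Tle (lexx T).
  rewrite (fo_q1T o) sub0r normrN subr0 divr1 mul1r => h.
  exact: le_trans (ler_norm _) h.
have a1 := orbit_q1_start_ge T0 mu0 fP gP o q1Q.
have a2 := orbit_q1_chord T0 mu0 fP gP o tT.
have a3 : - f' Q * (T ^+ 2 / 2) * (T - t) <= q1 0 * (T - t).
  by apply: ler_wpM2r => //; move: tT => /andP[_]; rewrite subr_ge0.
rewrite -(ler_pM2l T0); rewrite /m1; lra.
Qed.

Lemma modulus_small e : 0 < e -> exists2 d, 0 < d & forall x, modulus_bound T K x ->
  forall s t, 0 <= s <= T -> 0 <= t <= T -> `|t - s| <= d -> `|x t - x s| <= e.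
Proof.
move=> e0; have K0' := K0; pose k := e / K; have k0 : 0 < k by rewrite divr_gt0.
exists (k * e); first by rewrite mulr_gt0.
have half s t : t - s <= k * e -> (k * K + (t - s) / k) / 2 <= e.
  move=> h; have -> : k * K = e by rewrite divfK// gt_eqF.
  have : (t - s) / k <= e by rewrite ler_pdivrMr// mulrC.
  lra.
move=> x xm s t /andP[s0 sT] /andP[t0 tT]; have [st|/ltW ts] := leP s t.
  rewrite ger0_norm ?subr_ge0// => h.
  exact: le_trans (xm k s t k0 s0 st tT) (half _ _ h).
rewrite ler0_norm ?subr_le0// opprB => h; rewrite distrC.
exact: le_trans (xm k t s k0 t0 ts sT) (half _ _ h).
Qed.

(** The initial energy of the relative motion does not degenerate: if it
    did, then by Gronwall's inequality the gap would be small until a short time d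
    before T, and q2 T would be small; but a small q2 T bounds the coupling from
    below. *)
Lemma coupling_ge : exists c mu0, [/\ 0 < c, 0 < mu0 &
  forall mu q1 q2 v1 v2, mu < mu0 -> bounded_orbit mu q1 q2 v1 v2 ->
    c <= mu * g (q2 0 - q1 0)].
Proof.
have T0' := T0; have c00' := c00; have Tle := ltW T0.
have e0 : 0 < c0 / 8 by rewrite divr_gt0.
have [d1 d10 hd1] := modulus_small e0.
pose d := Num.min d1 (T / 2).
have d0 : 0 < d by rewrite lt_min d10 divr_gt0.
have dT : d <= T / 2 by rewrite ge_min lexx orbT.
have dd1 : d <= d1 by rewrite ge_min lexx.
pose m := m1 * d; have m0 : 0 < m by rewrite mulr_gt0.
have mM : m <= Num.max m M by rewrite le_max lexx.
have [L L0 hL] := pot_d_lipschitz fP m0 mM.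
pose G := expR ((1 + (L + 1)) * T); have G0 : 0 < G by exact: expR_gt0.
(* 512 c G <= c0^2 gives 8 c G <= (c0 / 8)^2 *)
have [n n0 nE] := @big_numeral 512%N isT.
have nG : 0 < n * G by exact: mulr_gt0.
pose c := Num.min (kap / 2) (c0 ^+ 2 / (n * G)).
have c_gt0 : 0 < c.
  by rewrite lt_min; apply/andP; split; apply: divr_gt0 => //; exact: exprn_gt0.
have ck : c <= kap / 2 by rewrite ge_min lexx.
have cG : c * (n * G) <= c0 ^+ 2.
  by rewrite -ler_pdivlMr// ge_min lexx orbT.
have zeta0 : 0 < Num.min 1 (4 * c) by rewrite lt_min ltr01 mulr_gt0.
have [mu0 mu00 hmu0] := gap_small zeta0.
exists c, mu0; split => // mu q1 q2 v1 v2 hmu bo.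
have gap := hmu0 mu q1 q2 v1 v2 hmu bo.
have q1ge := first_ge bo.
have [mu_gt0 o [md1 md2] q2M hk] := bo.
rewrite leNgt; apply/negP => hlt.
set z0 := q2 0 - q1 0 in gap hlt.
have z00 : 0 < z0 by exact: (orbit_z_gt0 o start).
pose b := T - d; have b0 : 0 <= b by rewrite /b; lra.
have bT : b < T by rewrite /b; lra.
have L1 : 1 <= L + 1 by lra.
have lip t : 0 <= t <= b -> f' (q2 t) - f' (q1 t) <= (L + 1) * (q2 t - q1 t).
  move=> /andP[t0 tb]; have tT : 0 <= t < T by rewrite t0 (le_lt_trans tb).
  have tT' : 0 <= t <= T by rewrite t0 ltW// (le_lt_trans tb).
  have := fo_pos o tT => /andP[p1 p2].
  have mq : m <= q1 t.
    apply: le_trans (q1ge t tT'); rewrite /m; apply: ler_wpM2l; first exact: ltW.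
    by rewrite /b in tb; lra.
  have := hL _ _ mq (ltW p2); rewrite le_max (q2M t tT') orbT => /(_ isT).
  have z_ge : 0 <= q2 t - q1 t by lra.
  lra.
have gr := orbit_gronwall T0 mu_gt0 fP gP o b0 bT L1 lip.
rewrite -/z0 in gr.
have Gb : expR ((1 + (L + 1)) * b) <= G.
  by rewrite /G ler_expR ler_wpM2l//; [lra|rewrite /b; lra].
have zb : (q2 b - q1 b) ^+ 2 <= (c0 / 8) ^+ 2.
  apply: le_trans gr _.
  have zz : z0 ^+ 2 <= 4 * c.
    move: gap; rewrite lt_min => /andP[z1 z2].
    have : z0 * z0 <= z0 * 1 by apply: ler_wpM2l; lra.
    rewrite expr2; lra.
  have h8 : z0 ^+ 2 + 2 * (2 * (mu * g z0)) <= 8 * c by lra.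
  have e00 : 0 <= expR ((1 + (L + 1)) * b) by exact: expR_ge0.
  apply: (@le_trans _ _ (8 * c * G)).
    apply: ler_pM => //; apply: addr_ge0; first exact: sqr_ge0.
    by do ! (apply: mulr_ge0 => //); [exact: ltW|exact/ltW/(pot_gt0 gP)].
  move: cG; rewrite nE expr_div_n; lra.
have bI : 0 <= b <= T by rewrite b0 ltW.
have zb' : q2 b - q1 b <= c0 / 8.
  by rewrite -(@ler_pXn2r _ 2) ?nnegrE ?(ltW e0)//; exact/ltW/(orbit_z_gt0T T0 mu_gt0 fP gP o).
have TI : 0 <= T <= T by rewrite lexx Tle.
have TbE : `|T - b| <= d1.
  have -> : T - b = d by rewrite /b; ring.
  by rewrite ger0_norm// ltW.
have s1 := hd1 _ md1 _ _ bI TI TbE; have s2 := hd1 _ md2 _ _ bI TI TbE.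
have q2T : q2 T < c0.
  move: s1 s2; rewrite (fo_q1T o) !ler_norml => /andP[x1 x2] /andP[x3 x4]; lra.
have := hk z0 z00; have zge t : 0 <= t <= T -> z0 <= q2 t - q1 t.
  by move=> /andP[t0 tT]; exact: (orbit_z_nd mu_gt0 fP gP o (lexx 0) t0 tT).
move=> /(_ zge q2T); have := kap0; lra.
Qed.

(** The gap is bounded below by the Lagrange-Jacobi inequality; q2 is bounded below
    by q1 on the first half of the interval and by the gap on the second half. *)
Lemma uniform_bounds : exists sig m mu0, [/\ 0 < sig, 0 < m, 0 < mu0 &
  forall mu q1 q2 v1 v2, mu < mu0 -> bounded_orbit mu q1 q2 v1 v2 ->
    (forall t, 0 <= t <= T -> sig * t ^+ 2 <= (q2 t - q1 t) ^+ 2) /\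
    (forall t, 0 <= t <= T -> m <= q2 t)].
Proof.
have [c [mu0 [cp mu00 hc]]] := coupling_ge.
have T0' := T0; have m10' := m10.
pose sig := alpha * (2 * c); have sig0 : 0 < sig by rewrite !mulr_gt0.
(* r <= 1, so that r <= z^2 implies r^2 <= z^2, hence r <= z *)
pose r := Num.min 1 (sig * (T / 2) ^+ 2).
have r0 : 0 < r by rewrite lt_min ltr01 mulr_gt0// exprn_gt0// divr_gt0.
pose m := Num.min (m1 * (T / 2)) r.
have m0 : 0 < m by rewrite lt_min r0 mulr_gt0// divr_gt0.
exists sig, m, mu0; split => // mu q1 q2 v1 v2 hmu bo.
have hcc := hc mu q1 q2 v1 v2 hmu bo; have q1ge := first_ge bo.
have [mu_gt0 o _ q2M _] := bo.
have zz t : 0 <= t <= T -> sig * t ^+ 2 <= (q2 t - q1 t) ^+ 2.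
  move=> tT; apply: le_trans (orbit_lagrange_jacobi mu_gt0 alpha0 alpha2 fP gP g_alpha o tT).
  rewrite /sig; apply: ler_wpM2r; first exact: sqr_ge0.
  by rewrite ler_pM2l// ler_pM2l.
split => // t tT; have [t1|t2] := leP t (T / 2).
  have h1 := q1ge t tT; have h2 := orbit_z_gt0T T0 mu_gt0 fP gP o tT.
  have h3 : m <= m1 * (T / 2) by rewrite ge_min lexx.
  have h4 : m1 * (T / 2) <= m1 * (T - t) by rewrite ler_pM2l//; lra.
  lra.
have h1 : m <= r by rewrite ge_min lexx orbT.
have q10 : 0 <= q1 t.
  apply: le_trans (q1ge t tT); apply: mulr_ge0; first exact: ltW.
  by move: tT => /andP[_]; rewrite subr_ge0.
have h2 : r <= q2 t - q1 t.
  rewrite -(@ler_pXn2r _ 2) ?nnegrE ?(ltW r0)//; last exact/ltW/(orbit_z_gt0T T0 mu_gt0 fP gP o).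
  apply: le_trans (zz t tT).
  have h3 : r <= sig * (T / 2) ^+ 2 by rewrite ge_min lexx orbT.
  have h4 : r * r <= 1 * r by apply: ler_wpM2r; [exact: ltW|rewrite ge_min lexx].
  have h5 : sig * (T / 2) ^+ 2 <= sig * t ^+ 2.
    rewrite ler_pM2l// ler_pXn2r// ?nnegrE; lra.
  rewrite expr2; lra.
lra.
Qed.

(** After the time d the gap is bounded away from 0, and so g' is bounded there. *)
Lemma force_small d e : 0 < d -> 0 < e -> exists2 mu0, 0 < mu0 &
  forall mu q1 q2 v1 v2, mu < mu0 -> bounded_orbit mu q1 q2 v1 v2 ->
    forall t, d <= t < T -> - e <= mu * g' (q2 t - q1 t).
Proof.
move=> d0 e0; have [sig [m [mu0 [sig0 m0 mu00 hu]]]] := uniform_bounds.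
pose r := Num.min 1 (sig * d ^+ 2).
have r0 : 0 < r by rewrite lt_min ltr01 mulr_gt0// exprn_gt0.
have gr := pot_d_lt0 gP r0.
exists (Num.min mu0 (e / - g' r)); first by rewrite lt_min mu00 divr_gt0// oppr_gt0.
move=> mu q1 q2 v1 v2; rewrite lt_min => /andP[hmu]; rewrite ltr_pdivlMr ?oppr_gt0// => hmu2 bo.
have [zz _] := hu mu q1 q2 v1 v2 hmu bo; have [mu_gt0 o _ _ _] := bo.
move=> t /andP[dt tT]; have t0 : 0 <= t by apply: le_trans dt; exact: ltW.
have tI : 0 <= t <= T by rewrite t0 ltW.
have rz : r <= q2 t - q1 t.
  rewrite -(@ler_pXn2r _ 2) ?nnegrE ?(ltW r0)//; last exact/ltW/(orbit_z_gt0T T0 mu_gt0 fP gP o).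
  apply: le_trans (zz t tI).
  have h3 : r <= sig * d ^+ 2 by rewrite ge_min lexx orbT.
  have h4 : r * r <= 1 * r by apply: ler_wpM2r; [exact: ltW|rewrite ge_min lexx].
  have h5 : sig * d ^+ 2 <= sig * t ^+ 2.
    by rewrite ler_pM2l// ler_pXn2r// ?nnegrE// ltW.
  rewrite expr2; lra.
have : mu * g' r <= mu * g' (q2 t - q1 t) by rewrite ler_pM2l//; exact: (pot_d_nd gP).
lra.
Qed.

Lemma end_velocity e : 0 < e -> exists2 B, 0 < B & forall d, 0 < d -> exists2 mu0, 0 < mu0 &
  forall mu q1 q2 v1 v2, mu < mu0 -> bounded_orbit mu q1 q2 v1 v2 ->
    forall t, d <= t < T -> `|v2 t| <= B * (T - t).
Proof.
move=> e0; have [sig [m [mu0 [sig0 m0 mu00 hu]]]] := uniform_bounds.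
have fm := pot_d_lt0 fP m0.
have B0 : 0 < - f' m + e by lra.
exists (- f' m + e) => // d d0; have [mu2 mu20 hf] := force_small d0 e0.
exists (Num.min mu0 mu2); first by rewrite lt_min mu00.
move=> mu q1 q2 v1 v2; rewrite lt_min => /andP[hmu hmu2] bo.
have [_ q2m] := hu mu q1 q2 v1 v2 hmu bo; have hff := hf mu q1 q2 v1 v2 hmu2 bo.
have [mu_gt0 o _ _ _] := bo.
apply: (orbit_v2_le o (ltW d0) (ltW B0)) => t /[dup] tI /andP[dt tT].
have t0 : 0 <= t by apply: le_trans dt; exact: ltW.
have tI' : 0 <= t <= T by rewrite t0 ltW.
have h1 := q2m t tI'; have h2 := pot_d_nd fP m0 h1.
have h3 := pot_d_le0 fP (lt_le_trans m0 h1).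
have h4 := hff t tI.
have h5 : mu * g' (q2 t - q1 t) <= 0.
  apply: mulr_ge0_le0; first exact: ltW.
  by apply: (pot_d_le0 gP); exact: (orbit_z_gt0T T0 mu_gt0 fP gP o).
by rewrite ler_norml; apply/andP; split; lra.
Qed.

(** The constants of orbit_comparison are chosen in the order rho, d, e. *)
Lemma orbits_cauchy eta : 0 < eta -> exists2 mu0, 0 < mu0 &
  forall mu nu q1 q2 v1 v2 r1 r2 u1 u2, mu < mu0 -> nu < mu0 ->
    bounded_orbit mu q1 q2 v1 v2 -> bounded_orbit nu r1 r2 u1 u2 ->
    forall t, 0 <= t <= T -> `|q1 t - r1 t| <= eta /\ `|q2 t - r2 t| <= eta.
Proof.
move=> eta0; have T0' := T0; have M0' := M0; have m10' := m10.
have [B B0 hB] := end_velocity ltr01.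
have e20 : 0 < eta ^+ 2 by rewrite exprn_gt0.
(* 768 = 3 * 256 makes each of the three terms of the smallness condition at most
   eta^2 / 3 *)
have [n n0 nE] := @big_numeral 768%N isT.
have T20 : 0 < T ^+ 2 by rewrite exprn_gt0.
have den1 : 0 < n * (B * T ^+ 2) by do ! (apply: mulr_gt0 => //).
pose rho := Num.min (eta / 8) (eta ^+ 2 / (n * (B * T ^+ 2))).
have rho0 : 0 < rho by rewrite lt_min; apply/andP; split; apply: divr_gt0.
have r1 : rho <= eta / 8 by rewrite ge_min lexx.
have r2 : rho * (n * (B * T ^+ 2)) <= eta ^+ 2.
  by rewrite -ler_pdivlMr// ge_min lexx orbT.
pose sd := - (2 * f' (m1 * (T / 2))).
have sd0 : 0 < sd.
  have h : 0 < m1 * (T / 2) by rewrite mulr_gt0// divr_gt0.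
  have := pot_d_lt0 fP h; rewrite /sd; lra.
have rho3 : 0 < rho / 3 by rewrite divr_gt0.
have [d1 d10 hd1] := modulus_small rho3.
have den2 : 0 < n * (T * M * sd) by do ! (apply: mulr_gt0 => //).
pose d := Num.min (T / 2) (Num.min d1 (eta ^+ 2 / (n * (T * M * sd)))).
have d0 : 0 < d.
  by rewrite !lt_min d10; apply/and3P; split => //; apply: divr_gt0.
have dT2 : d <= T / 2 by rewrite ge_min lexx.
have dd1 : d <= d1 by rewrite !ge_min lexx orbT.
have dsd : d * (n * (T * M * sd)) <= eta ^+ 2.
  by rewrite -ler_pdivlMr// !ge_min lexx !orbT.
have dT : d < T by lra.
have den3 : 0 < n * (T ^+ 2 * M) by do ! (apply: mulr_gt0 => //).
pose e := eta ^+ 2 / (n * (T ^+ 2 * M)); have e0 : 0 < e by exact: divr_gt0.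
have ee : e * (n * (T ^+ 2 * M)) = eta ^+ 2 by rewrite divfK// gt_eqF.
have [k1 k10 hk1] := force_small d0 e0.
have [k2 k20 hk2] := gap_small rho3.
have [k3 k30 hk3] := hB d d0.
exists (Num.min k1 (Num.min k2 k3)); first by rewrite !lt_min k10 k20.
pose S := sd * d.
have facts mu q1 q2 v1 v2 : mu < Num.min k1 (Num.min k2 k3) -> bounded_orbit mu q1 q2 v1 v2 ->
  [/\ forall t, d <= t < T -> - e <= mu * g' (q2 t - q1 t),
     `|v1 d + v2 d| <= S, q2 d - q1 d <= rho,
     forall t, d <= t < T -> `|v2 t| <= B * (T - t)
   & forall t, 0 <= t <= d -> `|q1 t - q1 d| <= rho /\ `|q2 t - q2 d| <= rho].
  rewrite !lt_min => /and3P[h1 h2 h3] bo.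
  have a1 := hk1 _ _ _ _ _ h1 bo; have a2 := hk2 _ _ _ _ _ h2 bo; have a3 := hk3 _ _ _ _ _ h3 bo.
  have q1ge := first_ge bo; have [mu_gt0 o [md1 md2] _ _] := bo.
  have md t : 0 <= t <= d -> `|q1 t - q1 d| <= rho / 3 /\ `|q2 t - q2 d| <= rho / 3.
    move=> /andP[t0 td].
    have dI : 0 <= d <= T by rewrite !ltW.
    have tI : 0 <= t <= T by rewrite t0 (le_trans td)// ltW.
    have tdd : `|t - d| <= d1 by rewrite ler0_norm; lra.
    by split; apply: hd1.
  split => //.
  - have pb : 0 < m1 * (T / 2) by rewrite mulr_gt0// divr_gt0.
    have hb t : 0 <= t <= d -> m1 * (T / 2) <= q1 t.
      move=> /andP[t0 td]; apply: le_trans (q1ge t _); last by rewrite t0 (le_trans td)// ltW.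
      by rewrite ler_pM2l//; lra.
    have := orbit_sum_velocity fP o (ltW d0) dT hb pb => /andP[b1 b2].
    have S0 : 0 <= S by rewrite mulr_ge0// ltW.
    rewrite ler_norml; apply/andP; split; last lra.
    by rewrite /S /sd; lra.
  - have [] := md 0; first by rewrite lexx ltW.
    rewrite !ler_norml => /andP[b1 b2] /andP[b3 b4]; lra.
  - move=> t tI; have [b1 b2] := md t tI.
    by split; [apply: le_trans b1 _|apply: le_trans b2 _]; lra.
move=> mu nu q1 q2 v1 v2 r1' r2' u1 u2 hmu hnu bo bo'.
have [f1 f2 f3 f4 f5] := facts _ _ _ _ _ hmu bo.
have [g1 g2 g3 g4 g5] := facts _ _ _ _ _ hnu bo'.
have [mu_gt0 o _ q2M _] := bo; have [nu_gt0 o' _ r2M _] := bo'.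
have S0 : 0 <= S by rewrite mulr_ge0// ltW.
apply: (orbit_comparison T0 mu_gt0 nu_gt0 fP gP o o' d0 dT (ltW e0) S0 (ltW rho0) (ltW B0) eta0 q2M r2M f1 g1 f2 g2 f3 g3 f4 g4 f5 g5).
  move: r2 dsd ee; rewrite !nE /S; lra.
lra.
Qed.

End uniform.

(** * The limit orbit *)

Section antiderivatives.
Variable R : realType.
Implicit Types (a c t s y T : R) (h : R -> R).

Lemma antiderivative h a c : (forall t, t < c -> {for t, continuous h}) ->
  exists G : R -> R, forall t, a <= t < c -> is_derive t (1 : R) G (h t).
Proof.
(* the lower bound a - 1 makes a an interior point *)
move=> hc; exists (fun x => \int[lebesgue_measure]_(s in `[a - 1, x]) h s).
move=> t /andP[at' tc]; pose u := (t + c) / 2.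
have tu : t < u by rewrite /u; lra.
have uc : u < c by rewrite /u; lra.
have ui : lebesgue_measure.-integrable `[a - 1, u] (EFin \o h).
  apply: continuous_compact_integrable; first exact: segment_compact.
  apply: continuous_in_subspaceT => s; rewrite inE/= in_itv/= => /andP[_ su].
  by apply: hc; exact: le_lt_trans su uc.
have at1 : a - 1 < t by lra.
have [] := @continuous_FTC1_closed R h (a - 1) t u tu ui at1 (hc t tc).
by move=> h1 h2; split; [exact: h1|rewrite -derive1E; exact: h2].
Qed.

(** A curve with a given acceleration, to be compared with the orbits. *)
Lemma double_antiderivative h c t0 y0 : (forall t, t < c -> {for t, continuous h}) ->
  exists Y V : R -> R, [/\ forall t, 0 <= t < c -> is_derive t (1 : R) Y (V t),
    forall t, 0 <= t < c -> is_derive t (1 : R) V (h t), V t0 = 0 & Y t0 = y0].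
Proof.
move=> hc; have [G Gd] := antiderivative 0 hc.
pose V t := G t - G t0.
have Vd t : 0 <= t < c -> is_derive t (1 : R) V (h t).
  by move=> tc; have h1 := Gd t tc; apply: is_derive_eq; rewrite subr0.
have [c0|c0] := leP c 0.
  exists (fun=> y0), V; split => //; last by rewrite /V subrr.
  by move=> t /andP[t0' tc]; have := lt_le_trans tc c0; rewrite ltNge t0'.
have Wc t : t < c -> {for t, continuous (fun t => V (Num.max 0 t))}.
  move=> tc; apply: continuous_comp.
    by apply: continuous_max; [exact: cvg_cst|exact: cvg_id].
  have mc : 0 <= Num.max 0 t < c by rewrite le_max lexx/= gt_max c0.
  exact: is_derive_continuous (Vd _ mc).
have [H Hd] := antiderivative 0 Wc.
exists (fun t => H t - H t0 + y0), V; split => //.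
- move=> t tc; have h1 := Hd t tc.
  have -> : V t = V (Num.max 0 t) by move: tc => /andP[/max_idPr -> _].
  by apply: is_derive_eq; rewrite subr0 addr0.
- by rewrite /V subrr.
- by rewrite subrr add0r.
Qed.

(** Composition with clamp T extends a continuous function on [0, T] to the line. *)
Definition clamp T t := Num.max 0 (Num.min t T).

Lemma clamp_itv T t : 0 <= T -> 0 <= clamp T t <= T.
Proof. by move=> T0; rewrite /clamp le_max lexx/= ge_max T0 ge_min lexx orbT. Qed.

Lemma clamp_id T t : 0 <= t <= T -> clamp T t = t.
Proof. by move=> /andP[t0 tT]; rewrite /clamp (min_idPl tT) (max_idPr t0). Qed.

Lemma clamp_lt T t : 0 < T -> t < T -> clamp T t < T.
Proof. by move=> T0 tT; rewrite /clamp gt_max T0 gt_min tT. Qed.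

Lemma clamp_continuous T : continuous (clamp T).
Proof.
move=> t; have h : {for t, continuous (fun s : R => Num.max 0 (Num.min s T))}.
  apply: continuous_max; first exact: cvg_cst.
  by apply: continuous_min; [exact: cvg_id|exact: cvg_cst].
exact: h.
Qed.

End antiderivatives.

Section comparison.
Variable R : realType.
Implicit Types (t d T B : R) (y v a : R -> R).

Lemma zero_start_bound y v a T b B : 0 < T -> b < T -> 0 <= B -> v 0 = 0 ->
  (forall t, 0 <= t <= b -> is_derive t (1 : R) y (v t)) ->
  (forall t, 0 <= t <= b -> is_derive t (1 : R) v (a t)) ->
  (forall t, 0 <= t <= b -> `|a t| <= B) ->
  forall t, 0 <= t <= b -> `|y t - y 0| <= B * T * T.
Proof.
move=> T0 bT B0 v0 yd vd hB.
have vB t : 0 <= t <= b -> - (B * T) <= v t <= B * T.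
  move=> /andP[t0 tb].
  have hd h : 0 <= h <= t -> is_derive h (1 : R) v (a h).
    by move=> /andP[h0 ht]; apply: vd; rewrite h0 (le_trans ht).
  have hb h : 0 < h < t -> - B <= a h <= B.
    by move=> /andP[h0 ht]; rewrite -ler_norml; apply: hB; rewrite (ltW h0) (le_trans (ltW ht)).
  have b1 := deriv_ge_lin t0 hd (fun h hI => (andP (hb h hI)).1).
  have b2 := deriv_le_lin t0 hd (fun h hI => (andP (hb h hI)).2).
  have b3 : B * t <= B * T by apply: ler_wpM2l => //; lra.
  by apply/andP; split; move: b1 b2; rewrite v0 subr0; lra.
move=> t /andP[t0 tb].
have hd h : 0 <= h <= t -> is_derive h (1 : R) y (v h).
  by move=> /andP[h0 ht]; apply: yd; rewrite h0 (le_trans ht).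
have hb h : 0 < h < t -> - (B * T) <= v h <= B * T.
  by move=> /andP[h0 ht]; apply: vB; rewrite (ltW h0) (le_trans (ltW ht)).
have b1 := deriv_ge_lin t0 hd (fun h hI => (andP (hb h hI)).1).
have b2 := deriv_le_lin t0 hd (fun h hI => (andP (hb h hI)).2).
have b3 : B * T * t <= B * T * T by apply: ler_wpM2l; [rewrite mulr_ge0// ltW|lra].
rewrite ler_norml; apply/andP; split; move: b1 b2; rewrite subr0; lra.
Qed.

Lemma zero_end_bound y v a T d B : 0 < T -> 0 <= d -> 0 <= B ->
  {within `[0, T], continuous y} -> derivative_within `[0, T] y T 0 ->
  (forall t, d <= t < T -> is_derive t (1 : R) y (v t)) ->
  (forall t, d <= t < T -> is_derive t (1 : R) v (a t)) ->
  (forall t, d <= t < T -> `|a t| <= B) ->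
  forall t, d <= t <= T -> `|y t - y T| <= B * T * T.
Proof.
move=> T0 d0 B0 yc slope yd vd hB t /andP[dt].
have BT : 0 <= B * T by rewrite mulr_ge0// ltW.
rewrite le_eqVlt => /predU1P[->|tT].
  by rewrite subrr normr0 mulr_ge0// ltW.
have t0 : 0 <= t by exact: le_trans dt.
have [c /andP[tc cT] ec] : exists2 c, t < c < T & y T - y t = v c * (T - t).
  apply: (mean_value_within tT (within_sub t0 (lexx T) yc)) => h /andP[th hT].
  by apply: yd; rewrite hT (le_trans dt (ltW th)).
have vc : `|v c| <= B * (T - c).
  apply: (zero_end_velocity d0 B0 yc slope yd vd hB).
  by rewrite cT (le_trans dt (ltW tc)).
rewrite distrC ec normrM (@ger0_norm _ (T - t)); last by rewrite subr_ge0 ltW.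
apply: ler_pM => //; [by rewrite subr_ge0 ltW| |by lra].
by apply: le_trans vc _; apply: ler_wpM2l => //; lra.
Qed.

Lemma derivative_within_sub D x y t (c k : R) :
  derivative_within D x t c -> derivative_within D y t k ->
  derivative_within D (fun s => x s - y s) t (c - k).
Proof.
move=> hx hy; rewrite /derivative_within.
have -> : (fun s => (x s - y s - (x t - y t)) / (s - t)) =
    (fun s => (x s - x t) / (s - t) - (y s - y t) / (s - t)).
  by apply/funext => s; rewrite -mulrBl; congr (_ / _); ring.
exact: cvgB.
Qed.

Lemma le_small (x k : R) : 0 <= k -> (forall e, 0 < e -> x <= e * k) -> x <= 0.
Proof.
move=> k0 h; apply/ler_addgt0Pr => e e0; rewrite add0r.
have k1 : 0 < k + 1 by lra.
apply: le_trans (h _ (divr_gt0 e0 k1)) _.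
rewrite mulrAC ler_pdivrMr// ler_pM2l//; lra.
Qed.

End comparison.

Section limit.
Variables (R : realType) (f g : R -> R) (T alpha K M c0 kap : R).
Implicit Types (t s mu e d : R).
Hypotheses (T0 : 0 < T) (alpha0 : 0 < alpha) (alpha2 : alpha < 2).
Hypotheses (fP : singular_potential f) (gP : singular_potential g).
Hypothesis g_alpha : forall s, 0 < s -> s * derive1 g s + alpha * g s <= 0.
Hypotheses (K0 : 0 < K) (M0 : 0 < M) (c00 : 0 < c0) (kap0 : 0 < kap).
Local Notation f' := (derive1 f).
Local Notation g' := (derive1 g).
Local Notation orbit := (bounded_orbit f g T K M c0 kap).
Hypothesis family : forall mu, 0 < mu -> mu <= 1 ->
  exists q : (R -> R) * (R -> R), exists v : (R -> R) * (R -> R), orbit mu q.1 q.2 v.1 v.2.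

Definition orbits_cvg (x1 x2 : R -> R) := forall eta, 0 < eta -> exists2 mu0, 0 < mu0 &
  forall mu q1 q2 v1 v2, mu < mu0 -> orbit mu q1 q2 v1 v2 ->
  forall t, 0 <= t <= T -> `|q1 t - x1 t| <= eta /\ `|q2 t - x2 t| <= eta.

(** The whole family is Cauchy as mu tends to 0, so the sequence mu = 1 / (n + 1)
    yields the limit of the family. *)
Lemma orbits_limit : exists x1 x2, orbits_cvg x1 x2.
Proof.
have cau := orbits_cauchy T0 alpha0 alpha2 fP gP g_alpha K0 M0 c00 kap0.
have : forall n : nat, exists p : ((R -> R) * (R -> R)) * ((R -> R) * (R -> R)),
    orbit (n.+1%:R^-1) p.1.1 p.1.2 p.2.1 p.2.2.
  move=> n; have h1 : 0 < n.+1%:R^-1 :> R by rewrite invr_gt0 ltr0n.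
  have h2 : n.+1%:R^-1 <= 1 :> R by rewrite invf_le1 ?ltr0n// ler1n.
  by have [q [v h]] := family h1 h2; exists (q, v).
move=> /choice[p hp].
have seq0 e : 0 < e -> \forall n \near \oo, n.+1%:R^-1 < e :> R.
  by move=> e0; exact: near_infty_natSinv_lt (PosNum e0).
have conv (F : (R -> R) * (R -> R) -> R -> R) :
   (forall e, 0 < e -> exists2 mu0, 0 < mu0 &
     forall mu nu q1 q2 v1 v2 r1 r2 u1 u2, mu < mu0 -> nu < mu0 -> orbit mu q1 q2 v1 v2 -> orbit nu r1 r2 u1 u2 ->
      forall t, 0 <= t <= T -> `|F (q1, q2) t - F (r1, r2) t| <= e) ->
   exists x, forall e, 0 < e -> exists2 mu0, 0 < mu0 &
     forall mu q1 q2 v1 v2, mu < mu0 -> orbit mu q1 q2 v1 v2 ->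
      forall t, 0 <= t <= T -> `|F (q1, q2) t - x t| <= e.
  move=> hF; exists (fun t => lim ((fun n => F (p n).1 t) @ \oo)).
  move=> e e0; have [mu0 mu00 hmu0] := hF e e0; exists mu0 => //.
  move=> mu q1 q2 v1 v2 hmu o t tT.
  have cv : cvg ((fun n => F (p n).1 t) @ \oo).
    apply: cauchy_cvg; apply: cauchy_exP => r r0.
    have r20 : 0 < r / 2 by rewrite divr_gt0.
    have [mu1 mu10 hmu1] := hF _ r20.
    have [N _ hN] := seq0 _ mu10.
    exists (F (p N).1 t); exists N => //= n nN.
    have := hmu1 _ _ _ _ _ _ _ _ _ _ (hN N (leqnn N)) (hN n nN) (hp N) (hp n) t tT.
    rewrite -!surjective_pairing /ball/= => /le_lt_trans; apply; lra.
  apply/ler_addgt0Pr => r r0.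
  have near_lim : \forall n \near \oo, `|lim ((fun n => F (p n).1 t) @ \oo) - F (p n).1 t| < r.
    by move/cvgrPdist_lt : cv; exact.
  have [n [h1 h2]] := filter_ex (filterI (seq0 _ mu00) near_lim).
  have := hmu0 _ _ _ _ _ _ _ _ _ _ hmu h1 o (hp n) t tT.
  rewrite -surjective_pairing => h3.
  have -> : F (q1, q2) t - lim ((fun n => F (p n).1 t) @ \oo) =
    (F (q1, q2) t - F (p n).1 t) - (lim ((fun n => F (p n).1 t) @ \oo) - F (p n).1 t) by ring.
  by apply: le_trans (ler_normB _ _) _; apply: lerD => //; exact: ltW.
have [|x1 h1] := conv fst.
  move=> e e0; have [mu0 mu00 h] := cau e e0; exists mu0 => //.
  move=> mu nu q1 q2 v1 v2 r1 r2 u1 u2 l1 l2 o1 o2 t tT.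
  exact: (h mu nu q1 q2 v1 v2 r1 r2 u1 u2 l1 l2 o1 o2 t tT).1.
have [|x2 h2] := conv snd.
  move=> e e0; have [mu0 mu00 h] := cau e e0; exists mu0 => //.
  move=> mu nu q1 q2 v1 v2 r1 r2 u1 u2 l1 l2 o1 o2 t tT.
  exact: (h mu nu q1 q2 v1 v2 r1 r2 u1 u2 l1 l2 o1 o2 t tT).2.
exists x1, x2 => e e0.
have [m1 m10 k1] := h1 e e0; have [m2 m20 k2] := h2 e e0.
exists (Num.min m1 m2); first by rewrite lt_min m10.
move=> mu q1 q2 v1 v2; rewrite lt_min => /andP[a b] o t tT; split.
  exact: (k1 _ _ _ _ _ a o t tT).
exact: (k2 _ _ _ _ _ b o t tT).
Qed.

Section facts.
Variables x1 x2 : R -> R.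
Hypothesis xP : orbits_cvg x1 x2.

(** Estimates pass to the limit through such a member of the family. *)
Lemma near_limit e mu1 : 0 < e -> 0 < mu1 -> exists mu q1 q2 v1 v2,
  [/\ mu < mu1, orbit mu q1 q2 v1 v2 &
  forall t, 0 <= t <= T -> `|q1 t - x1 t| <= e /\ `|q2 t - x2 t| <= e].
Proof.
move=> e0 mu10; have [mu2 mu20 h] := xP e0.
pose nu := Num.min 1 (Num.min mu1 mu2 / 2).
have nu0 : 0 < nu by rewrite lt_min ltr01 divr_gt0// lt_min mu10.
have nu1 : nu <= 1 by rewrite ge_min lexx.
have h3 : Num.min mu1 mu2 / 2 < Num.min mu1 mu2.
  by have : 0 < Num.min mu1 mu2 by [rewrite lt_min mu10]; lra.
have h4 : nu <= Num.min mu1 mu2 / 2 by rewrite ge_min lexx orbT.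
have := le_lt_trans h4 h3; rewrite lt_min => /andP[l1 l2].
have [[q1 q2] [[v1 v2] o]] := family nu0 nu1.
by exists nu, q1, q2, v1, v2; split => // t tT; exact: (h _ _ _ _ _ l2 o).
Qed.

Let inT t : 0 <= t -> t <= T -> 0 <= t <= T. Proof. by move=> -> ->. Qed.

Lemma limit_modulus : modulus_bound T K x1 /\ modulus_bound T K x2.
Proof.
split=> k s t k0 s0 st tT; apply/ler_addgt0Pr => e e0.
  have e2 : 0 < e / 2 by rewrite divr_gt0.
  have [mu [q1 [q2 [v1 [v2 [_ [_ _ [h _] _ _] c]]]]]] := near_limit e2 ltr01.
  have := h k s t k0 s0 st tT.
  have [+ _] := c s (inT s0 (le_trans st tT)); have [+ _] := c t (inT (le_trans s0 st) tT).
  by rewrite !ler_norml => /andP[? ?] /andP[? ?] /andP[? ?]; apply/andP; split; lra.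
have e2 : 0 < e / 2 by rewrite divr_gt0.
have [mu [q1 [q2 [v1 [v2 [_ [_ _ [_ h] _ _] c]]]]]] := near_limit e2 ltr01.
have := h k s t k0 s0 st tT.
have [_ +] := c s (inT s0 (le_trans st tT)); have [_ +] := c t (inT (le_trans s0 st) tT).
by rewrite !ler_norml => /andP[? ?] /andP[? ?] /andP[? ?]; apply/andP; split; lra.
Qed.

Lemma modulus_continuous x : modulus_bound T K x -> continuous (fun t => x (clamp T t)).
Proof.
move=> xm t; apply/cvgrPdist_le => e e0.
have [d d0 hd] := modulus_small T K0 e0.
have /cvgrPdist_le/(_ _ d0) := @clamp_continuous R T t.
apply: filterS => s hs; apply: (hd x xm); [exact/clamp_itv/ltW|exact/clamp_itv/ltW|exact: hs].
Qed.

Lemma limit_end : x1 T = 0.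
Proof.
apply/eqP; rewrite -normr_le0; apply/ler_addgt0Pr => e e0; rewrite add0r.
have [mu [q1 [q2 [v1 [v2 [_ [_ o _ _ _] c]]]]]] := near_limit e0 ltr01.
have [h _] := c T (inT (ltW T0) (lexx T)).
by move: h; rewrite (fo_q1T o) sub0r normrN.
Qed.

Lemma limit_start : x1 0 = x2 0.
Proof.
apply/eqP; rewrite -subr_eq0 -normr_le0; apply: (@le_small _ _ 3) => // e e0.
have [mu0 mu00 hz] := gap_small K c0 kap T0 fP gP M0 e0.
have [mu [q1 [q2 [v1 [v2 [mu1 o c]]]]]] := near_limit e0 mu00.
have h1 := hz _ _ _ _ _ mu1 o.
have [mup fo _ _ _] := o.
have h0 : 0 <= (0 : R) < T by rewrite lexx T0.
have /andP[_ h2] := fo_pos fo h0.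
have [] := c 0 (inT (lexx 0) (ltW T0)).
by rewrite !ler_norml => /andP[? ?] /andP[? ?]; apply/andP; split; lra.
Qed.

Lemma limit_first_ge : exists2 m, 0 < m & forall t, 0 <= t <= T -> m * (T - t) <= x1 t.
Proof.
have T0' := T0; have Q0 : 0 < (K + T) / 2 by rewrite divr_gt0// addr_gt0.
exists (- f' ((K + T) / 2) * (T / 2)).
  by rewrite mulr_gt0 ?divr_gt0// oppr_gt0; exact: (pot_d_lt0 fP).
move=> t tT; apply/ler_addgt0Pr => e e0.
have [mu [q1 [q2 [v1 [v2 [_ o c]]]]]] := near_limit e0 ltr01.
have h := first_ge T0 fP gP o tT.
by have [] := c t tT; rewrite ler_norml => /andP[? ?] _; lra.
Qed.

Lemma limit_second_bounds : exists m mu0, [/\ 0 < m, 0 < mu0, m <= M,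
  (forall mu q1 q2 v1 v2, mu < mu0 -> orbit mu q1 q2 v1 v2 ->
     forall t, 0 <= t <= T -> m <= q2 t) &
  forall t, 0 <= t <= T -> m <= x2 t <= M].
Proof.
have [sig [m [mu0 [_ m0 mu00 h]]]] := uniform_bounds T0 alpha0 alpha2 fP gP g_alpha K0 M0 c00 kap0.
have B t : 0 <= t <= T -> m <= x2 t <= M.
  move=> tT; apply/andP; split; apply/ler_addgt0Pr => e e0;
  have [mu [q1 [q2 [v1 [v2 [mu1 o c]]]]]] := near_limit e0 mu00;
  have [_ /(_ t tT) h1] := h _ _ _ _ _ mu1 o; have [_ _ _ /(_ t tT) h2 _] := o;
  by have [_] := c t tT; rewrite ler_norml => /andP[? ?]; lra.
exists m, mu0; split => //.
  by have /andP[a b] := B T (inT (ltW T0) (lexx T)); exact: le_trans b.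
by move=> mu q1 q2 v1 v2 hmu o t tT; have [_] := h _ _ _ _ _ hmu o; apply.
Qed.

Lemma force_lipschitz m : 0 < m -> m <= M -> exists2 L, 0 <= L &
  forall a b, m <= a <= M -> m <= b <= M -> `|f' a - f' b| <= L * `|a - b|.
Proof.
move=> m0 mM; have [L L0 hL] := pot_d_lipschitz fP m0 mM; exists L => //.
have H a b : m <= a -> a <= b -> b <= M -> `|f' b - f' a| <= L * `|b - a|.
  move=> ma ab bM; rewrite !ger0_norm ?subr_ge0//; first exact: hL.
  by apply: (pot_d_nd fP) => //; exact: lt_le_trans ma.
move=> a b /andP[ma aM] /andP[mb bM]; have [ab|/ltW ba] := leP a b; last exact: H.
by rewrite distrC (distrC a); exact: H.
Qed.

(** The curve Y has acceleration f' x2, velocity 0 at T, and the value x2 T there.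
    After any positive time the coupling is weak, and q2 has almost the same data. *)
Lemma limit_second : exists Y V : R -> R,
  [/\ forall t, 0 <= t <= T -> is_derive t (1 : R) Y (V t),
      forall t, 0 <= t <= T -> is_derive t (1 : R) V (f' (x2 t)),
      V T = 0 & forall t, 0 <= t <= T -> x2 t = Y t].
Proof.
have T0' := T0; have T2 : 0 <= T * T by rewrite mulr_ge0 ?ltW.
have [m [mu0 [m0 mu00 mM mq mx]]] := limit_second_bounds.
have [_ x2c] := limit_modulus; have {}x2c := modulus_continuous x2c.
have hc t : t < T + 1 -> {for t, continuous (f' \o (fun t => x2 (clamp T t)))}.
  move=> _; apply: continuous_comp; first exact: x2c.
  apply: (pot_d_continuous fP); have /mx/andP[+ _] := clamp_itv t (ltW T0).
  exact: lt_le_trans.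
have [Y [V [Yd Vd VT YT]]] := double_antiderivative T (x2 T) hc.
have {}Yd t : 0 <= t <= T -> is_derive t (1 : R) Y (V t).
  by move=> /andP[t0 tT]; apply: Yd; rewrite t0; lra.
have {}Vd t : 0 <= t <= T -> is_derive t (1 : R) V (f' (x2 t)).
  move=> tT; rewrite -[in x2 t](clamp_id tT); apply: Vd.
  by move: tT => /andP[t0 tT]; rewrite t0; lra.
have [L L0 hL] := force_lipschitz m0 mM.
have L1 : 0 < L + 1 by lra.
have pos t : 0 < t <= T -> x2 t = Y t.
  move=> /andP[t0 tT]; apply/eqP; rewrite -subr_eq0 -normr_le0.
  have k0 : 0 <= 2 * (T * T) + 2 by lra.
  apply: (le_small k0) => e e0; pose eta := e / (L + 1).
  have eta0 : 0 < eta by rewrite divr_gt0.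
  have Leta : L * eta <= e.
    by rewrite /eta mulrCA -[leRHS]mulr1 ler_pM2l// ler_pdivrMr//; lra.
  have eta_e : eta <= e by rewrite /eta ler_pdivrMr// -[leLHS]mulr1 ler_pM2l//; lra.
  have [mu2 mu20 hf] := force_small T0 alpha0 alpha2 fP gP g_alpha K0 M0 c00 kap0 t0 e0.
  have mu3 : 0 < Num.min mu0 mu2 by rewrite lt_min mu00.
  have [mu [q1 [q2 [v1 [v2 [+ o c]]]]]] := near_limit eta0 mu3.
  rewrite lt_min => /andP[l1 l2]; have {}mq := mq _ _ _ _ _ l1 o.
  have {}hf := hf _ _ _ _ _ l2 o; have [mup fo _ q2M _] := o.
  have sI s : t <= s < T -> 0 <= s < T by move=> /andP[h1 ->]; rewrite (le_trans (ltW t0)).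
  have sI' s : t <= s < T -> 0 <= s <= T by move=> /sI /andP[-> /ltW ->].
  have B0 : 0 <= 2 * e by lra.
  have B : `|q2 t - Y t - (q2 T - Y T)| <= 2 * e * T * T.
    apply: (@zero_end_bound _ (fun s => q2 s - Y s) (fun s => v2 s - V s)
      (fun s => f' (q2 s) - mu * g' (q2 s - q1 s) - f' (x2 s)) T t (2 * e)) => //.
    - exact: ltW.
    - have Yc := is_derive_continuous_within Yd.
      by move=> s; apply: continuousB; [exact: (fo_c2 fo)|exact: Yc].
    - have YT' := is_derive_within `[0, T]%classic (Yd T (inT (ltW T0) (lexx T))).
      by have := derivative_within_sub (fo_slope fo) YT'; rewrite VT subrr.
    - move=> s /[dup] /sI sT /sI' sT'; have h1 := fo_q2 fo sT; have h2 := Yd s sT'.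
      by apply: is_derive_eq.
    - move=> s /[dup] /sI sT /sI' sT'; have h1 := fo_v2 fo sT; have h2 := Vd s sT'.
      by apply: is_derive_eq.
    - move=> s /[dup] sts /[dup] /sI sT /sI' sT'.
      have h1 : `|f' (q2 s) - f' (x2 s)| <= L * eta.
        apply: le_trans (hL _ _ _ (mx s sT')) _; first by rewrite mq//= q2M.
        by apply: ler_wpM2l => //; have [] := c s sT'.
      have h2 := hf s sts; have /andP[_ zs] := fo_pos fo sT.
      have h3 : mu * g' (q2 s - q1 s) <= 0.
        by rewrite pmulr_rle0//; apply: (pot_d_le0 gP); rewrite subr_gt0.
      by move: h1; rewrite !ler_norml => /andP[? ?]; apply/andP; split; lra.
    - by rewrite lexx.
  have [_] := c t (inT (ltW t0) tT); have [_] := c T (inT (ltW T0) (lexx T)).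
  move: B; rewrite YT !ler_norml -!mulrA => /andP[? ?] /andP[? ?] /andP[? ?].
  by apply/andP; split; lra.
exists Y, V; split => // t /andP[]; rewrite le_eqVlt => /predU1P[<- _|t0 tT]; last first.
  by apply: pos; rewrite t0.
apply/eqP; rewrite -subr_eq0 -normr_le0; apply/ler_addgt0Pr => e e0; rewrite add0r.
have e2 : 0 < e / 2 by rewrite divr_gt0.
have h0 : 0 <= (0 : R) <= T by rewrite lexx ltW.
have Yc : {for 0, continuous Y} by exact: (is_derive_continuous (Yd 0 h0)).
have /cvgrPdist_le/(_ _ e2)[r1 /= r10 k1] := Yc.
have /cvgrPdist_le/(_ _ e2)[r2 /= r20 k2] := x2c 0.
pose s := Num.min T (Num.min r1 r2 / 2).
have r0 : 0 < Num.min r1 r2 by rewrite lt_min r10.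
have s0 : 0 < s by rewrite lt_min T0 divr_gt0.
have sr : s < Num.min r1 r2.
  apply: le_lt_trans (_ : Num.min r1 r2 / 2 < _); last lra.
  by rewrite ge_min lexx orbT.
have sT : s <= T by rewrite ge_min lexx.
move: sr; rewrite lt_min => /andP[sr1 sr2].
have n1 : `|0 - s| < r1 by rewrite sub0r normrN gtr0_norm.
have n2 : `|0 - s| < r2 by rewrite sub0r normrN gtr0_norm.
have cs : clamp T s = s by rewrite clamp_id// ltW.
have es : x2 s = Y s by apply: pos; rewrite s0.
move: (k1 s n1) (k2 s n2); rewrite (clamp_id h0) cs es !ler_norml => /andP[? ?] /andP[? ?].
by apply/andP; split; lra.
Qed.

(** The coupling cancels in q1 + q2, so the comparison can start at the collision;
    it ends before T, where q1 reaches the singularity of f. *)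
Lemma limit_sum : exists C A : R -> R,
  [/\ forall t, 0 <= t < T -> is_derive t (1 : R) C (A t),
      forall t, 0 <= t < T -> is_derive t (1 : R) A (f' (x1 t) + f' (x2 t)),
      A 0 = 0 & forall t, 0 <= t < T -> x1 t + x2 t = C t].
Proof.
have T0' := T0; have T2 : 0 <= T * T by rewrite mulr_ge0 ?ltW.
have [m [mu0 [m0 mu00 mM mq mx]]] := limit_second_bounds.
have [m1 m10 x1ge] := limit_first_ge.
have [/modulus_continuous x1c /modulus_continuous x2c] := limit_modulus.
pose h t := f' (x1 (clamp T t)) + f' (x2 (clamp T t)).
have hc t : t < T -> {for t, continuous h}.
  move=> tT; have cI := clamp_itv t (ltW T0).
  have c1 : {for t, continuous (f' \o (fun t => x1 (clamp T t)))}.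
    apply: continuous_comp; first exact: x1c.
    apply: (pot_d_continuous fP); apply: lt_le_trans (x1ge _ cI).
    by rewrite mulr_gt0// subr_gt0 clamp_lt.
  have c2 : {for t, continuous (f' \o (fun t => x2 (clamp T t)))}.
    apply: continuous_comp; first exact: x2c.
    apply: (pot_d_continuous fP); have /mx/andP[+ _] := cI.
    exact: lt_le_trans.
  exact: (continuousD c1 c2).
have [C [A [Cd Ad A0 C0]]] := double_antiderivative 0 (x1 0 + x2 0) hc.
have {}Ad t : 0 <= t < T -> is_derive t (1 : R) A (f' (x1 t) + f' (x2 t)).
  move=> tT; have tI : 0 <= t <= T by move: tT => /andP[-> /ltW].
  by have := Ad t tT; rewrite /h (clamp_id tI).
exists C, A; split => // b bT; have /andP[b0 bT'] := bT.
apply/eqP; rewrite -subr_eq0 -normr_le0.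
pose m' := Num.min m (m1 * (T - b) / 2).
have mb0 : 0 < m1 * (T - b) by rewrite mulr_gt0// subr_gt0.
have m'0 : 0 < m' by rewrite lt_min m0 divr_gt0.
have m'm : m' <= m by rewrite ge_min lexx.
have m'b : m' <= m1 * (T - b) / 2 by rewrite ge_min lexx orbT.
have [L L0 hL] := force_lipschitz m'0 (le_trans m'm mM).
have k0 : 0 <= 2 * L * (T * T) + 4 by rewrite addr_ge0// !mulr_ge0// ltW.
pose e1 := m1 * (T - b) / 2; have e10 : 0 < e1 by rewrite divr_gt0.
apply: (le_small k0) => e' e'0; pose e := Num.min e' e1.
have e0 : 0 < e by rewrite lt_min e'0.
have ee' : e <= e' by rewrite ge_min lexx.
have ee1 : e <= e1 by rewrite ge_min lexx orbT.
suff : `|x1 b + x2 b - C b| <= e * (2 * L * (T * T) + 4).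
  by move=> /le_trans; apply; apply: ler_wpM2r.
have [mu [q1 [q2 [v1 [v2 [l1 o c]]]]]] := near_limit e0 mu00.
have {}mq := mq _ _ _ _ _ l1 o; have [mup fo _ q2M _] := o.
have sI s : 0 <= s <= b -> 0 <= s < T by move=> /andP[-> /le_lt_trans->].
have sI' s : 0 <= s <= b -> 0 <= s <= T by move=> /sI /andP[-> /ltW ->].
have B0 : 0 <= 2 * (L * e) by rewrite !mulr_ge0// ltW.
have x1b s : 0 <= s <= b -> m1 * (T - b) <= x1 s.
  move=> sb; apply: le_trans (x1ge s (sI' s sb)); rewrite ler_pM2l//.
  by move: sb => /andP[_ sb]; lra.
have B : `|q1 b + q2 b - C b - (q1 0 + q2 0 - C 0)| <= 2 * (L * e) * T * T.
  apply: (@zero_start_bound _ (fun s => q1 s + q2 s - C s) (fun s => v1 s + v2 s - A s)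
    (fun s => f' (q1 s) + f' (q2 s) - (f' (x1 s) + f' (x2 s))) T b (2 * (L * e))) => //.
  - by rewrite (fo_v10 fo) (fo_v20 fo) A0 subr0 addr0.
  - move=> s /sI sT; have h1 := fo_q1 fo sT; have h2 := fo_q2 fo sT; have h3 := Cd s sT.
    by apply: is_derive_eq.
  - move=> s /sI sT; have h1 := fo_v1 fo sT; have h2 := fo_v2 fo sT; have h3 := Ad s sT.
    by apply: is_derive_eq; ring.
  - move=> s sb; have sT' := sI' s sb; have [d1 d2] := c s sT'.
    have /andP[_ q12] := fo_pos fo (sI s sb); have q2m := mq s sT'; have q2M' := q2M s sT'.
    have /andP[x2m x2M] := mx s sT'; have x1b' := x1b s sb.
    have n1 : m' <= q1 s <= M.
      by move: d1; rewrite ler_norml => /andP[? ?]; apply/andP; split; rewrite /e1 in ee1; lra.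
    have x1M : x1 s <= M.
      apply/ler_addgt0Pr => r r0.
      have [nu [r1 [r2 [u1 [u2 [_ [_ p _ r2M _] c']]]]]] := near_limit r0 ltr01.
      have /andP[_ r12] := fo_pos p (sI s sb); have r2M' := r2M s sT'.
      by have [] := c' s sT'; rewrite ler_norml => /andP[? ?] _; lra.
    have n2 : m' <= x1 s <= M by apply/andP; split; lra.
    have n3 : m' <= q2 s <= M by apply/andP; split; lra.
    have n4 : m' <= x2 s <= M by apply/andP; split; lra.
    have g1 : `|f' (q1 s) - f' (x1 s)| <= L * e.
      by apply: le_trans (hL _ _ n1 n2) _; apply: ler_wpM2l.
    have g2 : `|f' (q2 s) - f' (x2 s)| <= L * e.
      by apply: le_trans (hL _ _ n3 n4) _; apply: ler_wpM2l.
    by move: g1 g2; rewrite !ler_norml => /andP[? ?] /andP[? ?]; apply/andP; split; lra.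
  - by rewrite b0 lexx.
have [+ +] := c b (inT b0 (ltW bT')); have [+ +] := c 0 (inT (lexx 0) (ltW T0)).
have -> : e * (2 * L * (T * T) + 4) = 2 * (L * e) * T * T + 4 * e by ring.
move: B; rewrite C0 !ler_norml => /andP[? ?] /andP[? ?] /andP[? ?] /andP[? ?] /andP[? ?].
by apply/andP; split; lra.
Qed.

End facts.

End limit.

(** * The brake orbit *)

Lemma is_derive_reversed (R : realType) (F : R -> R) (T t d : R) :
  is_derive (T - t) (1 : R) F d -> is_derive t (1 : R) (fun s => F (T - s)) (- d).
Proof.
move=> Fd; have e : is_derive t (1 : R) (fun s => T - s) (-1).
  by apply: is_derive_eq; rewrite /GRing.scale/=; ring.
have c := @is_derive1_comp R F (fun s => T - s) t d (-1) Fd e.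
by rewrite -mulrN1; exact: c.
Qed.

Lemma is_derive_shifted (R : realType) (F : R -> R) (T t d : R) :
  is_derive (t - T) (1 : R) F d -> is_derive t (1 : R) (fun s => F (s - T)) d.
Proof.
move=> Fd; have e : is_derive t (1 : R) (fun s => s - T) 1.
  by apply: is_derive_eq; rewrite /GRing.scale/=; ring.
have c := @is_derive1_comp R F (fun s => s - T) t d 1 Fd e.
by rewrite -[d]mulr1; exact: c.
Qed.

Section glued_orbit.
Variables (R : realType) (f : R -> R) (T : R) (x1 x2 Y V C A : R -> R).
Implicit Types t s : R.
Local Notation f' := (derive1 f).
Hypotheses (T0 : 0 < T) (fP : singular_potential f).
Hypotheses (x1c : continuous (fun t => x1 (clamp T t)))
  (x2c : continuous (fun t => x2 (clamp T t))).
Hypotheses (x10 : forall t, 0 <= t < T -> 0 < x1 t) (x20 : forall t, 0 <= t <= T -> 0 < x2 t).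
Hypotheses (x1T : x1 T = 0) (x12 : x1 0 = x2 0).
Hypotheses (Yd : forall t, 0 <= t <= T -> is_derive t (1 : R) Y (V t))
  (Vd : forall t, 0 <= t <= T -> is_derive t (1 : R) V (f' (x2 t)))
  (VT : V T = 0) (YE : forall t, 0 <= t <= T -> x2 t = Y t).
Hypotheses (Cd : forall t, 0 <= t < T -> is_derive t (1 : R) C (A t))
  (Ad : forall t, 0 <= t < T -> is_derive t (1 : R) A (f' (x1 t) + f' (x2 t)))
  (A0 : A 0 = 0) (CE : forall t, 0 <= t < T -> x1 t + x2 t = C t).

(** The first component backwards from its zero to the collision, which takes place
    at the time T of the glued orbit, and then the second component. *)
Definition glued_orbit : R -> R :=
  glue T (fun s => x1 (clamp T (T - s))) (fun s => x2 (clamp T (s - T))).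

Lemma glued_orbitL t : 0 <= t <= T -> glued_orbit t = x1 (T - t).
Proof.
move=> /andP[t0 tT]; have T0' := T0; have h0 : 0 <= (0 : R) <= T by rewrite lexx ltW.
have e : clamp T (T - t) = T - t by apply: clamp_id; apply/andP; split; lra.
move: tT; rewrite le_eqVlt => /predU1P[->|tT]; last by rewrite /glued_orbit glueL// e.
by rewrite /glued_orbit glueR// !subrr clamp_id.
Qed.

Lemma glued_orbitR t : T <= t <= 2 * T -> glued_orbit t = x2 (t - T).
Proof.
by move=> /andP[t0 tT]; rewrite /glued_orbit glueR// clamp_id//; apply/andP; split; lra.
Qed.

(** On the first piece the orbit is C - Y, reversed, and on the second it is Y.  The
    velocities V - A and V agree at the collision, because A 0 = 0: the total
    momentum vanishes there. *)
Lemma glued_orbit_brake : brake_orbit f T glued_orbit.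
Proof.
have T0' := T0; have h0 : 0 <= (0 : R) <= T by rewrite lexx ltW.
have h0' : 0 <= (0 : R) < T by rewrite lexx.
split.
- apply: continuous_subspaceT => t; apply: glue_continuous.
  + by rewrite subrr clamp_id// x12.
  + move=> _.
    have c : {for t, continuous ((fun s => x1 (clamp T s)) \o (fun s => T - s))}.
      apply: continuous_comp; last exact: x1c.
      by apply: continuousB; [exact: cst_continuous|exact: cvg_id].
    exact: c.
  + move=> _.
    have c : {for t, continuous ((fun s => x2 (clamp T s)) \o (fun s => s - T))}.
      apply: continuous_comp; last exact: x2c.
      by apply: continuousB; [exact: cvg_id|exact: cst_continuous].
    exact: c.
- by rewrite glued_orbitL// subr0.
- move=> t; rewrite in_itv/= => /andP[t0 tT]; have [tT'|Tt] := leP t T.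
    by rewrite glued_orbitL ?(ltW t0)//; apply: x10; apply/andP; split; lra.
  by rewrite glued_orbitR ?(ltW Tt)//; apply: x20; apply/andP; split; lra.
pose G s := C (T - s) - Y (T - s); pose H s := Y (s - T).
pose vG s := V (T - s) - A (T - s); pose vH s := V (s - T).
exists (glue T vG vH); split.
  rewrite glueR; last lra.
  by rewrite /vH (_ : 2 * T - T = T)//; ring.
move=> t tI; have := tI; rewrite in_itv/= => /andP[t0 tT].
have lt1 : t <= T -> 0 <= T - t < T by move=> ?; apply/andP; split; lra.
have lt2 : t <= T -> 0 <= T - t <= T by move=> ?; apply/andP; split; lra.
have gt1 : T <= t -> 0 <= t - T <= T by move=> ?; apply/andP; split; lra.
have vT : vG T = vH T by rewrite /vG /vH subrr A0 subr0.
have vL : t <= T -> glue T vG vH t = vG t.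
  rewrite le_eqVlt => /predU1P[->|?]; last by rewrite glueL.
  by rewrite glueR.
have vR : T <= t -> glue T vG vH t = vH t by move=> ?; rewrite glueR.
split.
- have d : is_derive t (1 : R) (glue T G H) (glue T vG vH t).
    apply: glue_is_derive.
    + by rewrite /G /H !subrr -CE// -YE// x12; ring.
    + move=> tT'; rewrite vL//.
      have c1 := is_derive_reversed (Cd (lt1 tT')).
      have c2 := is_derive_reversed (Yd (lt2 tT')).
      by apply: is_derive_eq; rewrite /vG /GRing.scale/=; ring.
    + move=> tT'; rewrite vR//.
      have c2 := is_derive_shifted (Yd (gt1 tT')).
      by apply: is_derive_eq; rewrite /vH /GRing.scale/=; ring.
  apply: (derivative_within_eq ltr01) (is_derive_within _ d) => //.
  move=> s; rewrite /= in_itv/= => /andP[s0 sT] _; have [sT'|Ts] := ltP s T.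
    rewrite glueL// glued_orbitL ?(ltW s0) ?ltW// /G -CE -?YE.
    + by ring.
    + by apply/andP; split; lra.
    + by apply/andP; split; lra.
  by rewrite glueR// glued_orbitR ?Ts// /H -YE//; apply/andP; split; lra.
- apply: is_derive_within; apply: glue_is_derive => //.
  + move=> tT'; rewrite glued_orbitL ?(ltW t0)//.
    have c1 := is_derive_reversed (Ad (lt1 tT')).
    have c2 := is_derive_reversed (Vd (lt2 tT')).
    by apply: is_derive_eq; rewrite /GRing.scale/=; ring.
  + move=> tT'; rewrite glued_orbitR ?tT'//.
    have c2 := is_derive_shifted (Vd (gt1 tT')).
    by apply: is_derive_eq; rewrite /GRing.scale/=; ring.
Qed.

Lemma glued_segment1 : brake_segment T glued_orbit x1.
Proof.
have T0' := T0; exists T, (-1); split; first by right.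
move=> t; rewrite !in_itv/= => /andP[t0 tT]; split; first by apply/andP; split; lra.
have e : T - (T + -1 * t) = t by ring.
by rewrite glued_orbitL ?e//; apply/andP; split; lra.
Qed.

Lemma glued_segment2 : brake_segment T glued_orbit x2.
Proof.
have T0' := T0; exists T, 1; split; first by left.
move=> t; rewrite !in_itv/= => /andP[t0 tT]; split; first by apply/andP; split; lra.
have e : T + 1 * t - T = t by ring.
by rewrite glued_orbitR ?e//; apply/andP; split; lra.
Qed.

(** The velocity V of the second component decreases to V T = 0, because f' < 0. *)
Lemma glued_slope : exists d : R,
  [/\ 0 < d, derivative_within `[0, T] x1 0 (- d) & derivative_within `[0, T] x2 0 d].
Proof.
have T0' := T0; have h0 : 0 <= (0 : R) <= T by rewrite lexx ltW.
have h0' : 0 <= (0 : R) < T by rewrite lexx.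
have D0 : `[0, T]%classic (0 : R) by rewrite /= in_itv/=.
exists (V 0); split.
- have [c /andP[c0 cT]] := mean_value T0 Vd; rewrite VT subr0 sub0r => e.
  have : f' (x2 c) * T < 0.
    by rewrite nmulr_rlt0//; apply: (pot_d_lt0 fP); apply: x20; rewrite !ltW.
  by rewrite -e oppr_lt0.
- have h1 := Cd h0'; have h2 := Yd h0.
  have d : is_derive (0 : R) (1 : R) (fun s => C s - Y s) (- V 0).
    by apply: is_derive_eq; rewrite A0 sub0r.
  apply: (derivative_within_eq T0) (is_derive_within _ d) => //.
  move=> s; rewrite /= in_itv/= subr0 => /andP[s0 sT].
  rewrite ger0_norm// => sT'; rewrite -CE ?s0// -YE ?s0//; ring.
- apply: (derivative_within_eq T0) (is_derive_within _ (Yd h0)) => //.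
  by move=> s; rewrite /= in_itv/= => sI _; rewrite YE.
Qed.

End glued_orbit.

Theorem theorem1p3 (R : realType) (T alpha sbar d0 : R) (f g : R -> R)
    (qmu : R -> (R -> R) * (R -> R))
    (T_gt0 : 0 < T)
    (f_sing : singular_potential f) (g_sing : singular_potential g)
    (alpha_gt0 : 0 < alpha) (alpha_lt2 : alpha < 2)
    (f_alpha : forall s, 0 < s -> 0 <= s * derive1 f s + alpha * f s)
    (g_alpha : forall s, 0 < s -> s * derive1 g s + alpha * g s <= 0)
    (sbar_gt0 : 0 < sbar) (g_sbar : 0 < g sbar) (g_lt_f : g sbar < f sbar)
    (d0_gt0 : 0 < d0)
    (qmuP : forall mu, 0 < mu -> mu <= 1 ->
       mountain_pass_orbit f g T d0 mu (qmu mu)) :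
  exists q1 q2 : R -> R,
    (forall K : set R, compact K -> K `<=` `]0, T[ ->
       {uniform K, (fun mu => (qmu mu).1) @ 0^'+ --> q1} /\
       {uniform K, (fun mu => (qmu mu).2) @ 0^'+ --> q2}) /\
    (exists qhat : R -> R,
       [/\ brake_orbit f T qhat, brake_segment T qhat q1
         & brake_segment T qhat q2]) /\
    q1 T = 0 /\
    q1 0 = q2 0 /\
    (exists d : R,
       [/\ 0 < d, derivative_within `[0, T] q1 0 (- d)
         & derivative_within `[0, T] q2 0 d]).
Proof.
have [K [M [c0 [kap [K0 M0 c00 kap0 bounds]]]]] :=
  orbit_bounds T_gt0 alpha_gt0 alpha_lt2 f_sing g_sing f_alpha g_alpha d0_gt0.
have modE x y : (forall t, 0 <= t <= T -> y t = x t) -> modulus_bound T K x -> modulus_bound T K y.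
  move=> xy h k s t k0 s0 st tT.
  by rewrite !xy ?s0 ?(le_trans s0 st) ?(le_trans st tT)//; exact: h.
have family0 mu : 0 < mu -> mu <= 1 -> exists Q1 Q2 V1 V2,
    (forall t, 0 <= t <= T -> Q1 t = (qmu mu).1 t /\ Q2 t = (qmu mu).2 t) /\
    bounded_orbit f g T K M c0 kap mu Q1 Q2 V1 V2.
  move=> mu0 mu1; have := qmuP mu mu0 mu1.
  case: (qmu mu) => q1 q2 /[dup] /(bounds mu _ mu0 mu1)[/= b1 b2 b3 b4 b5] [fo _].
  have [Q1 [Q2 [V1 [V2 [E o]]]]] := frozen_orbit_of f_sing g_sing T_gt0 mu0 fo b5.
  exists Q1, Q2, V1, V2; split => //; split => //.
  - by split; [apply: modE b1 => t /E[]|apply: modE b2 => t /E[]].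
  - by move=> t tT; have [_ ->] := E t tT; exact: b3.
  - move=> m m0 hm hc; apply: b4 => //.
      by move=> t tT; have [<- <-] := E t tT; exact: hm.
    by have [_ <-] := E T (introT andP (conj (ltW T_gt0) (lexx T))).
have family mu : 0 < mu -> mu <= 1 -> exists q v : (R -> R) * (R -> R),
    bounded_orbit f g T K M c0 kap mu q.1 q.2 v.1 v.2.
  move=> mu0 mu1; have [Q1 [Q2 [V1 [V2 [_ o]]]]] := family0 mu mu0 mu1.
  by exists (Q1, Q2), (V1, V2).
have [x1 [x2 xP]] := orbits_limit T_gt0 alpha_gt0 alpha_lt2 f_sing g_sing g_alpha K0 M0 c00 kap0 family.
have [Y [V [Yd Vd VT YE]]] := limit_second T_gt0 alpha_gt0 alpha_lt2 f_sing g_sing g_alpha K0 M0 c00 kap0 family xP.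
have [C [A [Cd Ad A0 CE]]] := limit_sum T_gt0 alpha_gt0 alpha_lt2 f_sing g_sing g_alpha K0 M0 c00 kap0 family xP.
have [m1 m10 x1ge] := limit_first_ge T_gt0 f_sing g_sing K0 family xP.
have [m [_ [m0 _ _ _ x2b]]] := limit_second_bounds T_gt0 alpha_gt0 alpha_lt2 f_sing g_sing g_alpha K0 M0 c00 kap0 family xP.
have x1T := limit_end T_gt0 family xP.
have x12 := limit_start T_gt0 f_sing g_sing M0 family xP.
have [x1m x2m] := limit_modulus family xP.
have x1c := modulus_continuous T_gt0 K0 x1m.
have x2c := modulus_continuous T_gt0 K0 x2m.
have x10 t : 0 <= t < T -> 0 < x1 t.
  move=> /andP[t0 tT]; apply: lt_le_trans (x1ge t _); last by rewrite t0 ltW.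
  by rewrite mulr_gt0// subr_gt0.
have x20 t : 0 <= t <= T -> 0 < x2 t by move=> /x2b /andP[+ _]; exact: lt_le_trans.
exists x1, x2; split.
  move=> D _ DT; have near0 e : 0 < e -> \forall mu \near 0^'+, forall t, D t ->
      `|x1 t - (qmu mu).1 t| < e /\ `|x2 t - (qmu mu).2 t| < e.
    move=> e0; have e2 : 0 < e / 2 by rewrite divr_gt0.
    have [mu0 mu00 h] := xP _ e2.
    have r0 : 0 < Num.min mu0 1 by rewrite lt_min mu00 ltr01.
    near=> mu => t Dt.
    have mup : 0 < mu by near: mu; exact: nbhs_right_gt.
    have : mu < Num.min mu0 1 by near: mu; exact: nbhs_right_lt.
    rewrite lt_min => /andP[l1 /ltW l2].
    have [Q1 [Q2 [V1 [V2 [E o]]]]] := family0 mu mup l2.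
    have tT : 0 <= t <= T.
      by have := DT t Dt; rewrite /= in_itv/= => /andP[/ltW -> /ltW ->].
    have [E1 E2] := E t tT; have [] := h mu Q1 Q2 V1 V2 l1 o t tT.
    by rewrite E1 E2 distrC (distrC (_ (qmu mu) t)); lra.
  by split; apply/uniform_cvg_dist => e e0; apply: filterS (near0 e e0) => mu H t Dt;
    have [] := H t Dt.
split.
  exists (glued_orbit T x1 x2); split.
  - exact: (@glued_orbit_brake _ f T x1 x2 Y V C A).
  - exact: glued_segment1.
  - exact: glued_segment2.
do 2 split => //.
exact: (@glued_slope _ f T x1 x2 Y V C A).
Unshelve. all: by end_near. Qed.
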